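(* Let $\phi$ be a continuous adapted cocycle on a Hilbert space $X$ satisfying Assumption A, and let $\pi$ be a continuous linear projection onto a finite-dimensional subspace $\pi(X)\cong\mathbb R^m$. Suppose that (1) the Gramian $M_t(u,V)$ is non-degenerate for some fixed $u\in X$, $t>0$ and some fixed $V\in\Omega_t$; and (2) $\phi$ is exactly controllable on $\pi(X)$, i.e. for all $u',v\in X$ and $r>0$ there is a piecewise linear $V'\in\Omega_r$ with $\pi(\phi_r(u',V'))=\pi(v)$. If for some $s>0$ the law of $\pi(\phi_{t+s}(u,W))$ has a density $p_{t+s}$ with respect to Lebesgue measure on $\mathbb R^m$, then $p_{t+s}(x)>0$ for Lebesgue-almost every $x\in\mathbb R^m$.
   Context: $\mathcal Z$ finite; $\Omega=\{V:\mathbb R\to\mathbb R^{|\mathcal Z|}$ continuous, $V(0)=0\}$ with two-sided Wiener measure $\mathbb P$, canonical process $W$, shift $\theta_sV(r)=V(r+s)-V(s)$; $\Omega_t$ the paths on $[0,t]$ with sup norm; $\mathcal H_t=\{H\in H^1([0,t];\mathbb R^{|\mathcal Z|}):H(0)=0\}$. A continuous adapted cocycle is a continuous $\phi:[0,\infty)\times X\times\Omega\to X$ with $\phi_0(u,V)=u$, $\phi_{t+s}(u,V)=\phi_t(\phi_s(u,V),\theta_sV)$, and $\phi_t(u,V)$ depending only on $V|_{[0,t]}$ (so $\phi_t$ is also a map on $X\times\Omega_t$). Fixed $\sigma_k\in X$. Assumption A: (i) $\phi_t(u,\cdot)$ Fr\'echet differentiable along $\mathcal H_t$ with derivative $D_w\phi$;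 (ii) $\phi_t(\cdot,V)$ Fr\'echet differentiable with $(t,u,V,\xi)\mapsto D_u\phi_t(u,V)\xi$ continuous; (iii) $D_u\phi_t(v,V)$ injective; (iv) $D_w\phi_t(u,V)H=\sum_k\int_0^tJ_{s,t}(u,V)\sigma_k\dot H_k(s)ds$ with $J_{s,t}(u,V)\xi=(D_u\phi_{t-s})(\phi_s(u,V),\theta_sV)\xi$; (v) $J^*_{s,t}(u,V)$ injective for $s\le t$. Gramian: $\langle M_t(u,V)\xi,\rho\rangle_X=\sum_k\int_0^t\langle J_{s,t}(u,V)\sigma_k,\xi\rangle_X\langle J_{s,t}(u,V)\sigma_k,\rho\rangle_Xds$; it is non-degenerate if $\langle M_t(u,V)\xi,\xi\rangle_X>0$ for all $\xi\ne0$. *)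

(* Defs.v *)
From HB Require Import structures.
From mathcomp Require Import all_boot all_order all_algebra.
From mathcomp Require Import all_classical all_reals all_analysis.
Set Implicit Arguments. Unset Strict Implicit. Unset Printing Implicit Defensive.
Import Order.TTheory GRing.Theory Num.Theory.
Import numFieldNormedType.Exports.
Local Open Scope classical_set_scope.
Local Open Scope ring_scope.

Section defs.
Variable R : realType.

(** ip is a real inner product inducing the norm of X (so that a complete
    normed space X with such an ip is a real Hilbert space). *)
Definition is_inner_product (X : normedModType R) (ip : X -> X -> R) : Prop :=
  [/\ forall x y, ip x y = ip y x,
      forall (a : R) x y z, ip (a *: x + y) z = a * ip x z + ip y z
    & forall x, ip x x = `|x| ^+ 2].

Definition bpath (n : nat) := R -> 'rV[R]_n.

Definition in_Omega n (V : bpath n) : Prop := continuous V /\ V 0 = 0.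

Definition shift n (s : R) (V : bpath n) : bpath n := fun r => V (r + s) - V s.

Definition loc_unif_cvg n (Vk : nat -> bpath n) (V : bpath n) : Prop :=
  forall Tm eps : R, 0 < eps ->
    \forall k \near \oo, forall r, `|r| <= Tm -> `|Vk k r - V r| < eps.

(** continuous adapted cocycle phi : [0,oo) x X x Omega -> X (the time
    argument is real; only t >= 0 is used). Continuity is stated sequentially
    (the domain is metrizable). *)
Definition is_cont_adapted_cocycle (X : normedModType R) n
    (phi : R -> X -> bpath n -> X) : Prop :=
  [/\ (forall u V, in_Omega V -> phi 0 u V = u),
      (forall t s u V, 0 <= t -> 0 <= s -> in_Omega V ->
         phi (t + s) u V = phi t (phi s u V) (shift s V)),
      (forall t u V V', 0 <= t -> in_Omega V -> in_Omega V' ->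
         (forall r, 0 <= r <= t -> V r = V' r) -> phi t u V = phi t u V')
    & (forall (tk : nat -> R) (uk : nat -> X) (Vk : nat -> bpath n)
              (t : R) (u : X) (V : bpath n),
         (forall k, 0 <= tk k) -> (forall k, in_Omega (Vk k)) ->
         0 <= t -> in_Omega V ->
         tk @ \oo --> t -> uk @ \oo --> u -> loc_unif_cvg Vk V ->
         (fun k => phi (tk k) (uk k) (Vk k)) @ \oo --> phi t u V)].

Definition Du (X : normedModType R) n (phi : R -> X -> bpath n -> X)
    (t : R) (u : X) (V : bpath n) : X -> X :=
  'd (fun w => phi t w V) u.

Definition Jst (X : normedModType R) n (phi : R -> X -> bpath n -> X)
    (s t : R) (u : X) (V : bpath n) : X -> X :=
  Du phi (t - s) (phi s u V) (shift s V).

Definition itv0 (t : R) : set R := [set x | 0 <= x <= t].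

Definition is_L2 (t : R) (h : R -> R) : Prop :=
  measurable_fun (itv0 t) h /\
  (\int[lebesgue_measure]_(x in itv0 t) ((h x) ^+ 2)%:E < +oo)%E.

(** Cameron-Martin path H(r) = int_0^r h (H in H_t, extended by H(t) after t
    and by 0 before 0), for h in L^2([0,t];R^n). *)
Definition CM_path n (t : R) (h : 'I_n -> R -> R) : bpath n :=
  fun r => \row_k (if r < 0 then 0
                   else Rintegral lebesgue_measure (itv0 (Num.min r t)) (h k)).

(** norm of H in H_t : ||Hdot||_{L^2} (equivalent to the H^1 norm as H(0)=0) *)
Definition normCM n (t : R) (h : 'I_n -> R -> R) : R :=
  Num.sqrt (\sum_(k < n) Rintegral lebesgue_measure (itv0 t) (fun x => (h k x) ^+ 2)).

Definition is_adjoint (X : normedModType R) (ip : X -> X -> R) (A Astar : X -> X) :=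
  forall x y, ip (A x) y = ip x (Astar y).

Definition assumptionA (X : normedModType R) (ip : X -> X -> R) n
    (sigma : 'I_n -> X) (phi : R -> X -> bpath n -> X) : Prop :=
  [/\ (* (i) + (iv): Frechet differentiability along H_t, with the derivative
         D_w phi_t(u,V) H = sum_k int_0^t J_{s,t}(u,V) sigma_k Hdot_k(s) ds
         (X-valued integral of a continuous integrand, stated weakly) *)
      (forall t u V, 0 < t -> in_Omega V ->
         exists Dw : ('I_n -> R -> R) -> X,
           (forall h, (forall k, is_L2 t (h k)) -> forall xi,
              ip (Dw h) xi = \sum_(k < n) Rintegral lebesgue_measure (itv0 t)
                   (fun s => ip (Jst phi s t u V (sigma k)) xi * h k s)) /\
           (forall eps, 0 < eps -> exists delta, 0 < delta /\
              forall h, (forall k, is_L2 t (h k)) -> normCM t h < delta ->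
                `|phi t u (fun r => V r + CM_path t h r) - phi t u V - Dw h|
                  <= eps * normCM t h)),
      (forall t u V, 0 <= t -> in_Omega V -> differentiable (fun w => phi t w V) u),
      (forall (tk : nat -> R) (uk : nat -> X) (Vk : nat -> bpath n) (xik : nat -> X)
              (t : R) (u : X) (V : bpath n) (xi : X),
         (forall k, 0 <= tk k) -> (forall k, in_Omega (Vk k)) ->
         0 <= t -> in_Omega V ->
         tk @ \oo --> t -> uk @ \oo --> u -> loc_unif_cvg Vk V -> xik @ \oo --> xi ->
         (fun k => Du phi (tk k) (uk k) (Vk k) (xik k)) @ \oo --> Du phi t u V xi),
      (forall t v V, 0 <= t -> in_Omega V -> injective (Du phi t v V))
    &
      (forall s t u V, 0 <= s <= t -> in_Omega V ->
         exists Jstar, is_adjoint ip (Jst phi s t u V) Jstar /\ injective Jstar)].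

(** < M_t(u,V) xi, rho > *)
Definition gramian (X : normedModType R) (ip : X -> X -> R) n
    (sigma : 'I_n -> X) (phi : R -> X -> bpath n -> X)
    (t : R) (u : X) (V : bpath n) (xi rho : X) : R :=
  \sum_(k < n) Rintegral lebesgue_measure (itv0 t)
     (fun s => ip (Jst phi s t u V (sigma k)) xi * ip (Jst phi s t u V (sigma k)) rho).

Definition gramian_nondegenerate (X : normedModType R) (ip : X -> X -> R) n
    (sigma : 'I_n -> X) (phi : R -> X -> bpath n -> X) (t : R) (u : X) (V : bpath n) :=
  forall xi, xi != 0 -> 0 < gramian ip sigma phi t u V xi xi.

Definition piecewise_linear_on n (r : R) (V : bpath n) : Prop :=
  exists (N : nat) (ts : nat -> R),
    [/\ ts 0%N = 0, ts N = r,
        (forall i, (i < N)%N -> ts i < ts i.+1)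
      & forall i x, (i < N)%N -> ts i <= x <= ts i.+1 ->
          V x = V (ts i) + ((x - ts i) / (ts i.+1 - ts i)) *: (V (ts i.+1) - V (ts i))].

Definition exactly_controllable (X : normedModType R) n m
    (phi : R -> X -> bpath n -> X) (pi : X -> 'rV[R]_m) : Prop :=
  forall (u' v : X) (r : R), 0 < r ->
    exists V' : bpath n, [/\ in_Omega V', piecewise_linear_on r V'
                          & pi (phi r u' V') = pi v].

Definition is_two_sided_BM d (T : measurableType d) (P : probability T R) n
    (W : T -> bpath n) : Prop :=
  [/\ (forall w, in_Omega (W w)),
      (forall r j, measurable_fun setT (fun w => W w r ord0 j))
    & forall (k : nat) (ts : nat -> R), (forall i, (i < k)%N -> ts i < ts i.+1) ->
        forall A : 'I_k -> 'I_n -> set R, (forall i j, measurable (A i j)) ->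
          P (\bigcap_(i in [set: 'I_k]) \bigcap_(j in [set: 'I_n])
               [set w | A i j (W w (ts i.+1) ord0 j - W w (ts i) ord0 j)]) =
          (\prod_(i < k) \prod_(j < n) normal_prob 0 (Num.sqrt (ts i.+1 - ts i)) (A i j))%E].

Definition rv2t m (v : 'rV[R]_m) : m.-tuple R := [tuple v ord0 i | i < m].

(** lam is Lebesgue measure on R^m (unique measure giving boxes their volume) *)
Definition is_lebesgue_Rm m (lam : {measure set (m.-tuple R) -> \bar R}) : Prop :=
  forall a b : 'I_m -> R, (forall i, a i <= b i) ->
    lam [set x | forall i, a i <= tnth x i <= b i] = (\prod_(i < m) (b i - a i))%:E.

Definition has_density d (T : measurableType d) (P : probability T R) m
    (lam : {measure set (m.-tuple R) -> \bar R}) (Y : T -> m.-tuple R)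
    (p : m.-tuple R -> R) : Prop :=
  [/\ measurable_fun setT p, (forall x, 0 <= p x)
    & forall A, measurable A ->
        P [set w | A (Y w)] = (\int[lam]_(x in A) (p x)%:E)%E].

End defs.

(* Main.v *)
(** Let [A] be the null set of the density and [F Z = pi (phi (t + s) u Z)], so
    that [F W] almost surely avoids [A].  Null events of the Wiener measure are
    stable under translation by polygonal paths (Cameron-Martin); this gives the
    support theorem and, by Fubini, for every [Zb] in [Omega] a single path [Z]
    uniformly close to [Zb] on [[0, t + s]] such that [F (Z + H_c)] avoids [A] for
    almost every [c], for any finite-dimensional family [H_c] of polygonal paths.
    Let [Zb] follow [V] up to time [t] and then a control steering to a given
    point [y].  Since [J_{r,t+s} = J_{t,t+s} J_{r,t}] and [J_{t,t+s}^*] is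
    injective, non-degeneracy of the Gramian at time [t] yields finitely many
    ramps along which the derivative of [F] at [Zb] has full rank, and the same
    remains true at [Z].  So, after a linear change of parameters,
    [c |-> F (Z + H_c)] is a contractive perturbation of a translation: it covers
    a ball around [y] and small cubes have preimages of comparable volume, hence
    [A] is null near [y].  *)

(* The reference path [Zb] is a single point of path space, about which an almost sure statement
   says nothing. So everything established at [Zb] must persist, with uniform constants, at all
   paths close to it, and every tube around [Zb] must have positive probability. The derivative
   along Cameron-Martin paths is given pointwise and in weak form. It is therefore paired with Riesz
   representatives of the coordinates of [pi], and the mean value theorem is applied to one real
   function at a time. The resulting Lipschitz bound takes the place of the inverse function theorem
   and of the change of variables formula: a contraction solves [g c = y], and a comparison of
   dyadic cubes transports null sets. The law of [W] is known only through independent increments.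
   Translations are built from ramps that stop at dyadic times: their density involves a single
   value of [W], their sums approximate every path of [Omega] on [[0, t + s]], and their integrals
   detect a continuous response that does not vanish. *)
Require Import Defs.
From HB Require Import structures.
From mathcomp Require Import all_boot all_order all_algebra.
From mathcomp Require Import all_classical all_reals all_analysis.
From mathcomp Require Import measurable_realfun.
From mathcomp Require Import ring lra.
Set Implicit Arguments. Unset Strict Implicit. Unset Printing Implicit Defensive.
Import Order.TTheory GRing.Theory Num.Theory.
Import numFieldNormedType.Exports.
Local Open Scope classical_set_scope.
Local Open Scope ring_scope.

(** * Gaussian measures *)

Section weighted_expectation.
Context d (T : measurableType d) d' (Y : measurableType d') (R : realType).
Local Open Scope ereal_scope.
Import HBNNSimple.

(** From indicators to simple functions to monotone limits. The weight [g] will be a product of the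
    remaining factors in the independence argument, and the normal density for Gaussian
    integrals. *)
Lemma integral_weight_comp (P : {measure set T -> \bar R}) (X : T -> Y) (g : T -> R)
    (mu : {measure set Y -> \bar R}) (C : R) (f : Y -> R) :
  measurable_fun setT X -> measurable_fun setT g -> (forall w, 0 <= g w)%R ->
  (0 <= C)%R ->
  (forall A, measurable A -> \int[P]_w (g w * \1_A (X w))%:E = C%:E * mu A) ->
  measurable_fun setT f -> (forall x, 0 <= f x)%R ->
  \int[P]_w (g w * f (X w))%:E = C%:E * \int[mu]_x (f x)%:E.
Proof.
move=> mX mg g0 C0 gC mf f0.
have mEf : measurable_fun setT (fun x => (f x)%:E) by exact/measurable_EFinP.
have simple (h : {nnsfun Y >-> R}) :
    \int[P]_w (g w * h (X w))%:E = C%:E * \int[mu]_x (h x)%:E.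
  transitivity (\sum_(k \in range h)
      \int[P]_w (g w * (k * \1_(h @^-1` [set k]) (X w)))%:E).
    under eq_integral do rewrite fimfunE mulr_fsumr -fsumEFin//.
    rewrite ge0_integral_fsum//.
    - move=> k; apply/measurable_EFinP/measurable_funM => //.
      apply: measurable_funM => //; apply: (measurableT_comp _ mX).
      exact: measurable_indic.
    - move=> k x _; rewrite lee_fin mulr_ge0//; have := nnfun_muleindic_ge0 h k (X x).
      by rewrite lee_fin.
  rewrite integral_nnsfun// patch_setT sintegralE ge0_mule_fsumr; last first.
    by move=> k; exact: nnsfun_mulemu_ge0.
  apply: eq_fsbigr => k /set_mem[x _ hxk].
  have k0 : (0 <= k)%R by rewrite -hxk.
  transitivity (\int[P]_w (k%:E * (g w * \1_(h @^-1` [set k]) (X w))%:E)).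
    by apply: eq_integral => w _; rewrite -EFinM; congr EFin; rewrite mulrCA.
  rewrite ge0_integralZl_EFin//.
  - by rewrite gC// muleCA.
  - by move=> w _; rewrite lee_fin mulr_ge0.
  - apply/measurable_EFinP/measurable_funM => //; apply: (measurableT_comp _ mX).
    exact: measurable_indic.
pose f_ := nnsfun_approx measurableT mEf.
have cf x : (f_ n x)%:E @[n --> \oo] --> (f x)%:E.
  by apply: cvg_nnsfun_approx => // y _; rewrite lee_fin.
have cL : \int[P]_w (g w * f_ n (X w))%:E @[n --> \oo]
    --> \int[P]_w (g w * f (X w))%:E.
  have -> : \int[P]_w (g w * f (X w))%:E =
      \int[P]_w (limn (fun n => (g w * f_ n (X w))%:E)).
    apply: eq_integral => w _; apply/esym/cvg_lim => //.
    by under eq_fun do rewrite EFinM; rewrite EFinM; apply: cvgeZl.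
  apply: cvg_monotone_convergence => //.
  - move=> n; apply/measurable_EFinP/measurable_funM => //.
    by apply: measurableT_comp.
  - by move=> n w _; rewrite lee_fin mulr_ge0.
  - move=> w _ a b ab; rewrite lee_fin ler_wpM2l//.
    exact/lefP/nd_nnsfun_approx.
have cR : \int[mu]_x (f_ n x)%:E @[n --> \oo] --> \int[mu]_x (f x)%:E.
  have -> : \int[mu]_x (f x)%:E = \int[mu]_x (limn (fun n => (f_ n x)%:E)).
    by apply: eq_integral => w _; apply/esym/cvg_lim.
  apply: cvg_monotone_convergence => //.
  - by move=> n; apply/measurable_EFinP.
  - by move=> n w _; rewrite lee_fin.
  - by move=> w _ a b ab; rewrite lee_fin; exact/lefP/nd_nnsfun_approx.
have cR' : C%:E * \int[mu]_x (f_ n x)%:E @[n --> \oo] --> C%:E * \int[mu]_x (f x)%:E.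
  exact: cvgeZl.
move: cL; under eq_fun do rewrite simple.
by move=> cL; apply: (cvg_unique _ cL cR').
Qed.

Lemma expectation_prod_indep (P : probability T R) (I : finType) (X : I -> T -> Y)
    (mu : I -> probability Y R) :
  (forall i, measurable_fun setT (X i)) ->
  (forall A : I -> set Y, (forall i, measurable (A i)) ->
    P [set w | forall i, A i (X i w)] = \prod_i mu i (A i)) ->
  forall f : I -> Y -> R, (forall i, measurable_fun setT (f i)) ->
  (forall i x, 0 <= f i x)%R -> (forall i, \int[mu i]_x (f i x)%:E < +oo) ->
  \int[P]_w (\prod_i f i (X i w))%:E = \prod_i \int[mu i]_x (f i x)%:E.
Proof.
move=> mX PX.
(* Induction on a list [s] containing every index whose factor is not yet an indicator. *)
suff: forall (s : seq I) (f : I -> Y -> R), (forall i, measurable_fun setT (f i)) ->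
  (forall i x, 0 <= f i x)%R -> (forall i, \int[mu i]_x (f i x)%:E < +oo) ->
  (forall i, i \notin s -> exists2 A, measurable A & f i = \1_A) ->
  \int[P]_w (\prod_i f i (X i w))%:E = \prod_i \int[mu i]_x (f i x)%:E.
  move=> H f mf f0 fi; apply: (H (enum I)) => // i.
  by rewrite mem_enum.
elim=> [|i s IH] f mf f0 fi fs.
  have /choice[A HA] : forall i, exists A, measurable A /\ f i = \1_A.
    by move=> i; have [//|A mA fA] := fs i; exists A.
  transitivity (\int[P]_w (\1_[set w | forall i, A i (X i w)] w)%:E).
    apply: eq_integral => w _; congr EFin.
    rewrite indicE; have [/set_mem Aw|/negP Aw] := boolP (_ \in _).
      rewrite big1// => j _; rewrite (HA j).2 indicE mem_set//; exact: Aw.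
    suff [j jw] : exists j, ~ A j (X j w).
      by rewrite (bigD1 j)//= (HA j).2 indicE memNset// mul0r.
    by apply/existsNP => h; apply: Aw; exact: mem_set.
  rewrite integral_indic//; last first.
    rewrite (_ : [set w | _] = \bigcap_(j in [set` predT]) (X j @^-1` A j)); last first.
      by apply/seteqP; split => w /= h j; [move=> _; exact: h|exact: h].
    apply: fin_bigcap_measurable => // j _; rewrite -[_ @^-1` _]setTI.
    by apply: mX => //; exact: (HA j).1.
  rewrite setIT; apply: etrans (PX A (fun j => (HA j).1)) _.
  apply: eq_bigr => j _; rewrite (HA j).2 integral_indic ?setIT//.
  exact: (HA j).1.
pose C := (\prod_(j | j != i) fine (\int[mu j]_x (f j x)%:E))%R.
have fin j : \int[mu j]_x (f j x)%:E = (fine (\int[mu j]_x (f j x)%:E))%:E.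
  rewrite fineK// ge0_fin_numE ?fi//; apply: integral_ge0 => x _.
  by rewrite lee_fin.
have CE : C%:E = \prod_(j | j != i) \int[mu j]_x (f j x)%:E.
  rewrite /C; under [RHS]eq_bigr do rewrite fin.
  by elim/big_rec2: _ => // j x y _ <-; rewrite EFinM.
rewrite (bigD1 i)//= -CE muleC.
under eq_integral do rewrite (bigD1 i)//= mulrC.
apply: (@integral_weight_comp P (X i) (fun w => \prod_(j | j != i) f j (X j w))%R) => //.
- under eq_fun do rewrite -big_filter.
  by apply: measurable_prod => j _; apply: measurableT_comp.
- by move=> w; apply: prodr_ge0.
- by apply: prodr_ge0 => j _; rewrite fine_ge0// integral_ge0// => x _; rewrite lee_fin.
(* Replacing factor [i] by an indicator reduces to the shorter list; this computes the law of [X i]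
   weighted by the other factors. *)
move=> A mA; pose f' j := if j == i then \1_A : Y -> R else f j.
have mf' j : measurable_fun setT (f' j).
  by rewrite /f'; case: ifP => // _; exact: measurable_indic.
transitivity (\int[P]_w (\prod_j f' j (X j w))%:E).
  apply: eq_integral => w _; congr EFin; rewrite [RHS](bigD1 i)//= mulrC.
  rewrite /f' eqxx; congr (_ * _)%R; apply: eq_bigr => j /negbTE ji.
  by rewrite ji.
rewrite IH//; last 3 first.
- by move=> j x; rewrite /f'; case: ifP => // _; rewrite indicE.
- move=> j; rewrite /f'; case: ifP => // _; rewrite integral_indic//.
  by rewrite setIT -ge0_fin_numE// fin_num_measure.
- move=> j js; rewrite /f'; case: ifPn => [_|ji]; first by exists A.
  by apply: fs; rewrite inE negb_or ji.
rewrite (bigD1 i)//= muleC; congr (_ * _).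
  rewrite CE; apply: eq_bigr => j /negbTE ji; apply: eq_integral => x _.
  by rewrite /f' ji.
by rewrite /f' eqxx integral_indic// setIT.
Qed.

End weighted_expectation.

Section image_measure.
Context d d' (T1 : measurableType d) (T2 : measurableType d') (R : realFieldType).

Definition image_measure (m : {measure set T1 -> \bar R}) (f : T1 -> T2)
    (mf : measurable_fun setT f) : {measure set T2 -> \bar R} :=
  measure_function_pushforward__canonical__measure_function_Measure m mf.

Lemma image_measureE m f (mf : measurable_fun setT f) (A : set T2) :
  image_measure m mf A = m (f @^-1` A).
Proof. by []. Qed.

End image_measure.

Section gaussian_shift.
Context (R : realType).
Local Open Scope ereal_scope.

(** By uniqueness of the measure that gives half-open intervals their length. *)
Lemma lebesgue_measure_shift (a : R) (A : set R) : measurable A ->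
  lebesgue_measure [set x | A (x + a)%R] = lebesgue_measure A.
Proof.
move=> mA.
have ma : measurable_fun [set: measurableTypeR R]
    ((fun x => x + a)%R : measurableTypeR R -> measurableTypeR R).
  exact: measurable_funD.
have H X : ocitv X -> lebesgue_measure X = image_measure lebesgue_measure ma X.
  case=> [[x y] _ <-] /=; change (lebesgue_measure `]x, y] = lebesgue_measure
    ((fun z => z + a)%R @^-1` `]x, y])).
rewrite (_ : _ @^-1` _ = `]x - a, y - a]%classic)%R; last first.
    by apply/seteqP; split => z /=; rewrite !in_itv/= ltrBlDr lerBrDr.
  rewrite [RHS](lebesgue_measure_itv `]x - a, y - a])%R lebesgue_measure_itv/=.
  rewrite !lte_fin ltrD2r; case: ifP => // _.
  by rewrite -!EFinD; congr EFin; ring.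
by rewrite [RHS](lebesgue_measure_unique H).
Qed.

Lemma integral_normal_prob (s : R) (f : R -> R) :
  measurable_fun setT f -> (forall x, 0 <= f x)%R ->
  \int[normal_prob 0 s]_x (f x)%:E =
  \int[lebesgue_measure]_x (normal_pdf 0 s x * f x)%:E.
Proof.
move=> mf f0; apply/esym; rewrite -[RHS]mul1e.
pose H := @integral_weight_comp _ _ _ (measurableTypeR R) R lebesgue_measure idfun
  (normal_pdf 0 s) (normal_prob 0 s) 1 f.
have mid : measurable_fun [set: measurableTypeR R] (idfun : _ -> measurableTypeR R).
  exact: measurable_id.
have mpdf : measurable_fun [set: measurableTypeR R] (normal_pdf 0 s).
  exact: measurable_normal_pdf.
apply: H => //; first by move=> w; exact: normal_pdf_ge0.
move=> A mA; rewrite mul1e /normal_prob [RHS]integral_mkcond.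
apply: eq_integral => x _; rewrite /= patchE indicE.
by case: ifP => _; rewrite ?mulr1 ?mulr0.
Qed.

(** One-dimensional Cameron-Martin formula: the exponential is the ratio of the normal densities at
    [x - a] and at [x]. *)
Lemma normal_prob_shift (s a : R) (A : set R) : s != 0%R -> measurable A ->
  normal_prob 0 s [set x | A (x + a)%R] =
  \int[normal_prob 0 s]_x (\1_A x * expR (a * x / s ^+ 2 - a ^+ 2 / (2 * s ^+ 2)))%:E.
Proof.
move=> s0 mA.
have mrho : measurable_fun [set: R]
    (fun x : R => expR (a * x / s ^+ 2 - a ^+ 2 / (2 * s ^+ 2)))%R.
  apply: measurableT_comp => //; apply: measurable_funB => //.
  rewrite (_ : (fun x => _) = ( *%R (a / s ^+ 2))%R); first exact: mulrl_measurable.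
  by apply/funext => x; rewrite mulrAC.
have ma : measurable_fun [set: measurableTypeR R]
    ((fun x => x + a)%R : measurableTypeR R -> measurableTypeR R).
  exact: measurable_funD.
have mf : measurable_fun [set: R]
    (fun x : R => \1_A x * expR (a * x / s ^+ 2 - a ^+ 2 / (2 * s ^+ 2)))%R.
  by apply: measurable_funM => //; exact: measurable_indic.
rewrite integral_normal_prob//.
pose G (x : R) := (normal_pdf 0 s (x - a) * \1_A x)%R.
have mG : measurable_fun setT G.
  apply: measurable_funM; last exact: measurable_indic.
  apply: (measurableT_comp (measurable_normal_pdf 0 s)).
  exact: measurable_funB.
transitivity (\int[lebesgue_measure]_x (G x)%:E); last first.
  apply: eq_integral => x _; congr EFin; rewrite /G !normal_pdfE//.
  have -> : normal_fun 0 s (x - a) =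
      (normal_fun 0 s x * expR (a * x / s ^+ 2 - a ^+ 2 / (2 * s ^+ 2)))%R.
    by rewrite /normal_fun -expRD; congr expR; field; rewrite s0.
  by ring.
transitivity (\int[image_measure lebesgue_measure ma]_x (G x)%:E); last first.
  apply: eq_measure_integral => B mB _.
  by rewrite image_measureE; exact: (lebesgue_measure_shift a mB).
have mEG : measurable_fun [set: measurableTypeR R] (fun x => (G x)%:E).
  exact/measurable_EFinP.
apply: etrans _ (esym (ge0_integral_pushforward ma lebesgue_measure measurableT
  mEG _)); last by move=> y _; rewrite lee_fin mulr_ge0 ?normal_pdf_ge0// indicE.
rewrite preimage_setT /normal_prob [LHS]integral_mkcond.
apply: eq_integral => x _; rewrite /G/= addrK patchE indicE.
have -> : (x \in [set x0 | A (x0 + a)%R]) = (x + a \in A)%R.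
  by apply/idP/idP => /set_mem h; apply/mem_set.
by case: ifP => _; rewrite ?mulr1 ?mulr0.
Qed.

End gaussian_shift.

(** * Dyadic cubes and Lebesgue null sets *)

Section floor_cubes.
Context (R : realType) (m : nat).
Implicit Types (N : nat) (x : m.-tuple R).

(** Index of the half-open dyadic cube of side [2 ^- N] containing [x]; preimages of sets of codes
    are the unions of such cubes. *)
Definition floor_code N x : {ffun 'I_m -> int} :=
  [ffun i => Num.floor (2 ^+ N * tnth x i)].

Lemma floor_code_coarsen N N' x y : (N <= N')%N ->
  floor_code N' x = floor_code N' y -> floor_code N x = floor_code N y.
Proof.
move=> NN' /ffunP h; apply/ffunP => i; have := h i; rewrite !ffunE => {}h.
(* An integer lower bound at level [N] is an integer lower bound at level [N'], so the finer floor
   determines the coarser one. *)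
have key (z : R) (k : int) : (k <= Num.floor (2 ^+ N * z)) =
    (k * 2 ^+ (N' - N) <= Num.floor (2 ^+ N' * z)).
  rewrite !floor_ge_int intrM rmorphXn/= -{2}(subnK NN') exprD -mulrA.
  by rewrite [X in _ = (X <= _)]mulrC ler_pM2l ?exprn_gt0.
by apply/eqP; rewrite eq_le; apply/andP; split; [rewrite key -h -key|rewrite key h -key].
Qed.

Lemma measurable_floor_code N (I : set {ffun 'I_m -> int}) :
  measurable (floor_code N @^-1` I).
Proof.
have -> : floor_code N @^-1` I =
    \bigcup_(z : {ffun 'I_m -> int}) [set x | I z /\ floor_code N x = z].
  apply/seteqP; split => x /=; first by move=> Ix; exists (floor_code N x).
  by move=> [z _ [Iz ->]].
apply: countable_bigcupT_measurable; first exact: countableP.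
move=> z; have [Iz|Iz] := pselect (I z); last first.
  rewrite (_ : [set _ | _] = set0)//.
  by apply/seteqP; split => // x [].
rewrite (_ : [set _ | _] = \bigcap_(i in [set` predT])
    ((fun x : m.-tuple R => 2 ^+ N * tnth x i) @^-1` `[(z i)%:~R, (z i + 1)%:~R[)).
  apply: fin_bigcap_measurable => // i _; rewrite -[_ @^-1` _]setTI.
  have mf : measurable_fun setT (fun x : m.-tuple R => 2 ^+ N * tnth x i).
    by apply: measurable_funM => //; exact: measurable_tnth.
  by apply: mf => //; exact: measurable_itv.
apply/seteqP; split => x /=.
  move=> [_ <-] i _ /=; rewrite in_itv/= ffunE.
  exact: floor_itv.
move=> h; split => //; apply/ffunP => i; rewrite ffunE; apply/eqP.
by have := h i isT; rewrite /= in_itv/= -floor_eq.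
Qed.

Section approximation.
Variable kap : {measure set (m.-tuple R) -> \bar R}.
Hypothesis kfin : (kap setT < +oo)%E.
Variable N0 : nat.

Let sd (S D : set (m.-tuple R)) := (S `\` D) `|` (D `\` S).

Let msd S D : measurable S -> measurable D -> measurable (sd S D).
Proof. by move=> mS mD; apply: measurableU; exact: measurableD. Qed.

(** The level is kept above [N0] because two measures will be compared on small cubes only. *)
Definition floor_approximable S := measurable S /\
  forall e : R, 0 < e -> exists N I, (N0 <= N)%N /\
    (kap (sd S (floor_code N @^-1` I)) <= e%:E)%E.

Lemma floor_approximable_code N I : (N0 <= N)%N ->
  floor_approximable (floor_code N @^-1` I).
Proof.
move=> NN; split; first exact: measurable_floor_code.
move=> e e0; exists N, I; split => //.
by rewrite /sd setDv setU0 measure0 lee_fin ltW.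
Qed.

Lemma floor_approximableC S : floor_approximable S -> floor_approximable (~` S).
Proof.
move=> [mS aS]; split; first exact: measurableC.
move=> e /aS[N [I [NN h]]]; exists N, (~` I); split => //.
rewrite preimage_setC (_ : sd _ _ = sd S (floor_code N @^-1` I))//.
rewrite /sd !setDE !setCK setUC; congr (_ `|` _); exact: setIC.
Qed.

Lemma floor_approximableU S S' : floor_approximable S -> floor_approximable S' ->
  floor_approximable (S `|` S').
Proof.
move=> [mS aS] [mS' aS']; split; first exact: measurableU.
move=> e e0; have e2 : 0 < e / 2 by rewrite divr_gt0.
have [N [I [NN h]]] := aS _ e2; have [N' [I' [NN' h']]] := aS' _ e2.
(* A union of cubes is also a union of cubes of any finer level, so both approximants can be put on
   a common level. *)
have coarse M K : (M <= maxn N N')%N -> exists K',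
    floor_code M @^-1` K = floor_code (maxn N N') @^-1` K'.
  move=> MN; exists (floor_code (maxn N N') @` (floor_code M @^-1` K)).
  apply/seteqP; split => x /=; first by move=> Kx; exists x.
  by move=> [y Ky /(floor_code_coarsen MN)] <-.
have [K DK] := coarse _ I (leq_maxl _ _).
have [K' DK'] := coarse _ I' (leq_maxr _ _).
exists (maxn N N'), (K `|` K'); split; first by rewrite leq_max NN.
rewrite preimage_setU -DK -DK'.
set D := floor_code N @^-1` I; set D' := floor_code N' @^-1` I'.
have mD : measurable D := measurable_floor_code N I.
have mD' : measurable D' := measurable_floor_code N' I'.
apply: (@le_trans _ _ (kap (sd S D `|` sd S' D'))).
  apply: le_measure; rewrite ?inE.
  - by apply: msd; apply: measurableU.
  - by apply: measurableU; apply: msd.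
  - move=> x; rewrite /sd /=; tauto.
apply: le_trans (measureU2 _ _ _) _; try exact: msd.
by rewrite [e]splitr EFinD leeD.
Qed.

Lemma floor_approximable_bigcup (F : (set (m.-tuple R))^nat) :
  (forall k, floor_approximable (F k)) -> floor_approximable (\bigcup_k F k).
Proof.
move=> aF; have mF k : measurable (F k) := (aF k).1.
have mU : measurable (\bigcup_k F k) by apply: bigcupT_measurable.
split => // e e0; have e2 : 0 < e / 2 by rewrite divr_gt0.
pose S n := \big[setU/set0]_(k < n) F k.
have aS n : floor_approximable (S n).
  rewrite /S; elim: n => [|n IH].
    rewrite big_ord0 -(preimage_set0 (floor_code N0)).
    exact: floor_approximable_code.
  by rewrite big_ord_recr/=; exact: floor_approximableU.
have mS n : measurable (S n) := (aS n).1.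
(* The tails [G n] decrease to the empty set, so finiteness of [kap] makes one of them small; a
   finite union is left to approximate. *)
pose G n := \bigcup_k F k `\` S n.
have mG n : measurable (G n) by apply: measurableD.
have G0 : \bigcap_n G n = set0.
  apply/seteqP; split => // x Gx.
  have [[k _ Fkx] _] := Gx 0%N I.
  have [_] := Gx k.+1 I; apply; rewrite /S big_ord_recr/=; by right.
have cG : kap (G n) @[n --> \oo] --> (0 : R)%:E.
  have -> : ((0 : R)%:E = kap (\bigcap_n G n))%E by rewrite G0 measure0.
  apply: nonincreasing_cvg_mu => //.
  - by apply: le_lt_trans kfin; apply: le_measure; rewrite ?inE.
  - by rewrite G0.
  - move=> a b ab; apply/subsetPset => x [Ux nSx]; split => //.
    by move=> Sx; apply: nSx; apply: (subset_bigsetU _ Sx).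
have [n Gn] : exists n, (kap (G n) <= (e / 2)%:E)%E.
  have /fine_cvgP[fG /cvgrPdist_lt/(_ _ e2) cG'] := cG.
  near \oo => n; exists n.
  have fn : kap (G n) \is a fin_num by near: n.
  rewrite -(fineK fn) lee_fin.
  have : `|0 - fine (kap (G n))| < e / 2 by near: n.
  by rewrite sub0r normrN => /ltW; apply: le_trans; exact: ler_norm.
have [N [I [NN h]]] := (aS n).2 _ e2.
exists N, I; split => //; set D := floor_code N @^-1` I.
have mD : measurable D := measurable_floor_code N I.
apply: (@le_trans _ _ (kap (G n `|` sd (S n) D))).
  apply: le_measure; rewrite ?inE.
  - exact: msd.
  - by apply: measurableU => //; apply: msd.
  - move=> x; rewrite /sd /G /= => -[[Ux nDx]|[Dx nUx]].
      have [Sx|Sx] := pselect (S n x); first by right; left.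
      by left.
    right; right; split => // Sx; apply: nUx.
    by move: Sx; rewrite /S -bigcup_mkord => -[k _ Fk]; exists k.
apply: le_trans (measureU2 _ _ _) _ => //; first exact: msd.
by rewrite [e]splitr EFinD leeD.
Unshelve. all: by end_near. Qed.

Lemma floor_approximable_gt i (a : R) :
  floor_approximable [set x | a < tnth x i].
Proof.
have -> : [set x : m.-tuple R | a < tnth x i] =
    \bigcup_N (floor_code (N0 + N) @^-1` [set z | 2 ^+ (N0 + N) * a < (z i)%:~R]).
  apply/seteqP; split => x /=; last first.
    move=> [N _] /=; rewrite ffunE => h.
    have := lt_le_trans h (floor_le _); by rewrite ltr_pM2l ?exprn_gt0.
  (* At level [N0 + K] the side is at most [tnth x i - a], so the lower face of the cube of [x] lies
     beyond [a]. *)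
  move=> ax; pose K := Num.bound (tnth x i - a)^-1.
  exists K => //=; rewrite ffunE.
  have /andP[_ h] := floor_itv (2 ^+ (N0 + K) * tnth x i).
  have h2 : 1 <= 2 ^+ (N0 + K) * (tnth x i - a).
    rewrite -ler_pdivrMr ?subr_gt0// mul1r.
    have /archi_boundP/ltW/le_trans : 0 <= (tnth x i - a)^-1.
      by rewrite invr_ge0 subr_ge0 ltW.
    apply; rewrite -/K -natrX ler_nat (leq_trans (leq_addl N0 K))//.
    exact/ltnW/ltn_expl.
  move: h h2; rewrite intrD mulrBr; lra.
apply: floor_approximable_bigcup => N; apply: floor_approximable_code.
exact: leq_addr.
Qed.

(** The approximable sets form a sigma-algebra containing the open half-spaces orthogonal to the
    axes, which generate the product sigma-algebra. *)
Lemma measurable_floor_approximable S : measurable S -> floor_approximable S.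
Proof.
have a0 : floor_approximable set0.
  rewrite -(preimage_set0 (floor_code N0)); exact: floor_approximable_code.
move: S; change (g_sigma_preimage (fun i (x : m.-tuple R) => tnth x i) `<=` floor_approximable).
apply: smallest_sub.
  split => //; first by move=> A; rewrite setTD; exact: floor_approximableC.
  exact: floor_approximable_bigcup.
move=> A; rewrite -bigcup_seq => -[i _ [B mB <-]]; rewrite setTI.
move: B mB; change ((@ocitv R).-sigma.-measurable `<=` [set B | floor_approximable ((@tnth _ R ^~ i) @^-1` B)]).
rewrite RGenOInfty.measurableE.
apply: smallest_sub.
  split => //=.
  - by move=> A' aA'; rewrite setTD preimage_setC; exact: floor_approximableC.
  - by move=> F aF /=; rewrite preimage_bigcup; exact: floor_approximable_bigcup.
move=> _ [a ->] /=.
rewrite (_ : _ @^-1` _ = [set x | a < tnth x i]); first exact: floor_approximable_gt.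
by apply/seteqP; split => x /=; rewrite in_itv/= andbT.
Qed.

End approximation.
End floor_cubes.

Section cube_comparison.
Context (R : realType) (m : nat).
Variables mu nu : {measure set (m.-tuple R) -> \bar R}.
Hypotheses (mufin : (mu setT < +oo)%E) (nufin : (nu setT < +oo)%E).
Variables (C : R) (N0 : nat).
Hypothesis C0 : 0 <= C.
Hypothesis cubeC : forall N z, (N0 <= N)%N ->
  (mu (@floor_code R m N @^-1` [set z]) <= C%:E * nu (@floor_code R m N @^-1` [set z]))%E.

Let codeC N I : (N0 <= N)%N ->
  (mu (@floor_code R m N @^-1` I) <= C%:E * nu (@floor_code R m N @^-1` I))%E.
Proof.
move=> NN.
(* Each [I_ k] holds at most one code, which splits [I] into a sequence of single cubes. *)
pose I_ k := [set z | I z /\ pickle z = k].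
have -> : @floor_code R m N @^-1` I = \bigcup_k (@floor_code R m N @^-1` (I_ k)).
  apply/seteqP; split => x /=; first by move=> Ix; exists (pickle (floor_code N x)).
  by move=> [k _ []].
have mF k : measurable (@floor_code R m N @^-1` (I_ k)) := measurable_floor_code N _.
have tF : trivIset setT (fun k => @floor_code R m N @^-1` (I_ k)).
  by move=> i j _ _ [x [[_ <-] [_ <-]]].
rewrite !measure_bigcup// -nneseriesZl//.
apply: lee_nneseries => // k _.
have [[z [Iz zk]]|nz] := pselect (exists z, I_ k z).
  suff -> : I_ k = [set z] by exact: cubeC.
  apply/seteqP; split => y /=; last by move=> ->.
  by move=> [_]; rewrite -zk => /(pcan_inj pickleK).
suff -> : I_ k = set0 by rewrite preimage_set0 !measure0 mule0.
by apply/seteqP; split => // z Iz; apply: nz; exists z.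
Qed.

(** The bound on cubes extends to countable unions of cubes of one level, and such a union
    approximates [S]. *)
Lemma null_of_cube_le S : measurable S -> nu S = 0%E -> mu S = 0%E.
Proof.
move=> mS nuS; apply/eqP; rewrite eq_le measure_ge0 andbT.
apply/lee_addgt0Pr => e e0; rewrite add0e.
(* Approximating for the sum makes one union of cubes close to [S] for both measures at once. *)
pose kap : {measure set (m.-tuple R) -> \bar R} := measure_add mu nu.
have kapE B : kap B = (mu B + nu B)%E by exact: measure_addE.
have kfin : (kap setT < +oo)%E by rewrite kapE lte_add_pinfty.
have [_ aS] := @measurable_floor_approximable R m kap kfin N0 S mS.
have C1 : 0 < C + 1 by rewrite ltr_pwDr.
(* With [e' = e / (C + 1)] the final bound [C * e' + e'] equals [e]. *)
have [N [I [NN]]] := aS (e / (C + 1)) (divr_gt0 e0 C1).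
set D := _ @^-1` I => h.
have mD : measurable D := measurable_floor_code N I.
have msd : measurable (S `\` D `|` D `\` S).
  by apply: measurableU; exact: measurableD.
have h1 : (mu (S `\` D `|` D `\` S) <= (e / (C + 1))%:E)%E.
  by apply: le_trans h; rewrite kapE leeDl.
have h2 : (nu (S `\` D `|` D `\` S) <= (e / (C + 1))%:E)%E.
  by apply: le_trans h; rewrite kapE leeDr.
have muS : (mu S <= mu D + (e / (C + 1))%:E)%E.
  apply: (@le_trans _ _ (mu (D `|` (S `\` D `|` D `\` S)))).
    apply: le_measure; rewrite ?inE//; first exact: measurableU.
    by move=> x Sx; have [Dx|Dx] := pselect (D x); [left|right; left].
  by apply: le_trans (measureU2 _ _ _) _ => //; rewrite leeD2l.
have nuD : (nu D <= (e / (C + 1))%:E)%E.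
  apply: (@le_trans _ _ (nu (S `|` (S `\` D `|` D `\` S)))).
    apply: le_measure; rewrite ?inE//; first exact: measurableU.
    by move=> x Dx; have [Sx|Sx] := pselect (S x); [left|right; right].
  have nuS0 : (nu S <= 0)%E by rewrite nuS.
  by apply: le_trans (measureU2 _ _ _) _ => //; rewrite -[leRHS]add0e; apply: leeD.
apply: le_trans muS _; apply: (@le_trans _ _ (C%:E * (e / (C + 1))%:E + (e / (C + 1))%:E)%E).
  by rewrite leeD2r// (le_trans (codeC _ NN))// lee_wpmul2l// lee_fin.
rewrite -EFinM -EFinD lee_fin -{2}[e / _]mul1r -mulrDl mulrCA divff ?mulr1//.
by rewrite gt_eqF.
Qed.

End cube_comparison.

(** Registers matrices as complete, so that the Banach fixed point theorem applies to row
    vectors. *)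
HB.instance Definition _ (R : realType) (m n : nat) := Complete.on 'M[R]_(m, n).

(** * Contractive perturbations of translations and null sets of R^m *)

Section row_vectors.
Context (R : realType) (m : nat).

Definition t2rv (x : m.-tuple R) : 'rV[R]_m := \row_i tnth x i.

Lemma rV_norm_leP (v : 'rV[R]_m) (r : R) : 0 <= r ->
  (`|v| <= r) <-> (forall i, `|v ord0 i| <= r).
Proof.
move=> r0; rewrite [`|v|]mx_normrE; split.
  by move=> /bigmax_leP[_ h] i; exact: (h (ord0, i)).
move=> h; apply/bigmax_leP; split => // -[i j] _ /=.
by rewrite (ord1 i).
Qed.

Lemma rV_coord_le (v : 'rV[R]_m) i : `|v ord0 i| <= `|v|.
Proof. by have := (rV_norm_leP v (normr_ge0 _)).1 (lexx _) i. Qed.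

Definition tbox (a b : 'I_m -> R) := [set x : m.-tuple R | forall i, a i <= tnth x i <= b i].

Lemma measurable_tbox a b : measurable (tbox a b).
Proof.
rewrite (_ : tbox a b = \bigcap_(i in [set` predT]) ((@tnth m R ^~ i) @^-1` `[a i, b i])).
  apply: fin_bigcap_measurable => // i _; rewrite -[_ @^-1` _]setTI.
  exact: (@measurable_tnth _ R m i measurableT _ (measurable_itv _)).
apply/seteqP; split => x h i => [_|]; first by rewrite /= in_itv/=; exact: h.
by have := h i isT; rewrite /= in_itv/=.
Qed.

Definition tball (y : 'rV[R]_m) (r : R) := [set x : m.-tuple R | `|t2rv x - y| <= r].

Lemma tballE y r : 0 <= r ->
  tball y r = tbox (fun i => y ord0 i - r) (fun i => y ord0 i + r).
Proof.
move=> r0; apply/seteqP; split => x /=.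
  move=> /(rV_norm_leP _ r0) h i; have := h i.
  by rewrite !mxE ler_distl.
by move=> h; apply/(rV_norm_leP _ r0) => i; rewrite !mxE ler_distl; exact: h.
Qed.

Lemma measurable_tball y r : 0 <= r -> measurable (tball y r).
Proof. by move=> r0; rewrite tballE//; exact: measurable_tbox. Qed.

(** Substitute for an invertible derivative: this bound can be made uniform over all paths close to
    a given one, and it yields both surjectivity and volume estimates. *)
Definition half_lipschitz_dev (g : 'rV[R]_m -> 'rV[R]_m) (delta : R) :=
  forall c c', `|c| <= delta -> `|c'| <= delta ->
    `|g c - g c' - (c - c')| <= `|c - c'| / 2.

(** Solutions are the fixed points of [f c = c - g c + y], a contraction of ratio 1/2. The ball of
    radius [delta / 2] is stable under [f] because [f 0] has norm at most [delta / 4]. *)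
Lemma half_lipschitz_dev_surj g delta y : 0 < delta ->
  half_lipschitz_dev g delta -> `|g 0 - y| <= delta / 4 ->
  exists c, `|c| <= delta / 2 /\ g c = y.
Proof.
move=> d0 gd gy; pose U := [set c : 'rV[R]_m | `|c| <= delta / 2].
pose f c := c - g c + y.
have fctr c c' : U c -> U c' -> `|f c - f c'| <= 2^-1 * `|c - c'|.
  move=> Uc Uc'.
  have -> : f c - f c' = - (g c - g c' - (c - c')).
    by rewrite /f; apply/rowP => i; rewrite !mxE; ring.
  rewrite normrN mulrC; apply: gd.
    by apply: le_trans Uc _; lra.
  by apply: le_trans Uc' _; lra.
have U0 : U 0 by rewrite /U/= normr0; lra.
have fU : set_fun U U f.
  move=> c Uc; rewrite /U/=; rewrite -(subrK (f 0) (f c)).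
  apply: le_trans (ler_normD _ _) _.
  have h1 := fctr _ _ Uc U0; rewrite subr0 in h1.
  have h2 : `|f 0| <= delta / 4.
    by rewrite /f sub0r addrC distrC.
  have h3 : `|c| <= delta / 2 := Uc.
  lra.
pose F : {fun U >-> U} := HB.pack f (isFun.Build _ _ U U f fU).
have Fctr : is_contraction F.
  exists (2^-1)%:nng; split => /=; first by lra.
  by move=> [c c'] [/= Uc Uc']; exact: fctr.
have Ucl : closed U.
  rewrite (_ : U = (fun c : 'rV[R]_m => `|c|) @^-1` [set r | r <= delta / 2])//.
  apply: preimage_closed; last exact: closed_le.
  by move=> c _; exact: norm_continuous.
have [c Uc cf] := @banach_fixed_point R ('rV[R]_m : completeNormedModType R)
  U F Fctr Ucl (ex_intro _ 0 U0).
exists c; split => //.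
have {}cf : c = c - g c + y := cf.
by apply: (@addrI _ (c - g c)); rewrite -cf subrK.
Qed.

Variable lam : {measure set (m.-tuple R) -> \bar R}.
Hypothesis lamP : is_lebesgue_Rm lam.

Lemma exp2N_small (r : R) : 0 < r -> exists N0, forall N, (N0 <= N)%N -> (2 ^+ N)^-1 <= r.
Proof.
move=> r0; exists (Num.bound r^-1) => N NN.
rewrite -[r]invrK lef_pV2 ?posrE ?exprn_gt0 ?invr_gt0//.
have /archi_boundP/ltW/le_trans : 0 <= r^-1 by rewrite invr_ge0 ltW.
apply; rewrite -natrX ler_nat (leq_trans NN)//; exact/ltnW/ltn_expl.
Qed.

Lemma lam_tball y r : 0 <= r -> lam (tball y r) = ((r *+ 2) ^+ m)%:E.
Proof.
move=> r0; rewrite tballE// lamP; last by move=> i; lra.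
rewrite (eq_bigr (fun=> r *+ 2)) => [|i _]; first by rewrite prodr_const card_ord.
by rewrite mulr2n; ring.
Qed.

Lemma floor_code_bounds N (x : m.-tuple R) i :
  (floor_code N x i)%:~R / 2 ^+ N <= tnth x i < ((floor_code N x i)%:~R + 1) / 2 ^+ N.
Proof.
rewrite ler_pdivrMr ?exprn_gt0// ltr_pdivlMr ?exprn_gt0// ffunE.
by have := floor_itv (2 ^+ N * tnth x i); rewrite intrD; lra.
Qed.

(* [g] is 3/2-Lipschitz and covers a ball around [y], so the preimage of a small
   cube contains a cube of comparable side. *)
Lemma half_lipschitz_dev_null g delta y A : 0 < delta ->
  half_lipschitz_dev g delta -> `|g 0 - y| <= delta / 16 ->
  measurable_fun setT (fun x => rv2t (g (t2rv x))) -> measurable A ->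
  lam (tball 0 delta `&` [set x | A (rv2t (g (t2rv x)))]) = 0%E ->
  lam (A `&` tball y (delta / 16)) = 0%E.
Proof.
move=> d0 gd gy mg mA A0.
have d16 : 0 <= delta / 16 by lra.
have mBy : measurable (tball y (delta / 16)) := measurable_tball y d16.
have mB0 : measurable (tball 0 delta) := measurable_tball 0 (ltW d0).
pose mu : {measure set (m.-tuple R) -> \bar R} := mrestr lam mBy.
pose nu : {measure set (m.-tuple R) -> \bar R} := image_measure (mrestr lam mB0) mg.
have muE S : mu S = lam (S `&` tball y (delta / 16)) by [].
have nuE S : nu S = lam ([set x | S (rv2t (g (t2rv x)))] `&` tball 0 delta) by [].
(* A cube of side at most [delta / 16] that meets the ball has its centre within [delta / 8] of [y],
   hence within [delta / 4] of [g 0], where surjectivity is available. *)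
have [N0 hN0] := exp2N_small (divr_gt0 d0 (ltr0n _ 16 : 0 < 16%:R)).
have mufin : (mu setT < +oo)%E by rewrite muE setTI lam_tball// ltry.
have nufin : (nu setT < +oo)%E.
  rewrite nuE (_ : [set x | _] = setT); last by apply/seteqP.
  by rewrite setTI lam_tball ?ltry// ltW.
have nuA : nu A = 0%E by rewrite nuE setIC.
have C0 : 0 <= 2 ^+ m :> R by rewrite exprn_ge0.
(* The factor [2 ^+ m] compares a cube of side [h] with the cube of side [h / 2] found in its
   preimage. *)
rewrite -muE; apply: (@null_of_cube_le R m mu nu mufin nufin (2 ^+ m) N0 C0 _ A mA nuA).
move=> N z NN; set Q := _ @^-1` _.
have mQ : measurable Q := measurable_floor_code N _.
have [Q0|/set0P[x0 [Qx0 Bx0]]] := eqVneq (Q `&` tball y (delta / 16)) set0.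
  by rewrite muE Q0 measure0 mule_ge0// lee_fin exprn_ge0.
pose h : R := (2 ^+ N)^-1; have h0 : 0 < h by rewrite invr_gt0 exprn_gt0.
have hd : h <= delta / 16 := hN0 _ NN.
pose q : 'rV[R]_m := \row_i ((z i)%:~R * h + h / 2).
have xq : `|t2rv x0 - q| <= h.
  apply/rV_norm_leP; [exact: ltW|move=> i]; rewrite !mxE ler_distl.
  have := floor_code_bounds N x0 i; rewrite Qx0 -/h mulrDl mul1r; lra.
have yq : `|q - y| <= delta / 8.
  rewrite -(subrK (t2rv x0) q) -addrA; apply: le_trans (ler_normD _ _) _.
  rewrite distrC; have : `|t2rv x0 - y| <= delta / 16 := Bx0; lra.
have gq : `|g 0 - q| <= delta / 4.
  rewrite -(subrK y (g 0)) -addrA; apply: le_trans (ler_normD _ _) _.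
  rewrite [X in _ + X]distrC; lra.
have [c0 [c0d gc0]] := half_lipschitz_dev_surj d0 gd gq.
have h4 : 0 <= h / 4 by lra.
have muQ : (mu Q <= (h ^+ m)%:E)%E.
  rewrite muE; apply: (@le_trans _ _ (lam (tball q (h / 2)))).
    apply: le_measure; rewrite ?inE; [exact: measurableI|by apply: measurable_tball; lra|].
    move=> x [Qx _]; apply/rV_norm_leP; [by lra|move=> i]; rewrite !mxE ler_distl.
    have := floor_code_bounds N x i; rewrite Qx -/h mulrDl mul1r; lra.
  rewrite lam_tball; last by lra.
  by rewrite lee_fin (_ : h / 2 *+ 2 = h)//; field.
have nuQ : (((h / 2) ^+ m)%:E <= nu Q)%E.
  rewrite nuE (_ : h / 2 = (h / 4) *+ 2); last by field.
  rewrite -(lam_tball c0 h4); apply: le_measure; rewrite ?inE.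
  - exact: measurable_tball.
  - by apply: measurableI => //; have := mg measurableT _ mQ; rewrite setTI.
  move=> x xc; have xc' : `|t2rv x - c0| <= h / 4 := xc.
  have xd : `|t2rv x| <= delta.
    rewrite -(subrK c0 (t2rv x)); apply: le_trans (ler_normD _ _) _; lra.
  split; last by rewrite /tball/= subr0.
  (* Here [3/2 * h/4 = 3h/8 < h/2]: the strict inequality keeps the image inside the half-open
     cube. *)
  have gx : `|g (t2rv x) - q| <= h * 3 / 8.
    rewrite -gc0 -(subrK (t2rv x - c0) (g (t2rv x) - g c0)).
    apply: le_trans (ler_normD _ _) _.
    have := gd _ _ xd (le_trans c0d _ : `|c0| <= delta); move=> /(_ ltac:(lra)).
    lra.
  apply/ffunP => i; apply/eqP; rewrite ffunE floor_eq tnth_mktuple.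
  have := le_trans (rV_coord_le _ i) gx; rewrite !mxE ler_distl.
  move=> /andP[l1 l2].
  rewrite -(ler_pM2l h0) -(ltr_pM2l h0) mulKf ?expf_neq0// intrD.
  by apply/andP; split; lra.
apply: le_trans muQ _; apply: (@le_trans _ _ ((2 ^+ m)%:E * ((h / 2) ^+ m)%:E)%E).
  by rewrite -EFinM lee_fin -exprMn mulrC divfK.
by rewrite lee_wpmul2l// lee_fin exprn_ge0.
Qed.

(** Every point of [A] lies in a dyadic cube that meets [A] in a null set, and there are only
    countably many dyadic cubes. *)
Lemma lam_null_local A : measurable A ->
  (forall y : 'rV[R]_m, exists2 r, 0 < r & lam (A `&` tball y r) = 0%E) ->
  lam A = 0%E.
Proof.
move=> mA locA.
pose F k := A `&` [set x | exists N, pickle (N, floor_code N x) = k /\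
  lam (A `&` (@floor_code R m N @^-1` [set floor_code N x])) = 0%E].
suff : lam.-negligible (\bigcup_k F k).
  move=> /(negligibleS _) AF; apply/negligibleP => //; apply: AF => x Ax.
  have [r r0 Ar] := locA (t2rv x); have [N hN] := exp2N_small r0.
  exists (pickle (N, floor_code N x)) => //; split => //; exists N; split => //.
  apply/eqP; rewrite eq_le measure_ge0 andbT -Ar; apply: le_measure; rewrite ?inE.
  - by apply: measurableI => //; exact: measurable_floor_code.
  - by apply: measurableI => //; apply: measurable_tball; exact: ltW.
  move=> x' [Ax' xx']; split => //; apply/rV_norm_leP; first exact: ltW.
  move=> i; rewrite !mxE ler_distl.
  have xx2 := congr1 (fun F : {ffun 'I_m -> int} => F i)
    (xx' : floor_code N x' = floor_code N x).
  have := floor_code_bounds N x' i; rewrite /= in xx2; rewrite xx2.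
  have := floor_code_bounds N x i; have := hN _ (leqnn _).
  rewrite !mulrDl !mul1r; lra.
apply: negligible_bigcup => k.
have [[x [Ax [N [xk AN]]]]|nF] := pselect (exists x, F k x).
  exists (A `&` (@floor_code R m N @^-1` [set floor_code N x])); split => //.
    by apply: measurableI => //; exact: measurable_floor_code.
  move=> x' [Ax' [N' [xk' _]]]; split => //.
  move: xk'; rewrite -xk => /(pcan_inj pickleK) [NE]; rewrite NE => E; exact: E.
rewrite (_ : F k = set0); first exact: negligible_set0.
by apply/seteqP; split => // x Fx; apply: nF; exists x.
Qed.

End row_vectors.

Section density_measure.
Context d (T : measurableType d) (R : realType) (P : {measure set T -> \bar R}).
Variable f : T -> R.
Hypotheses (mf : measurable_fun setT f) (f0 : forall x, 0 <= f x).

(** The two proofs are arguments so that the structure of measure can be attached to the function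
    itself. *)
Definition density_measure of measurable_fun setT f & (forall x, 0 <= f x) :=
  fun A : set T => (\int[P]_(x in A) (f x)%:E)%E.

Let nu := density_measure mf f0.

Let nu0 : nu set0 = 0%E. Proof. by rewrite /nu /density_measure integral_set0. Qed.

Let nu_ge0 A : (0 <= nu A)%E.
Proof. by apply: integral_ge0 => x _; rewrite lee_fin. Qed.

Let nu_sigma_additive : semi_sigma_additive nu.
Proof.
move=> F mF tF mUF; rewrite /nu /density_measure ge0_integral_bigcup//.
- by apply: is_cvg_ereal_nneg_natsum_cond => n _ _; exact: nu_ge0.
- by apply/measurable_EFinP; exact: measurable_funTS.
- by move=> x _; rewrite lee_fin.
Qed.

HB.instance Definition _ := isMeasure.Build _ _ _ (density_measure mf f0)
  nu0 nu_ge0 nu_sigma_additive.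

End density_measure.

(** * Translation of Wiener measure by polygonal paths *)

Section path_events.
Context (R : realType) (n : nat) (Tm : R).

Definition grid (N i : nat) : R := i%:R * Tm / 2 ^+ N.

Definition incr (N i : nat) (j : 'I_n) (V : bpath R n) : R :=
  V (grid N i.+1) ord0 j - V (grid N i) ord0 j.

Definition cylinder N (A : nat -> 'I_n -> set R) : set (bpath R n) :=
  [set V | forall i j, (i < 2 ^ N)%N -> A i j (incr N i j V)].

Definition cylinders N : set (set (bpath R n)) :=
  [set cylinder N A | A in [set A | forall i j, measurable (A i j)]].

Definition all_cylinders := \bigcup_N cylinders N.

(** A sigma-algebra on all functions, not only on [Omega]. It sees a path only through its
    increments on the dyadic grids of [[0, Tm]], because increments are what the law of a Brownian
    motion is specified by. *)
Definition path_event : set (set (bpath R n)) := <<s all_cylinders >>.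

Lemma cylinder_coord N i j A : (i < 2 ^ N)%N -> measurable A ->
  cylinders N (incr N i j @^-1` A).
Proof.
move=> iN mA; exists (fun i' j' => if (i' == i) && (j' == j) then A else setT).
  by move=> i' j' /=; case: ifP.
apply/seteqP; split => V /=.
  by move=> /(_ i j iN); rewrite !eqxx.
by move=> AV i' j' _; case: ifPn => // /andP[/eqP -> /eqP ->].
Qed.

Lemma measurable_cylinderT d (T : measurableType d) N A (Y : T -> bpath R n) :
  (forall i j, (i < 2 ^ N)%N -> measurable_fun setT (fun w => incr N i j (Y w))) ->
  (forall i j, measurable (A i j)) -> measurable (Y @^-1` cylinder N A).
Proof.
move=> mY mA.
rewrite (_ : _ @^-1` _ = \bigcap_(p in [set` predT])
    ((fun w => incr N (nat_of_ord p.1) p.2 (Y w)) @^-1`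
     A (nat_of_ord (p : 'I_(2 ^ N) * 'I_n).1) p.2)).
  apply: fin_bigcap_measurable => // p _; rewrite -[_ @^-1` _]setTI.
  exact: mY.
apply/seteqP; split => w /= h; first by move=> p _; exact: h.
by move=> i j iN; exact: (h (Ordinal iN, j) isT).
Qed.

Lemma incr_split N i j V : incr N i j V = incr N.+1 i.*2 j V + incr N.+1 i.*2.+1 j V.
Proof.
have E k : grid N.+1 k.*2 = grid N k.
  rewrite /grid -muln2 natrM exprS invfM; field.
  by rewrite expf_neq0.
by rewrite /incr -doubleS !E; ring.
Qed.

Lemma cylinders_refine N : cylinders N `<=` <<s cylinders N.+1 >>.
Proof.
move=> _ [A mA <-].
have mid i j : (i < 2 ^ N.+1)%N -> measurable_fun setT
    (incr N.+1 i j : g_sigma_algebraType (cylinders N.+1) -> R).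
  move=> iN _ B mB; rewrite setTI; apply: sub_sigma_algebra.
  exact: cylinder_coord.
suff: measurable ((idfun : g_sigma_algebraType (cylinders N.+1) -> bpath R n)
    @^-1` cylinder N A) by [].
apply: measurable_cylinderT => // i j iN.
rewrite (_ : (fun w => _) = (fun w => incr N.+1 i.*2 j w + incr N.+1 i.*2.+1 j w)); last first.
  by apply/funext => V; exact: incr_split.
have iN2 : (i.*2 < 2 ^ N.+1)%N by rewrite expnS mul2n ltn_double.
have iN3 : (i.*2.+1 < 2 ^ N.+1)%N by rewrite expnS mul2n ltn_Sdouble.
by apply: measurable_funD; exact: mid.
Qed.

Lemma sigma_cylinders_le N N' : (N <= N')%N ->
  <<s cylinders N >> `<=` <<s cylinders N' >>.
Proof.
move=> /subnK <-; elim: (N' - N)%N => [//|k IH].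
apply: subset_trans IH _; apply: smallest_sub; first exact: smallest_sigma_algebra.
exact: cylinders_refine.
Qed.

Lemma path_event_levels N0 : path_event `<=` <<s \bigcup_(N in [set N | (N0 <= N)%N]) <<s cylinders N >> >>.
Proof.
apply: smallest_sub; first exact: smallest_sigma_algebra.
move=> B [N _ NB]; apply: sub_sigma_algebra; exists (maxn N0 N) => /=.
  exact: leq_maxl.
by apply: (sigma_cylinders_le (leq_maxr N0 N)); exact: sub_sigma_algebra.
Qed.

Lemma setI_closed_levels N0 :
  setI_closed (\bigcup_(N in [set N | (N0 <= N)%N]) <<s cylinders N >>).
Proof.
move=> A B [N /= NN NA] [N' /= NN' NB]; exists (maxn N N') => /=.
  by rewrite leq_max NN.
apply: (@measurableI _ (g_sigma_algebraType (cylinders (maxn N N'))) A B); [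
  exact: (sigma_cylinders_le (leq_maxl N N') NA)|
  exact: (sigma_cylinders_le (leq_maxr N N') NB)].
Qed.

Lemma setI_closed_cylinders N : setI_closed (cylinders N).
Proof.
move=> _ _ [A mA <-] [B mB <-]; exists (fun i j => A i j `&` B i j).
  by move=> i j /=; exact: measurableI.
apply/seteqP; split => V /=.
  by move=> h; split => i j iN; have [] := h i j iN.
by move=> [h1 h2] i j iN; split; [exact: h1|exact: h2].
Qed.

Lemma measurable_path_eventT d (T : measurableType d) (Y : T -> bpath R n) :
  (forall r j, measurable_fun setT (fun w => Y w r ord0 j)) ->
  forall B, path_event B -> measurable (Y @^-1` B).
Proof.
move=> mY B PB.
have : [set B | measurable (Y @^-1` B)] B; last by [].
apply: PB; split.
  split => /=.
  - by rewrite preimage_set0.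
  - by move=> A mA; rewrite setTD preimage_setC; exact: measurableC.
  - by move=> F mF; rewrite preimage_bigcup; exact: bigcupT_measurable.
move=> _ [N _ [A mA <-]] /=; apply: measurable_cylinderT => // i j _.
exact: measurable_funB.
Qed.

Lemma path_event_shift (H : bpath R n) B : path_event B ->
  path_event [set V | B (fun r => V r + H r)].
Proof.
move=> PB.
suff : [set B | path_event [set V | B (fun r => V r + H r)]] B by [].
apply: PB; split.
  split => /=.
  - exact: (@measurable0 _ (g_sigma_algebraType all_cylinders)).
  - move=> A mA.
    rewrite (_ : [set V | _] = ~` [set V | A (fun r => V r + H r)]); last first.
      by apply/seteqP; split => V /=; tauto.
    exact: (@measurableC _ (g_sigma_algebraType all_cylinders) _ mA).
  - move=> F mF.
    exact: (@bigcupT_measurable _ (g_sigma_algebraType all_cylinders) _ mF).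
move=> _ [N _ [A mA <-]] /=; apply: sub_sigma_algebra; exists N => //.
exists (fun i j => (fun x => x + incr N i j H) @^-1` A i j) => /=.
  move=> i j; rewrite -[_ @^-1` _]setTI.
  have mf : measurable_fun setT (fun x : R => x + incr N i j H) by exact: measurable_funD.
  exact: mf.
have E V i j : incr N i j V + incr N i j H = incr N i j (fun r => V r + H r).
  by rewrite /incr !mxE; ring.
by apply/seteqP; split => V /= h i j iN; have := h i j iN; rewrite /= E.
Qed.

End path_events.

Section brownian_shift.
Context d (T : measurableType d) (R : realType) (P : probability T R) (n : nat).
Variables (W : T -> bpath R n) (Tm : R).
Hypotheses (BM : is_two_sided_BM P W) (T0 : 0 < Tm).

Let mW r j : measurable_fun setT (fun w => W w r ord0 j).
Proof. by case: BM. Qed.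

(** For [0 <= b], the projection of the line onto [[0, b]]: it serves as the profile of a
    translation and, later, to freeze paths outside a segment. *)
Definition ramp (b r : R) : R := Num.min (Num.max r 0) b.

Definition ramp_path (b a : R) (k : 'I_n) : bpath R n :=
  fun r => (a * ramp b r) *: delta_mx ord0 k.

Lemma grid_step N i : grid Tm N i.+1 - grid Tm N i = Tm / 2 ^+ N.
Proof. by rewrite /grid -natr1; ring. Qed.

Lemma grid_ge0 N i : 0 <= grid Tm N i.
Proof. by rewrite /grid mulr_ge0 ?invr_ge0 ?exprn_ge0// mulr_ge0// ltW. Qed.

Lemma ler_grid N i j : (i <= j)%N -> grid Tm N i <= grid Tm N j.
Proof.
move=> ij; rewrite /grid ler_pM2r ?invr_gt0 ?exprn_gt0// ler_pM2r//.
by rewrite ler_nat.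
Qed.

Lemma grid_refine N N0 i0 : (N0 <= N)%N ->
  grid Tm N0 i0 = grid Tm N (i0 * 2 ^ (N - N0)).
Proof.
move=> NN; rewrite /grid -{2}(subnK NN) natrM natrX exprD.
have h k : (2 ^+ k != 0 :> R) by rewrite expf_neq0.
by field; rewrite !h.
Qed.

Lemma incr_ramp_path N0 i0 N i j a k : (N0 <= N)%N ->
  incr Tm N i j (ramp_path (grid Tm N0 i0) a k) =
  if (j == k) && (i < i0 * 2 ^ (N - N0))%N then a * (Tm / 2 ^+ N) else 0.
Proof.
move=> NN; rewrite /incr /ramp_path !mxE eqxx/= (grid_refine i0 NN).
set I := (i0 * _)%N; have [jk|jk] := eqVneq j k; last by rewrite !mulr0 subrr.
rewrite !mulr1 -mulrBr /ramp !max_l ?grid_ge0//.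
have [iI|iI] := ltnP i I.
  by rewrite !min_l ?ler_grid// ?grid_step// ltnW.
by rewrite !min_r ?ler_grid ?subrr ?mulr0// (leq_trans iI).
Qed.

Lemma prob_incr N (A : nat -> 'I_n -> set R) : (forall i j, measurable (A i j)) ->
  P [set w | forall p : 'I_(2 ^ N) * 'I_n, A p.1 p.2 (incr Tm N p.1 p.2 (W w))] =
  (\prod_(p : 'I_(2 ^ N) * 'I_n)
    normal_prob 0 (Num.sqrt (Tm / 2 ^+ N)) (A p.1 p.2))%E.
Proof.
move=> mA; have [_ _ /(_ (2 ^ N)%N (grid Tm N))] := BM.
have gS i : (i < 2 ^ N)%N -> grid Tm N i < grid Tm N i.+1.
  by move=> _; rewrite -subr_gt0 grid_step divr_gt0// exprn_gt0.
move=> /(_ gS (fun i j => A i j)) /(_ (fun i j => mA i j)) E.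
transitivity (\prod_(i < 2 ^ N) \prod_(j < n)
    normal_prob 0 (Num.sqrt (Tm / 2 ^+ N)) (A i j))%E; last by rewrite pair_bigA.
under eq_bigr => i _ do under eq_bigr => j _ do rewrite -(grid_step N i).
rewrite -E; congr (P _); apply/seteqP; split => w /= h.
  by move=> i _ j _; exact: (h (i, j)).
by move=> [i j]; exact: (h i I j I).
Qed.

Section one_ramp.
Variables (N0 i0 : nat) (a : R) (k : 'I_n).

Let b := grid Tm N0 i0.

(* Density of the law of [W] translated by the ramp stopped at [b] with slope [a]. *)
Definition girsanov_density (w : T) : R :=
  expR (a * (W w b ord0 k) - a ^+ 2 * b / 2).

Let mrho : measurable_fun setT girsanov_density.
Proof.
apply: measurableT_comp => //; apply: measurable_funB => //.
exact: measurable_funM.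
Qed.

Let rho0 w : 0 <= girsanov_density w. Proof. exact: expR_ge0. Qed.

Hypothesis i0N0 : (i0 <= 2 ^ N0)%N.

(** Only the first [I] steps in direction [k] contribute, and their increments telescope to the
    value of [W] at [b] since [W] starts at 0. The product is thus the same at every level, which
    lets one density serve for all of them. *)
Lemma girsanov_density_prod N w : (N0 <= N)%N ->
  girsanov_density w = \prod_(p : 'I_(2 ^ N) * 'I_n)
    expR (let h := incr Tm N p.1 p.2 (ramp_path b a k) in
      h * incr Tm N p.1 p.2 (W w) / (Tm / 2 ^+ N) - h ^+ 2 / (2 * (Tm / 2 ^+ N))).
Proof.
move=> NN; rewrite -expR_sum; congr expR.
pose I := (i0 * 2 ^ (N - N0))%N; pose D := Tm / 2 ^+ N.
have D0 : D != 0 by rewrite mulf_neq0 ?gt_eqF// invr_gt0 exprn_gt0.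
have IN : (I <= 2 ^ N)%N.
  by rewrite -(subnKC NN) expnD -/I leq_mul2r i0N0 orbT.
rewrite -(pair_bigA _ (fun (i : 'I_(2 ^ N)) (j : 'I_n) =>
  incr Tm N i j (ramp_path b a k) * incr Tm N i j (W w) / D
   - incr Tm N i j (ramp_path b a k) ^+ 2 / (2 * D)))/=.
transitivity (\sum_(i < 2 ^ N) (if (i < I)%N then
    a * incr Tm N i k (W w) - a ^+ 2 * D / 2 else 0)); last first.
  apply: eq_bigr => i _; rewrite (bigD1 k)//= big1 ?addr0; last first.
    by move=> j /negbTE jk; rewrite incr_ramp_path// jk/= expr0n !mul0r subrr.
  rewrite incr_ramp_path// eqxx/= -/I -/D; case: ifP => _.
    by field.
  by rewrite expr0n !mul0r subrr.
rewrite -(big_mkord xpredT (fun i => if (i < I)%N then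
    a * incr Tm N i k (W w) - a ^+ 2 * D / 2 else 0)).
rewrite (big_cat_nat (n := I))//= [X in _ = _ + X]big_nat_cond [X in _ = _ + X]big1 ?addr0; last first.
  by move=> i /andP[/andP[Ii _] _]; rewrite ltnNge Ii.
rewrite [RHS]big_nat_cond (eq_bigr (fun i => a * incr Tm N i k (W w) - a ^+ 2 * D / 2)); last first.
  by move=> i /andP[/andP[_ ->] _].
rewrite -big_nat_cond big_split/= -mulr_sumr sumr_const_nat subn0.
rewrite /incr telescope_sumr//.
have [W0 _ _] := BM; have [_ W00] := W0 w.
rewrite {2}/grid mul0r mul0r W00 mxE subr0 /b (grid_refine i0 NN) -/I.
by congr (_ + _); rewrite /grid /D -mulr_natl; field; rewrite ?expf_neq0.
Qed.

Let H := ramp_path b a k.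

Let mWH r j : measurable_fun setT (fun w => (W w r + H r) ord0 j).
Proof.
under eq_fun do rewrite mxE.
exact: measurable_funD.
Qed.

Let mY1 : measurable_fun [set: T]
  ((fun w r => W w r + H r) : T -> g_sigma_algebraType (@all_cylinders R n Tm)).
Proof.
move=> _ B mB; rewrite setTI.
by apply: (@measurable_path_eventT R n Tm _ _ (fun w r => W w r + H r)).
Qed.

Let mY2 : measurable_fun [set: T] (W : T -> g_sigma_algebraType (@all_cylinders R n Tm)).
Proof.
by move=> _ B mB; rewrite setTI; exact: (@measurable_path_eventT R n Tm _ _ W).
Qed.

(** The law of the translated path and the reweighted law of [W]; they turn out to agree on path
    events. *)
Let m1 := image_measure P mY1.
Let m2 := image_measure (density_measure P mrho rho0) mY2.

(** Both sides factor over the independent increments, and the factors agree by the one-dimensional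
    formula. *)
Let m12_cylinder N B : (N0 <= N)%N -> cylinders Tm N B -> m1 B = m2 B.
Proof.
move=> NN [A mA <-]; rewrite !image_measureE.
pose D := Tm / 2 ^+ N; pose s := Num.sqrt D.
have D0 : 0 < D by rewrite divr_gt0// exprn_gt0.
have s0 : s != 0 by rewrite gt_eqF// sqrtr_gt0.
have s2 : s ^+ 2 = D by rewrite sqr_sqrtr// ltW.
pose h (p : 'I_(2 ^ N) * 'I_n) := incr Tm N p.1 p.2 H.
pose f (p : 'I_(2 ^ N) * 'I_n) (x : R) :=
  \1_(A p.1 p.2) x * expR (h p * x / s ^+ 2 - h p ^+ 2 / (2 * s ^+ 2)).
have L : P ((fun w r => W w r + H r) @^-1` cylinder Tm N A) =
    (\prod_(p : 'I_(2 ^ N) * 'I_n) \int[normal_prob 0 s]_x (f p x)%:E)%E.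
  transitivity (P [set w | forall p : 'I_(2 ^ N) * 'I_n,
      ((fun x => x + incr Tm N p.1 p.2 H) @^-1` A p.1 p.2) (incr Tm N p.1 p.2 (W w))]).
    have E V i j : incr Tm N i j (fun r => V r + H r) = incr Tm N i j V + incr Tm N i j H.
      by rewrite /incr !mxE; ring.
    congr (P _); apply/seteqP; split => w /= hh.
      by move=> p; have := hh p.1 p.2 (ltn_ord _); rewrite E.
    by move=> i j iN; have := hh (Ordinal iN, j); rewrite E.
  rewrite (@prob_incr N (fun i j => (fun x => x + incr Tm N i j H) @^-1` A i j)).
    by apply: eq_bigr => p _; exact: (normal_prob_shift (h p) s0 (mA _ _)).
  move=> i j; rewrite -[_ @^-1` _]setTI.
  have mf : measurable_fun setT (fun x : R => x + incr Tm N i j H) by exact: measurable_funD.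
  exact: mf.
rewrite [LHS]L.
have mf p : measurable_fun [set: measurableTypeR R] (f p).
  apply: measurable_funM; first by apply: measurable_indic; exact: mA.
  apply: measurableT_comp => //; apply: measurable_funB => //.
  rewrite (_ : (fun x => _) = ( *%R (h p / s ^+ 2))); first exact: mulrl_measurable.
  by apply/funext => x; rewrite mulrAC.
have f0 p x : 0 <= f p x by rewrite /f mulr_ge0// expR_ge0.
have fi p : (\int[normal_prob 0 s]_x (f p x)%:E < +oo)%E.
  rewrite -(normal_prob_shift (h p) s0 (mA _ _)).
  apply: (@le_lt_trans _ _ (normal_prob 0 s setT)); last by rewrite probability_setT ltry.
  apply: le_measure; rewrite ?inE//.
  have mf' : measurable_fun [set: measurableTypeR R] ((fun x : R => x + h p) : _ -> measurableTypeR R).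
    exact: measurable_funD.
  by have := mf' measurableT _ (mA p.1 p.2); rewrite setTI.
pose X (p : 'I_(2 ^ N) * 'I_n) (w : T) : measurableTypeR R := incr Tm N p.1 p.2 (W w).
have mX p : measurable_fun setT (X p) by exact: measurable_funB.
have := @expectation_prod_indep _ _ _ (measurableTypeR R) R P _ X
  (fun=> normal_prob 0 s) mX _ f mf f0 fi.
move=> <-; last first.
  (* The independence statement is indexed by natural numbers; [B'] extends [E] by the trivial
     event. *)
  move=> E mE; pose B' i j := if insub i is Some i' then E (i', j) else setT.
  have mB' i j : measurable (B' i j).
    by rewrite /B'; case: insubP => // u _ _; exact: mE.
  have BE (p : 'I_(2 ^ N) * 'I_n) : B' p.1 p.2 = E p.
    by case: p => i j; rewrite /B'/= valK.
  have := prob_incr N mB'.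
  under eq_bigr do rewrite BE.
  by move=> <-; congr (P _); apply/seteqP; split => w /= hh p; have := hh p; rewrite BE.
rewrite /density_measure [RHS]integral_mkcond; apply: eq_integral => w _.
rewrite patchE (girsanov_density_prod w NN).
case: ifPn => [/set_mem Aw|/negP Aw].
  congr EFin; apply: eq_bigr => p _; rewrite /f indicE mem_set ?mul1r ?s2//.
  exact: Aw.
have [p nAp] : exists p : 'I_(2 ^ N) * 'I_n, ~ A p.1 p.2 (X p w).
  apply/existsNP => hh; apply: Aw; apply: mem_set => i j iN.
  exact: (hh (Ordinal iN, j)).
by rewrite (bigD1 p)//= /f indicE memNset// mul0r mul0r.
Qed.

(** Uniqueness of measures is used twice: cylinders of one level are stable under intersection,
    while those of different levels need not be. So the laws are identified on each level
    sigma-algebra, then on what the union of these generates. *)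
Lemma null_ramp_shift B : path_event Tm B -> P (W @^-1` B) = 0%E ->
  P [set w | B (fun r => W w r + H r)] = 0%E.
Proof.
move=> mB PB.
have m1T : m1 setT = 1%E by exact: (@probability_setT _ _ _ P).
pose GT : measurableType _ := g_sigma_algebraType (@all_cylinders R n Tm).
have cylm N : cylinders Tm N `<=` (@measurable _ GT).
  by move=> C NC; apply: sub_sigma_algebra; exists N.
have scylm N : <<s cylinders Tm N >> `<=` (@measurable _ GT).
  by apply: smallest_sub => //; exact: sigma_algebra_measurable.
have cylT N : cylinders Tm N [set: bpath R n].
  by exists (fun _ _ => setT) => //; apply/seteqP.
have lev N C : (N0 <= N)%N -> <<s cylinders Tm N >> C -> m1 C = m2 C.
  move=> NN; apply: (@g_sigma_algebra_measure_unique _ R GT (cylinders Tm N) (cylm N)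
    (fun=> setT)) => //.
  - by rewrite bigcup_const.
  - exact: setI_closed_cylinders.
  - by move=> A; exact: m12_cylinder.
  - by move=> _; rewrite m1T ltry.
have : m1 B = m2 B.
  apply: (@g_sigma_algebra_measure_unique _ R GT
    (\bigcup_(N in [set N | (N0 <= N)%N]) <<s cylinders Tm N >>) _ (fun=> setT)).
  - by move=> C [N _]; exact: scylm.
  - move=> _; exists N0 => //=; apply: sub_sigma_algebra; exact: cylT.
  - by rewrite bigcup_const.
  - exact: setI_closed_levels.
  - by move=> A [N NN]; exact: lev.
  - by move=> _; rewrite m1T ltry.
  - exact: path_event_levels.
rewrite !image_measureE => E.
apply: etrans E _; apply: null_set_integral => //.
  by rewrite -[W @^-1` B]setTI; exact: mY2.
by apply/measurable_EFinP; exact: measurable_funTS.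
Qed.

End one_ramp.
End brownian_shift.

(** * Polygonal approximation and the support of Wiener measure *)

Section sequential_compactness.
Context (R : realType).

Lemma bolzano_weierstrass_segment (u : nat -> R) a b : (forall k, a <= u k <= b) ->
  exists f l, [/\ forall k, (k <= f k)%N, (fun k => u (f k)) @ \oo --> l & a <= l <= b].
Proof.
move=> uab.
have bu : bounded_fun u.
  exists (`|a| + `|b|); split; first exact: num_real.
  move=> M MM x _; have := uab x; have := ler_norm b; have := ler_norm (- a).
  rewrite normrN => h1 h2 /andP[h3 h4]; rewrite /= ler_norml.
  have := normr_ge0 a; have := normr_ge0 b; move=> h5 h6; apply/andP; split; lra.
have [f finc /cvg_ex[/= l ul]] := bolzano_weierstrass bu.
have fk k : (k <= f k)%N.
  elim: k => // k IH; apply: leq_ltn_trans IH _.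
  by have /increasing_seqP := finc; move=> /(_ k).
exists f, l; split => //; apply/andP; split.
  apply: (@cvgr_to_ge _ _ _ _ _ l _ ul) => //; apply: nearW => k /=.
  by case/andP: (uab (f k)).
apply: (@cvgr_to_le _ _ _ _ _ l _ ul) => //; apply: nearW => k /=.
by case/andP: (uab (f k)).
Qed.

Lemma invS_cvg_dist (u v : nat -> R) (l : R) :
  (forall k, `|u k - v k| <= k.+1%:R^-1) -> u @ \oo --> l -> v @ \oo --> l.
Proof.
move=> uv ul.
have h : (fun k => u k - v k) @ \oo --> (0 : R).
  apply/cvgr0Pnorm_lt => e e0.
  have /cvgr0Pnorm_lt/(_ _ e0) := @cvg_harmonic R; apply: filterS => k /=.
  rewrite ger0_norm ?invr_ge0//; exact: le_lt_trans.
rewrite (_ : v = (fun k => u k - (u k - v k))); last by apply/funext => k; rewrite subKr.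
by rewrite -[l]subr0; exact: cvgB.
Qed.

Lemma unif_cont_segment (Y : normedModType R) (V : R -> Y) (a b e : R) :
  continuous V -> 0 < e -> exists2 dl, 0 < dl & forall x y, a <= x <= b ->
    a <= y <= b -> `|x - y| <= dl -> `|V x - V y| < e.
Proof.
move=> cV e0; apply: contrapT => H.
have /choice[p Hp] : forall k : nat, exists q : R * R, [/\ a <= q.1 <= b, a <= q.2 <= b,
    `|q.1 - q.2| <= k.+1%:R^-1 & ~ `|V q.1 - V q.2| < e].
  move=> k; apply: contrapT => nk; apply: H; exists k.+1%:R^-1 => // x y ax ay xy.
  by apply: contrapT => nV; apply: nk; exists (x, y).
have pab k : a <= (p k).1 <= b by case: (Hp k).
have [f [l [fk pl _]]] := bolzano_weierstrass_segment pab.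
have ql : (fun k => (p (f k)).2) @ \oo --> l.
  apply: invS_cvg_dist pl => k; have [_ _ + _] := Hp (f k).
  move=> /le_trans; apply; rewrite lef_pV2 ?posrE// ler_nat ltnS; exact: fk.
have c1 : (fun k => V (p (f k)).1) @ \oo --> V l.
  by apply: (cvg_comp _ V pl); exact: cV.
have c2 : (fun k => V (p (f k)).2) @ \oo --> V l.
  by apply: (cvg_comp _ V ql); exact: cV.
have c12 : (fun k => V (p (f k)).1 - V (p (f k)).2) @ \oo --> (0 : Y).
  by rewrite -(subrr (V l)); exact: cvgB.
have [N _ NV] := (cvgr0Pnorm_lt _).1 c12 _ e0.
by have [_ _ _] := Hp (f N); apply; exact: (NV N (leqnn N)).
Qed.

End sequential_compactness.

Section paths.
Context (R : realType) (n : nat).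
Implicit Types V : bpath R n.

Lemma ramp_lipschitz (b x y : R) : `|ramp b x - ramp b y| <= `|x - y|.
Proof.
wlog xy : x y / x <= y => [H|].
  have [xy|/ltW yx] := leP x y; first exact: H.
  by rewrite distrC [leRHS]distrC; exact: H.
have h : 0 <= ramp b y - ramp b x <= y - x.
  rewrite /ramp /Order.min /Order.max; case: (ltP x 0) => hx; case: (ltP y 0) => hy;
    do ?[case: ltP => ?]; apply/andP; split; lra.
case/andP: h => h1 h2.
by rewrite distrC [leRHS]distrC (ger0_norm h1) ger0_norm// subr_ge0.
Qed.

Lemma ramp_continuous (b : R) : continuous (ramp b).
Proof.
move=> x; apply/cvgrPdist_lt => e e0; near=> y.
apply: le_lt_trans (ramp_lipschitz b x y) _.
by near: y; apply: cvgr_dist_lt => //; exact: cvg_id.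
Unshelve. all: by end_near. Qed.

Lemma ramp_bounds (b r : R) : 0 <= b -> 0 <= ramp b r <= b.
Proof.
move=> b0; rewrite /ramp /Order.min /Order.max; case: (ltP r 0) => h;
  case: ltP => h1; apply/andP; split; lra.
Qed.

Lemma ramp_id (b r : R) : 0 <= r <= b -> ramp b r = r.
Proof. by move=> /andP[r0 rb]; rewrite /ramp max_l// min_l. Qed.

Lemma ramp_ramp (b c r : R) : 0 <= b <= c -> ramp b (ramp c r) = ramp b r.
Proof.
move=> /andP[b0 bc]; have /andP[c0 _] := ramp_bounds r (le_trans b0 bc).
by rewrite {1}/ramp (max_l c0) /ramp -minA (min_r bc).
Qed.

Lemma in_OmegaD V V' : in_Omega V -> in_Omega V' -> @in_Omega R n (fun r => V r + V' r).
Proof.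
move=> [cV V0] [cV' V0']; split; last by rewrite V0 V0' addr0.
by move=> r; apply: cvgD; [exact: cV|exact: cV'].
Qed.

Lemma in_Omega_sum (I : Type) (s : seq I) (F : I -> bpath R n) :
  (forall i, in_Omega (F i)) -> @in_Omega R n (fun r => \sum_(i <- s) F i r).
Proof.
move=> OF; elim: s => [|i s IH].
  by under eq_fun do rewrite big_nil; split => // r; exact: cvg_cst.
by under eq_fun do rewrite big_cons; exact: in_OmegaD.
Qed.

Lemma in_Omega_ramp_path (b a : R) (k : 'I_n) : 0 <= b -> in_Omega (ramp_path b a k).
Proof.
move=> b0; split; last by rewrite /ramp_path /ramp maxxx min_l// mulr0 scale0r.
move=> r; apply: (@cvgZr_tmp _ _ _ _ _ (fun r => a * ramp b r)).
by apply: cvgM; [exact: cvg_cst|exact: ramp_continuous].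
Qed.

(** Freezing a path outside [[0, Tm]] turns uniform closeness on that segment into locally uniform
    convergence on the line, which continuity of the cocycle asks for; adaptedness hides the
    change. *)
Definition stop (Tm : R) V : bpath R n := fun r => V (ramp Tm r).

Lemma in_Omega_stop Tm V : 0 <= Tm -> in_Omega V -> in_Omega (stop Tm V).
Proof.
move=> T0 [cV V0]; split; last by rewrite /stop ramp_id ?lexx.
by move=> r; apply: (cvg_comp (ramp Tm) V); [exact: ramp_continuous|exact: cV].
Qed.

Lemma stop_id Tm V r : 0 <= r <= Tm -> stop Tm V r = V r.
Proof. by move=> h; rewrite /stop ramp_id. Qed.

Definition ramps (K : nat) (b : 'I_K -> R) (kk : 'I_K -> 'I_n) (a : 'rV[R]_K) :
    bpath R n :=
  fun r => \sum_(l < K) ramp_path (b l) (a ord0 l) (kk l) r.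

Lemma in_Omega_ramps K (b : 'I_K -> R) kk a : (forall l, 0 <= b l) ->
  in_Omega (ramps b kk a).
Proof. by move=> b0; apply: in_Omega_sum => l; exact: in_Omega_ramp_path. Qed.

End paths.

Section dyadic_paths.
Context (R : realType) (n : nat) (Tm : R).
Hypothesis T0 : 0 < Tm.
Implicit Types V : bpath R n.

(* The increments are rounded at scale [4 ^- N], so that the [2 ^ N] rounding errors
   still sum up to [o(1)]. *)
Definition path_code N V : {ffun 'I_(2 ^ N) * 'I_n -> int} :=
  [ffun p => Num.floor (4 ^+ N * incr Tm N (p : 'I_(2 ^ N) * 'I_n).1 p.2 V)].

(** The slope for which the increment over grid step [p] is the rounded value [z p / 4 ^ N]. *)
Definition code_coef N (z : {ffun 'I_(2 ^ N) * 'I_n -> int}) p : R :=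
  (z p)%:~R / 4 ^+ N / (Tm / 2 ^+ N).

(** Each step is written as a difference of two ramps starting at 0, so that the translation results
    for ramps apply. *)
Definition code_path N (z : {ffun 'I_(2 ^ N) * 'I_n -> int}) : bpath R n :=
  fun r => \sum_(p : 'I_(2 ^ N) * 'I_n)
    (ramp_path (grid Tm N p.1.+1) (code_coef z p) p.2 r +
     ramp_path (grid Tm N p.1) (- code_coef z p) p.2 r).

Lemma in_Omega_code_path N z : in_Omega (@code_path N z).
Proof.
apply: in_Omega_sum => p; apply: in_OmegaD; apply: in_Omega_ramp_path;
  exact: grid_ge0.
Qed.

Let Dl N : R := Tm / 2 ^+ N.

Let Dl0 N : 0 < Dl N. Proof. by rewrite divr_gt0// exprn_gt0. Qed.

Let S N i r := (ramp (grid Tm N i.+1) r - ramp (grid Tm N i) r) / Dl N.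

Lemma code_path_coord N z r j : @code_path N z r ord0 j =
  \sum_(i < 2 ^ N) ((z (i, j))%:~R / 4 ^+ N) * S N i r.
Proof.
rewrite /code_path summxE.
transitivity (\sum_(i < 2 ^ N) \sum_(k < n)
  (ramp_path (grid Tm N i.+1) (code_coef z (i, k)) k r +
     ramp_path (grid Tm N i) (- code_coef z (i, k)) k r) ord0 j).
  by rewrite pair_bigA; apply: eq_bigr => -[i k].
apply: eq_bigr => i _; rewrite (bigD1 j)//= big1 ?addr0.
  by rewrite /ramp_path !mxE !eqxx/= !mulr1 /S /code_coef -/(Dl N); ring.
by move=> k kj; rewrite /ramp_path !mxE/= eq_sym (negbTE kj) !mulr0 addr0.
Qed.

Lemma grid_end N : grid Tm N (2 ^ N) = Tm.
Proof. by rewrite /grid natrX mulrAC divff ?mul1r// expf_neq0. Qed.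

Lemma grid_lookup N r : 0 <= r <= Tm ->
  exists2 l, (l < 2 ^ N)%N & grid Tm N l <= r <= grid Tm N l.+1.
Proof.
move=> /andP[r0]; rewrite -{1}(grid_end N).
suff H L : (0 < L)%N -> r <= grid Tm N L ->
    exists2 l, (l < L)%N & grid Tm N l <= r <= grid Tm N l.+1.
  by apply: H; rewrite expn_gt0.
elim: L => // L IH _ rL; have [rL'|rL'] := leP r (grid Tm N L).
  case: L IH rL rL' => [|L] IH rL rL'.
    by exists 0%N => //; rewrite rL andbT /grid !mul0r.
  by have [//|l lL h] := IH _ rL'; exists l => //; rewrite ltnW.
by exists L => //; rewrite rL ltW.
Qed.

(** Three errors: [2 ^ N] roundings of size [4 ^- N], the distance from [V r] to the preceding grid
    value, and the partial increment over the current step. *)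
Lemma code_path_approx N V w r : in_Omega V -> 0 <= r <= Tm ->
  (forall x y, 0 <= x <= Tm -> 0 <= y <= Tm -> `|x - y| <= Tm / 2 ^+ N ->
    `|V x - V y| <= w) ->
  `|code_path (path_code N V) r - V r| <= (2 ^+ N)^-1 + w + w.
Proof.
move=> [_ V0] rT Vw.
have w0 : 0 <= w.
  have := Vw r r rT rT; rewrite !subrr !normr0; apply; exact: ltW (Dl0 N).
have D4 : (0 : R) < 4 ^+ N by rewrite exprn_gt0.
apply/rV_norm_leP; first by rewrite !addr_ge0// invr_ge0 exprn_ge0.
move=> j; rewrite mxE [X in _ + X]mxE code_path_coord.
have [l lN lr] := grid_lookup N rT.
have gl : 0 <= grid Tm N l <= Tm.
  by rewrite grid_ge0//= -[leRHS](grid_end N) ler_grid// ltnW.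
have glS : 0 <= grid Tm N l.+1 <= Tm.
  by rewrite grid_ge0//= -[leRHS](grid_end N) ler_grid.
have S1 i : (i < l)%N -> S N i r = 1.
  move=> il; rewrite /S /ramp max_l; last by case/andP: rT.
  have h1 : grid Tm N i.+1 <= r by apply: le_trans (ler_grid T0 _ il) _ => //; case/andP: lr.
  have h2 : grid Tm N i <= r by apply: le_trans h1; rewrite ler_grid.
  by rewrite !min_r// grid_step -/(Dl N) divff// gt_eqF// Dl0.
have S0 i : (l < i)%N -> S N i r = 0.
  move=> il; rewrite /S /ramp max_l; last by case/andP: rT.
  have h1 : r <= grid Tm N i by apply: le_trans (ler_grid T0 _ il) => //; case/andP: lr.
  have h2 : r <= grid Tm N i.+1 by apply: le_trans h1 _; rewrite ler_grid.
  by rewrite !min_l// subrr mul0r.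
have Sl : 0 <= S N l r <= 1.
  rewrite /S /ramp max_l; last by case/andP: rT.
  case/andP: lr => lr1 lr2; rewrite min_l// min_r//.
  have := grid_step Tm N l; rewrite -/(Dl N) => <-.
  have h : 0 < grid Tm N l.+1 - grid Tm N l by rewrite grid_step; exact: Dl0.
  apply/andP; split; first by apply: divr_ge0; [rewrite subr_ge0|exact: ltW].
  by rewrite ler_pdivrMr// mul1r lerD2r.
have S01 i : 0 <= S N i r <= 1.
  by have [/S1 ->|/S0 ->|->] := ltngtP i l; rewrite ?lexx ?ler01.
have incS : \sum_(i < 2 ^ N) incr Tm N i j V * S N i r =
    V (grid Tm N l) ord0 j + incr Tm N l j V * S N l r.
  rewrite -(big_mkord xpredT (fun i => incr Tm N i j V * S N i r)).
  rewrite (big_cat_nat (n := l))//=; last exact: ltnW.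
  rewrite [X in _ + X = _]big_ltn//.
  rewrite [X in _ + (_ + X) = _]big_nat_cond [X in _ + (_ + X) = _]big1 ?addr0; last first.
    by move=> i /andP[/andP[li _] _]; rewrite S0// mulr0.
  congr (_ + _); rewrite big_nat_cond (eq_bigr (fun i => incr Tm N i j V)); last first.
    by move=> i /andP[/andP[_ il] _]; rewrite S1// mulr1.
  rewrite -big_nat_cond /incr telescope_sumr//.
  by rewrite {2}/grid !mul0r V0 mxE subr0.
have -> : \sum_(i < 2 ^ N) (path_code N V (i, j))%:~R / 4 ^+ N * S N i r - V r ord0 j =
   \sum_(i < 2 ^ N) ((path_code N V (i, j))%:~R / 4 ^+ N - incr Tm N i j V) * S N i r +
   ((V (grid Tm N l) ord0 j - V r ord0 j) + incr Tm N l j V * S N l r).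
  under [X in _ = X + _]eq_bigr do rewrite mulrBl.
  by rewrite big_split/= sumrN incS; ring.
apply: le_trans (ler_normD _ _) _; rewrite -[leRHS]addrA; apply: lerD.
  apply: le_trans (ler_norm_sum _ _ _) _.
  apply: (@le_trans _ _ (\sum_(i < 2 ^ N) (4 ^+ N)^-1)); last first.
    rewrite sumr_const card_ord -[leLHS]mulr_natl natrX.
    rewrite (_ : 4 = 2 * 2 :> R); last by ring.
    by rewrite exprMn invfM mulrA divff ?mul1r// expf_neq0.
  apply: ler_sum => i _; rewrite normrM.
  have h : `|(path_code N V (i, j))%:~R / 4 ^+ N - incr Tm N i j V| <= (4 ^+ N)^-1.
    rewrite ffunE/=; have := floor_itv (4 ^+ N * incr Tm N i j V).
    set K := (Num.floor _)%:~R; set q := incr _ _ _ _ _; rewrite intrD -/K => /andP[k1 k2].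
    rewrite -(ler_pM2l D4) divff ?gt_eqF// -{1}(gtr0_norm D4) -normrM mulrBr mulrCA divff ?gt_eqF// mulr1.
    by rewrite ler_norml; apply/andP; split; lra.
  rewrite -[leRHS]mulr1; apply: ler_pM => //.
  by case/andP: (S01 i) => s0 s1; rewrite ger0_norm.
apply: le_trans (ler_normD _ _) _; apply: lerD.
  have h := Vw _ _ gl rT; have := rV_coord_le (V (grid Tm N l) - V r) j.
  rewrite !mxE => /le_trans; apply; apply: h.
  case/andP: lr => lr1 lr2; rewrite distrC ger0_norm ?subr_ge0// -(grid_step Tm N l).
  by rewrite lerD2r.
rewrite normrM -[leRHS]mulr1; apply: ler_pM => //; last first.
  by case/andP: Sl => s0 s1; rewrite ger0_norm.
have h := Vw _ _ glS gl; have := rV_coord_le (V (grid Tm N l.+1) - V (grid Tm N l)) j.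
rewrite !mxE => /le_trans; apply; apply: h.
by rewrite grid_step ger0_norm//; exact: ltW (Dl0 N).
Qed.

Definition disc N V : bpath R n := code_path (path_code N V).

Lemma disc_approx V e : in_Omega V -> 0 < e -> exists N0, forall N r, (N0 <= N)%N ->
  0 <= r <= Tm -> `|disc N V r - V r| <= e.
Proof.
move=> OV e0; have e4 : 0 < e / 4 by lra.
have [dl dl0 Vdl] := unif_cont_segment 0 Tm (proj1 OV) e4.
(* One bound makes the rounding error at most [e / 2], the other makes the grid step at most
   [dl]. *)
have mn : 0 < Num.min (e / 2) (dl / Tm) by rewrite lt_min divr_gt0//= divr_gt0.
have [N0 hN] := exp2N_small mn.
exists N0 => N r NN rT; have := hN N NN; rewrite le_min => /andP[h1 h2].
apply: le_trans (code_path_approx (w := e / 4) OV rT _) _; last by lra.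
move=> x y xT yT xy; apply/ltW/Vdl => //; apply: le_trans xy _.
by rewrite mulrC -ler_pdivlMr.
Qed.

Lemma disc_ramp N V r : disc N V (ramp Tm r) = disc N V r.
Proof.
apply: eq_bigr => p _; rewrite /ramp_path !ramp_ramp//.
  by rewrite grid_ge0//= -[leRHS](grid_end N) ler_grid// ltnW.
by rewrite grid_ge0//= -[leRHS](grid_end N) ler_grid.
Qed.

Lemma disc_cvg V : in_Omega V -> loc_unif_cvg (fun N => disc N V) (stop Tm V).
Proof.
move=> OV B e e0; have e2 : 0 < e / 2 by lra.
have [N0 hN] := disc_approx OV e2; exists N0 => // N /= NN r _.
rewrite -disc_ramp /stop; apply: le_lt_trans (hN _ _ NN _) _; last by lra.
exact: ramp_bounds (ltW T0).
Qed.

End dyadic_paths.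

Section countable_negligible.
Context d (T : measurableType d) (R : realType) (mu : {measure set T -> \bar R}).

Lemma negligible_countable_bigcup (U : countType) (F : U -> set T) :
  (forall u, mu.-negligible (F u)) -> mu.-negligible (\bigcup_u F u).
Proof.
move=> NF; apply: (@negligibleS _ _ _ mu
    (\bigcup_k (if unpickle k is Some u then F u else set0))).
  by move=> w [u _ Fu]; exists (pickle u) => //; rewrite pickleK.
apply: negligible_bigcup => k; case: unpickle => // .
exact: negligible_set0.
Qed.

End countable_negligible.

(** * Measurable versions of continuous functionals of the path *)

Section path_functionals.
Context (R : realType) (n : nat) (Tm : R).
Hypothesis T0 : 0 < Tm.

Notation pathT := (g_sigma_algebraType (@all_cylinders R n Tm)).

Lemma path_event_code N (I : set {ffun 'I_(2 ^ N) * 'I_n -> int}) :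
  path_event Tm [set V : bpath R n | I (path_code Tm N V)].
Proof.
rewrite (_ : [set V | _] = \bigcup_z [set V : bpath R n | I z /\ path_code Tm N V = z]); last first.
  apply/seteqP; split => V /=; first by move=> IV; exists (path_code Tm N V).
  by move=> [z _ [Iz ->]].
apply: (@countable_bigcupT_measurable _ pathT); first exact: countableP.
move=> z; have [Iz|Iz] := pselect (I z); last first.
  rewrite (_ : [set V | _] = set0); first exact: (@measurable0 _ pathT).
  by apply/seteqP; split => // V [].
apply: sub_sigma_algebra; exists N => //.
exists (fun i j => if insub i is Some i' then
    (fun x : R => 4 ^+ N * x) @^-1` `[(z (i', j))%:~R, (z (i', j) + 1)%:~R[ else setT).
  move=> i j /=; case: insubP => // u _ _; rewrite -[_ @^-1` _]setTI.
  have mf : measurable_fun setT (fun x : R => 4 ^+ N * x) by exact: mulrl_measurable.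
  by apply: mf => //; exact: measurable_itv.
apply/seteqP; split => V /=.
  move=> h; split => //; apply/ffunP => -[i j]; rewrite ffunE; apply/eqP.
  have := h i j (ltn_ord i); rewrite valK /= in_itv/= => hh.
  by rewrite floor_eq.
move=> [_ <-] i j iN; case: insubP => // u _ <- /=.
by rewrite in_itv/= ffunE; exact: floor_itv.
Qed.

Variables (m : nat) (F : bpath R n -> 'rV[R]_m).
Hypothesis Fcont : forall (Vk : nat -> bpath R n) V, (forall k, in_Omega (Vk k)) ->
  in_Omega V -> loc_unif_cvg Vk V -> (fun k => F (Vk k)) @ \oo --> F V.
Hypothesis Fadapt : forall V V', in_Omega V -> in_Omega V' ->
  (forall r, 0 <= r <= Tm -> V r = V' r) -> F V = F V'.

(* [F] is only continuous on [Omega], which is not a [path_event]; this version of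
   it is measurable on the whole path space. *)
Definition functional_version (V : bpath R n) : m.-tuple R :=
  [tuple fine (limn_esup (fun N => (F (disc Tm N V) ord0 i)%:E)) | i < m].

Lemma functional_versionE V : in_Omega V -> functional_version V = rv2t (F V).
Proof.
move=> OV; apply: eq_from_tnth => i; rewrite !tnth_mktuple.
have c : (fun N => F (disc Tm N V)) @ \oo --> F (stop Tm V).
  apply: Fcont; [|exact: (in_Omega_stop (ltW T0))|exact: disc_cvg].
  by move=> N; exact: in_Omega_code_path.
have ci : (fun N => F (disc Tm N V) ord0 i) @ \oo --> F (stop Tm V) ord0 i.
  by apply: (cvg_comp _ (fun v : 'rV[R]_m => v ord0 i) c); exact: coord_continuous.
have cE : (fun N => (F (disc Tm N V) ord0 i)%:E) @ \oo --> (F (stop Tm V) ord0 i)%:E.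
  by apply/fine_cvgP; split; [exact: nearW|exact: ci].
rewrite (cvg_limn_einf_sup cE).2/=.
have -> // : F (stop Tm V) = F V.
apply: Fadapt => //; first exact: (in_Omega_stop (ltW T0)).
by move=> r rT; exact: stop_id.
Qed.

(** For each [N], [F (disc Tm N V)] is a function of a code from a countable set, and any set of
    codes defines a path event; no regularity of [F] enters. *)
Lemma measurable_functional_version :
  measurable_fun setT (functional_version : pathT -> m.-tuple R).
Proof.
apply/measurable_fun_tnthP => i.
rewrite (_ : _ \o _ = (fun V : pathT =>
    fine (limn_esup (fun N => (F (disc Tm N V) ord0 i)%:E)))); last first.
  by apply/funext => V; rewrite /= tnth_mktuple.
apply: measurableT_comp => //.
apply: (measurable_fun_limn_esup (f := fun N (V : pathT) => (F (disc Tm N V) ord0 i)%:E)).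
move=> N; apply/measurable_EFinP => _ B mB; rewrite setTI.
exact: (@path_event_code N [set z | B (F (code_path Tm z) ord0 i)]).
Qed.

End path_functionals.

Section brownian_paths.
Context d (T : measurableType d) (R : realType) (P : probability T R) (n : nat).
Variables (W : T -> bpath R n) (Tm : R).
Hypotheses (BM : is_two_sided_BM P W) (T0 : 0 < Tm).

Notation pathT := (g_sigma_algebraType (@all_cylinders R n Tm)).

Let OW w : in_Omega (W w). Proof. by case: BM. Qed.

Let mW r j : measurable_fun setT (fun w => W w r ord0 j).
Proof. by case: BM. Qed.

(** Quasi-invariance reduced to null events; in this form it is stable under sums, which leads from
    ramps to all polygonal paths with dyadic corners. *)
Definition null_shift (H : bpath R n) := forall B, path_event Tm B ->
  P (W @^-1` B) = 0%E -> P [set w | B (fun r => W w r + H r)] = 0%E.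

Lemma null_shiftD H H' : null_shift H -> null_shift H' ->
  null_shift (fun r => H r + H' r).
Proof.
move=> nH nH' B mB PB.
have := nH _ (path_event_shift H' mB) (nH' _ mB PB).
by move=> <-; congr (P _); apply/seteqP; split => w /=;
  rewrite (_ : (fun r => W w r + (H r + H' r)) = (fun r => W w r + H r + H' r))//;
  apply/funext => r; rewrite addrA.
Qed.

Lemma null_shift_sum (I : Type) (s : seq I) (H : I -> bpath R n) :
  (forall i, null_shift (H i)) -> null_shift (fun r => \sum_(i <- s) H i r).
Proof.
move=> nH; elim: s => [|i s IH].
  move=> B mB PB; rewrite -PB; congr (P _); apply/seteqP; split => w /=;
  rewrite (_ : (fun r => _) = W w)//; by apply/funext => r; rewrite big_nil addr0.
by under eq_fun do rewrite big_cons; exact: null_shiftD.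
Qed.

Lemma null_shift_code_path N z : null_shift (@code_path R n Tm N z).
Proof.
apply: null_shift_sum => p; apply: null_shiftD => B mB PB.
  by apply: (@null_ramp_shift _ _ _ _ _ _ _ BM T0) => //.
by apply: (@null_ramp_shift _ _ _ _ _ _ _ BM T0) => //; exact: ltnW.
Qed.

(** Dyadic times make this a countable intersection, and [V 0] is subtracted because path events see
    only increments. Continuity recovers the other times on [Omega]. *)
Definition tube (g : bpath R n) (e : R) := \bigcap_N [set V : bpath R n |
  forall i j, (i <= 2 ^ N)%N ->
    `|V (grid Tm N i) ord0 j - V 0 ord0 j - g (grid Tm N i) ord0 j| <= e].

Lemma measurable_grid_value N i j : (i <= 2 ^ N)%N ->
  measurable_fun setT (fun V : pathT => V (grid Tm N i) ord0 j - V 0 ord0 j : R).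
Proof.
elim: i => [|i IH] iN.
  rewrite (_ : (fun V => _) = cst 0); first exact: measurable_cst.
  by apply/funext => V; rewrite /grid !mul0r subrr.
rewrite (_ : (fun V => _) = (fun V : pathT => incr Tm N i j V +
    (V (grid Tm N i) ord0 j - V 0 ord0 j))); last first.
  by apply/funext => V; rewrite /incr; ring.
apply: measurable_funD; last exact: (IH (ltnW iN)).
move=> _ B mB; rewrite setTI; apply: sub_sigma_algebra; exists N => //.
exact: cylinder_coord.
Qed.

Lemma path_event_tube g e : path_event Tm (tube g e).
Proof.
apply: (@bigcapT_measurable _ pathT) => N.
rewrite (_ : [set V | _] = \bigcap_(p in [set` predT])
  ((fun V : pathT => V (grid Tm N (nat_of_ord p.1)) ord0 p.2 - V 0 ord0 p.2 : R) @^-1`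
   `[g (grid Tm N (nat_of_ord (p : 'I_(2 ^ N).+1 * 'I_n).1)) ord0 p.2 - e,
     g (grid Tm N (nat_of_ord p.1)) ord0 p.2 + e]%classic)).
  apply: (@fin_bigcap_measurable _ pathT) => // p _; rewrite -[_ @^-1` _]setTI.
  have iN : (p.1 <= 2 ^ N)%N by rewrite -ltnS.
  exact: (@measurable_grid_value N p.1 p.2 iN measurableT _ (measurable_itv _)).
apply/seteqP; split => V /= h.
  by move=> p _ /=; rewrite in_itv/= -ler_distl; apply: h; rewrite -ltnS.
move=> i j iN; have := h (Ordinal (iN : (i < (2 ^ N).+1)%N), j) isT.
by rewrite /= in_itv/= -ler_distl.
Qed.

Lemma tube_unif g e V : 0 <= e -> in_Omega g -> in_Omega V -> tube g e V ->
  forall r, 0 <= r <= Tm -> `|V r - g r| <= e.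
Proof.
move=> e0 Og OV tV r rT.
have OD : @in_Omega R n (fun r => V r - g r).
  by split; [move=> x; apply: cvgB; [exact: OV.1|exact: Og.1]|rewrite OV.2 Og.2 subr0].
apply/ler_addgt0Pr => h h0.
have [dl dl0 hD] := unif_cont_segment 0 Tm OD.1 h0.
have [N0 hN] := exp2N_small (divr_gt0 dl0 T0).
have [l lN /andP[l1 l2]] := grid_lookup N0 rT.
have lT : 0 <= grid Tm N0 l <= Tm by rewrite grid_ge0//= -[leRHS](grid_end Tm N0) ler_grid// ltnW.
have rl : `|r - grid Tm N0 l| <= dl.
  rewrite ger0_norm ?subr_ge0//.
  apply: (@le_trans _ _ (grid Tm N0 l.+1 - grid Tm N0 l)); first by rewrite lerD2r.
  by rewrite grid_step mulrC -ler_pdivlMr//; exact: hN.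
have h1 := hD _ _ rT lT rl.
have h2 : `|V (grid Tm N0 l) - g (grid Tm N0 l)| <= e.
  apply/rV_norm_leP => // j; have := tV N0 I l j (ltnW lN).
  by rewrite OV.2 !mxE subr0.
rewrite -(subrK (V (grid Tm N0 l) - g (grid Tm N0 l)) (V r - g r)) addrC.
by apply: le_trans (ler_normD _ _) _; apply: lerD => //; exact: ltW.
Qed.

(** Countably many tubes around code paths cover all paths of [W], so one of them has positive
    probability. Translation by a polygonal path carries it to the tube around an approximation of
    [Vb], which therefore cannot be null. *)
Lemma brownian_support (Vb : bpath R n) e : in_Omega Vb -> 0 < e ->
  exists B, [/\ path_event Tm B, P (W @^-1` B) != 0%E &
    forall V, in_Omega V -> B V -> forall r, 0 <= r <= Tm -> `|V r - Vb r| <= e].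
Proof.
move=> OVb e0; have e2 : 0 < e / 2 by lra.
have mE B : path_event Tm B -> measurable (W @^-1` B).
  by apply: measurable_path_eventT.
have in_tube g V : in_Omega V -> in_Omega g ->
    (forall r, 0 <= r <= Tm -> `|g r - V r| <= e / 2) -> tube g (e / 2) V.
  move=> OV Og h N _ i j iN; rewrite OV.2 mxE subr0.
  have gT : 0 <= grid Tm N i <= Tm by rewrite grid_ge0//= -[leRHS](grid_end Tm N) ler_grid.
  have := h _ gT; rewrite distrC; apply: le_trans.
  by have := rV_coord_le (V (grid Tm N i) - g (grid Tm N i)) j; rewrite !mxE.
have [N [z Pz]] : exists N (z : {ffun 'I_(2 ^ N) * 'I_n -> int}),
    P (W @^-1` tube (code_path Tm z) (e / 2)) != 0%E.
  apply: contrapT => H.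
  have : P.-negligible (\bigcup_(q : {N : nat & {ffun 'I_(2 ^ N) * 'I_n -> int}})
      (W @^-1` tube (code_path Tm (tagged q)) (e / 2))).
    apply: negligible_countable_bigcup => q; apply/negligibleP.
      by apply: mE; exact: path_event_tube.
    apply/eqP/negPn/negP => nq; apply: H; exists (tag q), (tagged q); exact: nq.
  rewrite (_ : \bigcup_q _ = setT); last first.
    apply/seteqP; split => // w _.
    have [N hN] := disc_approx T0 (OW w) e2.
    exists (existT _ N (path_code Tm N (W w))) => //=.
    apply: in_tube; [exact: OW|exact: in_Omega_code_path|].
    by move=> r rT; apply: hN.
  move=> /(measure_negligible measurableT) PT0.
  have := etrans (esym PT0) (@probability_setT _ _ _ P) => /eqP.
  by rewrite eq_sym onee_eq0.
have [N' hN'] := disc_approx T0 OVb e2.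
pose g' := disc Tm N' Vb.
exists (tube g' (e / 2)); split; first exact: path_event_tube.
  apply/negP => /eqP P0; move/negP: Pz; apply; apply/eqP.
  (* Opposite codes give opposite paths, so subtracting a code path is again a translation by a code
     path. *)
  pose mz : {ffun 'I_(2 ^ N) * 'I_n -> int} := [ffun p => - z p].
  have mzE r : code_path Tm mz r = - code_path Tm z r.
    rewrite -sumrN; apply: eq_bigr => p _.
    rewrite /ramp_path /code_coef ffunE mulrNz !mulNr !opprK opprD.
    by rewrite !scaleNr opprK.
  have nH : null_shift (fun r => g' r + code_path Tm mz r).
    by apply: null_shiftD; exact: null_shift_code_path.
  have := nH _ (path_event_tube g' (e / 2)) P0.
  have g'0 : g' 0 = 0 := (in_Omega_code_path T0 _).2.
  have z0 : code_path Tm z 0 = 0 := (in_Omega_code_path T0 _).2.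
  have E w r j : (W w r + (g' r + code_path Tm mz r)) ord0 j -
      (W w 0 + (g' 0 + code_path Tm mz 0)) ord0 j - g' r ord0 j =
      W w r ord0 j - W w 0 ord0 j - code_path Tm z r ord0 j.
    by rewrite !mzE g'0 z0 !mxE; ring.
  move=> <-; congr (P _); apply/seteqP; split => w /= h M _ i j iM;
    have := h M I i j iM; by rewrite E.
move=> V OV BV r rT.
have Og' : in_Omega g' by exact: in_Omega_code_path.
have h1 := tube_unif (ltW e2) Og' OV BV rT; have h2 := hN' N' r (leqnn _) rT.
rewrite -(subrK (g' r) (V r)) -addrA; apply: le_trans (ler_normD _ _) _.
rewrite /g' in h1 *; lra.
Qed.

End brownian_paths.

Section good_path.
Context d (T : measurableType d) (R : realType) (P : probability T R) (n : nat).
Variables (W : T -> bpath R n) (Tm : R).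
Hypotheses (BM : is_two_sided_BM P W) (T0 : 0 < Tm).

Notation pathT := (g_sigma_algebraType (@all_cylinders R n Tm)).

Let OW w : in_Omega (W w). Proof. by case: BM. Qed.

Let mW r j : measurable_fun setT (fun w => W w r ord0 j).
Proof. by case: BM. Qed.

Lemma null_shift_ramps K (q : 'I_K -> nat * nat) kk a :
  (forall l, ((q l).2 <= 2 ^ (q l).1)%N) ->
  null_shift P W Tm (ramps (fun l => grid Tm (q l).1 (q l).2) kk a).
Proof.
move=> qP; apply: null_shift_sum => l B mB PB.
by apply: (@null_ramp_shift _ _ _ _ _ _ _ BM T0) => //.
Qed.

Variables (m : nat) (F : bpath R n -> 'rV[R]_m).
Hypothesis Fcont : forall (Vk : nat -> bpath R n) V, (forall k, in_Omega (Vk k)) ->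
  in_Omega V -> loc_unif_cvg Vk V -> (fun k => F (Vk k)) @ \oo --> F V.
Hypothesis Fadapt : forall V V', in_Omega V -> in_Omega V' ->
  (forall r, 0 <= r <= Tm -> V r = V' r) -> F V = F V'.
Variable lam : {measure set (m.-tuple R) -> \bar R}.
Hypothesis lamP : is_lebesgue_Rm lam.

Lemma exists_good_path (A : set (m.-tuple R)) (Vb : bpath R n) (e delta : R)
    (K : nat) (q : 'I_K -> nat * nat) (kk : 'I_K -> 'I_n) (B : 'M[R]_(m, K)) :
  measurable A -> P [set w | A (rv2t (F (W w)))] = 0%E ->
  in_Omega Vb -> 0 < e -> 0 < delta ->
  (forall l, ((q l).2 <= 2 ^ (q l).1)%N) ->
  let G Z x := rv2t (F (fun r => Z r +
    ramps (fun l => grid Tm (q l).1 (q l).2) kk (t2rv x *m B) r)) in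
  exists Z, [/\ in_Omega Z, forall r, 0 <= r <= Tm -> `|Z r - Vb r| <= e,
    measurable_fun setT (G Z) &
    lam (tball 0 delta `&` [set x | A (G Z x)]) = 0%E].
Proof.
move=> mA PA OVb e0 d0 qP G.
pose b l := grid Tm (q l).1 (q l).2.
have b0 l : 0 <= b l := grid_ge0 T0 _ _.
(* The measurable version agrees with [F] on all the paths that occur, since these lie in
   [Omega]. *)
pose Psi := functional_version Tm F.
have mPsi : measurable_fun setT (functional_version Tm F : pathT -> m.-tuple R).
  by apply: measurable_functional_version.
have OZ Z x : in_Omega Z -> @in_Omega R n (fun r => Z r + ramps b kk (t2rv x *m B) r).
  by move=> HZ; apply: in_OmegaD => //; exact: in_Omega_ramps.
have GE Z x : in_Omega Z -> G Z x = Psi (fun r => Z r + ramps b kk (t2rv x *m B) r).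
  by move=> HZ; rewrite /Psi (functional_versionE T0 Fcont Fadapt)//; exact: OZ.
have mramps r j : measurable_fun setT
    (fun x : m.-tuple R => ramps b kk (t2rv x *m B) r ord0 j).
  rewrite (_ : (fun x => _) = (fun x : m.-tuple R =>
      \sum_(l < K) (\sum_(i < m) tnth x i * B i l) * (ramp (b l) r * (j == kk l)%:R))).
    apply: measurable_sum => l; apply: measurable_funM => //.
    apply: measurable_sum => i; apply: measurable_funM => //.
    exact: measurable_tnth.
  apply/funext => x; rewrite /ramps summxE; apply: eq_bigr => l _.
  rewrite /ramp_path !mxE eqxx/= -mulrA; congr (_ * _).
  by apply: eq_bigr => i _; rewrite !mxE.
have mG Z : in_Omega Z -> measurable_fun setT (G Z).
  move=> HZ; rewrite (_ : G Z = (Psi : pathT -> m.-tuple R) \o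
      (fun x r => Z r + ramps b kk (t2rv x *m B) r)); last first.
    by apply/funext => x; exact: GE.
  apply: (measurableT_comp mPsi) => _ C mC; rewrite setTI.
  apply: (@measurable_path_eventT R n Tm _ _
    (fun (x : m.-tuple R) r => Z r + ramps b kk (t2rv x *m B) r)) => // r j.
  under eq_fun do rewrite mxE.
  by apply: measurable_funD.
pose Y (xw : m.-tuple R * T) : bpath R n :=
  fun r => W xw.2 r + ramps b kk (t2rv xw.1 *m B) r.
pose E := [set xw | A (Psi (Y xw))].
have mE : measurable E.
  have mY : measurable_fun setT (Y : _ -> pathT).
    move=> _ C mC; rewrite setTI.
    apply: (@measurable_path_eventT R n Tm _ _ Y) => // r j.
    rewrite (_ : (fun w => _) = (fun xw : m.-tuple R * T => W xw.2 r ord0 j +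
       ramps b kk (t2rv xw.1 *m B) r ord0 j)); last first.
      by apply/funext => xw; rewrite mxE.
    apply: measurable_funD.
      exact: (measurableT_comp (mW r j) measurable_snd).
    exact: (measurableT_comp (mramps r j) measurable_fst).
  by have := (measurableT_comp mPsi mY) measurableT _ mA; rewrite setTI.
have mD : measurable (tball (0 : 'rV[R]_m) delta) := measurable_tball 0 (ltW d0).
have lD : (lam (tball 0 delta) < +oo)%E by rewrite lam_tball ?ltry// ltW.
(* Restriction to the ball makes Lebesgue measure finite, as required for Tonelli's theorem. *)
pose m1 : {finite_measure set (m.-tuple R) -> \bar R} := mfrestr mD lD.
have PE x : P [set w | E (x, w)] = 0%E.
  have PB : P (W @^-1` (Psi @^-1` A)) = 0%E.
    rewrite -PA; congr (P _); apply/seteqP; split => w /=;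
      by rewrite /Psi (functional_versionE T0 Fcont Fadapt).
  apply: (null_shift_ramps kk (t2rv x *m B) qP) PB.
  by have := mPsi measurableT _ mA; rewrite setTI.
have mf : measurable_fun [set: m.-tuple R * T] (fun xw => (\1_E xw)%:E : \bar R).
  by apply/measurable_EFinP; exact: measurable_indic.
have f0 xw : (0 <= (\1_E xw)%:E :> \bar R)%E by rewrite lee_fin indicE.
have secP (x : m.-tuple R) : (\int[P]_w (\1_E (x, w))%:E = 0)%E.
  have mEx : measurable [set w | E (x, w)].
    have := measurable_xsection x mE; rewrite /xsection/=.
    rewrite (_ : [set y | (x, y) \in E] = [set w | E (x, w)])//.
    by apply/seteqP; split => w /= => [/set_mem|/mem_set].
  transitivity (P ([set w | E (x, w)] `&` setT)); last by rewrite setIT PE.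
  by rewrite -integral_indic.
have fub := fubini_tonelli (m1 := m1) (m2 := P) (fun xw => (\1_E xw)%:E) mf f0.
have I0 : (\int[P]_w \int[m1]_x (\1_E (x, w))%:E = 0)%E.
  by rewrite -fub; under eq_integral do rewrite secP; rewrite integral0.
have mI : measurable_fun setT (fun w => \int[m1]_x (\1_E (x, w))%:E)%E.
  exact: (measurable_fun_fubini_tonelli_G (m1 := m1) (fun xw => (\1_E xw)%:E)).
have aeI : ae_eq P setT (fun w => \int[m1]_x (\1_E (x, w))%:E)%E (cst 0%E).
  apply/(ae_eq_integral_abs P measurableT mI); rewrite -[RHS]I0.
  by apply: eq_integral => w _; rewrite gee0_abs//; apply: integral_ge0.
have [N [mN PN NE]] := aeI.
have [B0 [pB0 PB0 B0V]] := brownian_support BM T0 OVb e0.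
have mB0 : measurable (W @^-1` B0) by apply: measurable_path_eventT pB0.
(* The tube event has positive probability, so it is not contained in the exceptional null set. *)
have [w [Bw Nw]] : exists w, B0 (W w) /\ ~ N w.
  apply: contrapT => H; move/negP: PB0; apply; apply/eqP.
  apply: (@subset_measure0 _ _ _ P _ N) => // w Bw.
  by apply: contrapT => Nw; apply: H; exists w.
exists (W w); split; [exact: OW|exact: B0V|exact: mG|].
have Ew : (\int[m1]_x (\1_E (x, w))%:E = 0)%E.
  by apply: contrapT => h; apply: Nw; apply: NE => /= /(_ I).
have mEw : measurable [set x | E (x, w)].
  have := measurable_ysection w mE; rewrite /ysection.
  by rewrite (_ : [set x | (x, w) \in E] = [set x | E (x, w)])//;
    apply/seteqP; split => x /= => [/set_mem|/mem_set].
rewrite -[RHS]Ew.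
transitivity (m1 [set x | E (x, w)]); last first.
  by rewrite -[in LHS](setIT [set x | E (x, w)]) -integral_indic.
rewrite /m1/= /mfrestr /mrestr setIC; congr (lam (_ `&` _)).
by apply/seteqP; split => x /=; rewrite GE.
Qed.

End good_path.

(** * Riesz representation *)

Section inner_product.
Context (R : realType) (X : completeNormedModType R) (ip : X -> X -> R).
Hypothesis ipP : is_inner_product ip.

Lemma ipC x y : ip x y = ip y x. Proof. by case: ipP. Qed.

Lemma ipZDl a x y z : ip (a *: x + y) z = a * ip x z + ip y z.
Proof. by case: ipP. Qed.

Lemma ipxx x : ip x x = `|x| ^+ 2. Proof. by case: ipP. Qed.

Lemma ipDl x y z : ip (x + y) z = ip x z + ip y z.
Proof. by have := ipZDl 1 x y z; rewrite scale1r mul1r. Qed.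

Lemma ip0l z : ip 0 z = 0.
Proof. by have := ipDl 0 0 z; rewrite addr0; lra. Qed.

Lemma ipZl a x z : ip (a *: x) z = a * ip x z.
Proof. by have := ipZDl a x 0 z; rewrite addr0 ip0l addr0. Qed.

Lemma ipBl x y z : ip (x - y) z = ip x z - ip y z.
Proof. by rewrite -scaleN1r ipDl ipZl mulN1r. Qed.

Lemma ipBr x y z : ip z (x - y) = ip z x - ip z y.
Proof. by rewrite ipC ipBl !(ipC _ z). Qed.

Lemma ipDr x y z : ip z (x + y) = ip z x + ip z y.
Proof. by rewrite ipC ipDl !(ipC _ z). Qed.

Lemma ipZr a x z : ip z (a *: x) = a * ip z x.
Proof. by rewrite ipC ipZl (ipC z). Qed.

Lemma ip_cauchy_schwarz x y : `|ip x y| <= `|x| * `|y|.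
Proof.
have [->|y0] := eqVneq y 0; first by rewrite ipC ip0l !normr0 mulr0.
have ny : 0 < `|y| by rewrite normr_gt0.
have : 0 <= `|x - (ip x y / `|y| ^+ 2) *: y| ^+ 2 by rewrite exprn_ge0.
rewrite -ipxx ipBl !ipBr !ipZr !ipZl !ipxx (ipC y x).
have -> : `|x| ^+ 2 - ip x y / `|y| ^+ 2 * ip x y -
    (ip x y / `|y| ^+ 2 * ip x y - ip x y / `|y| ^+ 2 * (ip x y / `|y| ^+ 2 * `|y| ^+ 2)) =
    `|x| ^+ 2 - ip x y ^+ 2 / `|y| ^+ 2 by field; rewrite gt_eqF.
rewrite subr_ge0 ler_pdivrMr ?exprn_gt0// -exprMn => h.
by rewrite -ler_sqr ?nnegrE ?mulr_ge0// real_normK// num_real.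
Qed.

Lemma ip_continuousl xi : continuous (ip ^~ xi).
Proof.
move=> x; apply/cvgrPdist_lt => e e0; near=> y.
rewrite -ipBl; apply: le_lt_trans (ip_cauchy_schwarz _ _) _.
apply: (@le_lt_trans _ _ (`|x - y| * (`|xi| + 1))).
  by rewrite ler_wpM2l// lerDl.
rewrite -ltr_pdivlMr ?ltr_wpDl//; near: y.
by apply: cvgr_dist_lt; [exact: cvg_id|rewrite divr_gt0// ltr_wpDl].
Unshelve. all: by end_near. Qed.

(* The representing vector minimises [|x|^2 - 2 l x]; minimising sequences are
   Cauchy by the parallelogram law. *)
Lemma riesz_representation (l : X -> R) :
  (forall a x y, l (a *: x + y) = a * l x + l y) -> continuous l ->
  exists xi, forall x, l x = ip x xi.
Proof.
move=> lin cl.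
have l0 : l 0 = 0 by have := lin 1 0 0; rewrite scale1r addr0; lra.
have lZ a x : l (a *: x) = a * l x by rewrite -[a *: x]addr0 lin l0 addr0.
have lD x y : l (x + y) = l x + l y by rewrite -[x]scale1r lin mul1r scale1r.
have [M M0 lM] : exists2 M, 0 < M & forall x, l x <= M * `|x|.
  have /cvgrPdist_lt/(_ _ ltr01) := cl 0; rewrite l0.
  move=> /nbhs_ballP[r /= r0 rl]; exists (2 / r); first by rewrite divr_gt0.
  move=> x; have [->|x0] := eqVneq x 0; first by rewrite l0 normr0 mulr0.
  have nx : 0 < `|x| by rewrite normr_gt0.
  have c0 : 0 < r / (2 * `|x|) by rewrite divr_gt0// mulr_gt0.
  have : ball 0 r ((r / (2 * `|x|)) *: x).
    rewrite -ball_normE/= sub0r normrN normrZ gtr0_norm//.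
    have -> : r / (2 * `|x|) * `|x| = r / 2 by field; rewrite gt_eqF.
    lra.
  move=> /rl /=; rewrite sub0r normrN lZ normrM gtr0_norm// => h.
  apply: le_trans (ler_norm _) _.
  rewrite -(ler_pM2l c0); apply: le_trans (ltW h) _.
  have -> : r / (2 * `|x|) * (2 / r * `|x|) = 1 by field; rewrite !gt_eqF.
  by [].
pose J x := `|x| ^+ 2 - 2 * l x.
have Jlb x : - M ^+ 2 <= J x.
  have h := lM x; have := sqr_ge0 (`|x| - M); rewrite /J sqrrB; lra.
pose E := range J.
have Einf : has_inf E.
  by split; [exists (J 0), 0|exists (- M ^+ 2) => _ [x _ <-]].
pose c := inf E.
have cJ x : c <= J x by apply: ge_inf => //; [case: Einf|exists x].
have /choice[x_ xP] : forall k : nat, exists x, J x < c + k.+1%:R^-1.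
  move=> k; have k0 : 0 < k.+1%:R^-1 :> R by rewrite invr_gt0.
  by have [_ [x _ <-] h] := inf_adherent k0 Einf; exists x.
have aux (a1 a2 a3 b1 b2 e : R) :
    e <= 2^-1 * (2^-1 * (a1 + a2 + (a2 + a3))) - 2 * (2^-1 * (b1 + b2)) ->
    a1 - a2 - (a2 - a3) <= 2 * (a1 - 2 * b1 - e) + 2 * (a3 - 2 * b2 - e).
  lra.
(* Parallelogram law, combined with the lower bound [c] for [J] at the midpoint. *)
have par x y : `|x - y| ^+ 2 <= 2 * (J x - c) + 2 * (J y - c).
  have := cJ (2^-1 *: (x + y)).
  rewrite /J -!ipxx !(ipBl, ipBr, ipZl, ipZr, ipDl, ipDr) lZ lD (ipC y x).
  exact: aux.
have xc : cvgn x_.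
  apply/cauchy_cvgP; apply: cauchy_exP => e e0.
  (* Two indices beyond [k] give a squared distance at most [4 / (k + 1)], which is below
     [e ^+ 2]. *)
  pose k := Num.bound (4 / e ^+ 2).
  have e2 : 0 < e ^+ 2 by rewrite exprn_gt0.
  have kP : 4 / e ^+ 2 < k%:R by apply: archi_boundP; rewrite divr_ge0// ltW.
  have k1 : 4 * k.+1%:R^-1 < e ^+ 2.
    rewrite ltr_pdivrMr// -ltr_pdivrMl// mulrC; apply: lt_le_trans kP _.
    by rewrite ler_nat.
  exists (x_ k); exists k => // i /= ki.
  rewrite -ball_normE/= -ltr_sqr ?nnegrE ?(ltW e0)//.
  apply: le_lt_trans (par _ _) _; have h1 := xP k; have h2 := xP i.
  have h3 : i.+1%:R^-1 <= k.+1%:R^-1 :> R by rewrite lef_pV2 ?posrE// ler_nat.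
  move: h1 h2 h3 k1.
  move: (J (x_ k)) (J (x_ i)) (k.+1%:R^-1) (i.+1%:R^-1) (e ^+ 2) => a1 a2 a3 a4 a5; lra.
move/cvg_ex: xc => [/= xi xxi].
have Jxi : J xi <= c.
  have cJx : (fun k => J (x_ k)) @ \oo --> J xi.
    rewrite /J; apply: cvgB.
      by rewrite expr2; under eq_fun do rewrite expr2; apply: cvgM; exact: cvg_norm.
    by apply: cvgM; [exact: cvg_cst|apply: (cvg_comp x_ l xxi); exact: cl].
  have ch : (fun k => c + k.+1%:R^-1) @ \oo --> c + 0.
    by apply: cvgD; [exact: cvg_cst|exact: cvg_harmonic].
  rewrite -[leRHS]addr0; apply: (ler_cvg_to cJx ch); apply: nearW => k.
  exact/ltW/xP.
exists xi => x.
(* Minimality of [xi] along the line through [xi] with direction [x]. *)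
have key s : 0 <= s ^+ 2 * `|x| ^+ 2 + 2 * s * (ip x xi - l x).
  have := le_trans Jxi (cJ (s *: x + xi)).
  rewrite /J lin -!ipxx ipDl !ipDr !ipZl !ipZr (ipC xi x); lra.
set d := ip x xi - l x in key.
suff : d = 0 by rewrite /d; lra.
apply/eqP/negPn/negP => d0.
have q0 : 0 < `|x| ^+ 2 + 1 by rewrite ltr_wpDl// exprn_ge0.
(* Near the minimiser of the quadratic in [s]; the added 1 also covers [x = 0]. *)
have := key (- d / (`|x| ^+ 2 + 1)).
have -> : (- d / (`|x| ^+ 2 + 1)) ^+ 2 * `|x| ^+ 2 + 2 * (- d / (`|x| ^+ 2 + 1)) * d =
    - (d ^+ 2 * ((`|x| ^+ 2 + 2) / (`|x| ^+ 2 + 1) ^+ 2)) by field; rewrite gt_eqF.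
rewrite oppr_ge0 leNgt => /negP; apply.
have dd : 0 < d ^+ 2 by rewrite exprn_even_gt0.
have p2 : 0 < `|x| ^+ 2 + 2 by rewrite ltr_wpDl// exprn_ge0.
by rewrite mulr_gt0// divr_gt0// exprn_gt0.
Qed.

End inner_product.

(** Greedy choice: while the rank is below [m], some nonzero column [a] is annihilated by all chosen
    rows, and a [v i] with [v i *m a != 0] lies outside their span. Rank [m] then gives the left
    inverse [B]. *)
Lemma spanning_family (K : fieldType) (m : nat) (I : Type) (v : I -> 'rV[K]_m) :
  (forall a : 'cV[K]_m, a != 0 -> exists i, v i *m a != 0) ->
  exists (k : nat) (l : 'I_k -> I) (B : 'M[K]_(m, k)),
    B *m (\matrix_(j < k) v (l j)) = 1%:M.
Proof.
move=> vP.
suff H r : (r <= m)%N -> exists (k : nat) (l : 'I_k -> I),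
    (r <= \rank (\matrix_(j < k) v (l j)))%N.
  have [k [l rk]] := H _ (leqnn m).
  have /row_fullP[B BE] : row_full (\matrix_(j < k) v (l j)).
    by rewrite /row_full eqn_leq rank_leq_col.
  by exists k, l, B.
elim: r => [_|r IH rm].
  by exists 0%N, (fun j : 'I_0 => match j with Ordinal _ h => False_rect _ (notF h) end).
have [k [l rk]] := IH (ltnW rm).
set M := \matrix_(j < k) v (l j) in rk.
have [rk'|rk'] := ltnP r (\rank M); first by exists k, l.
have rE : \rank M = r by apply/eqP; rewrite eqn_leq rk rk'.
have : cokermx M != 0 by rewrite -mxrank_eq0 mxrank_coker rE -lt0n subn_gt0.
move=> /eqP cM; have [j0 cj] : exists j, col j (cokermx M) != 0.
  apply: contrapT => /forallNP h; apply: cM; apply/matrixP => i j.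
  have /negP/negPn/eqP/matrixP/(_ i ord0) := h j; by rewrite !mxE.
have Ma : M *m col j0 (cokermx M) = 0 by rewrite colE mulmxA mulmx_coker mul0mx.
have [i vi] := vP _ cj.
pose l' (j : 'I_k.+1) := if unlift ord_max j is Some j' then l j' else i.
exists k.+1, l'; set M' := \matrix_(j < k.+1) v (l' j).
have MM' : (M <= M')%MS.
  apply/row_subP => j; rewrite rowK.
  have -> : v (l j) = row (lift ord_max j) M' by rewrite rowK /l' liftK.
  exact: row_sub.
rewrite -rE ltn_neqAle mxrankS// andbT; apply/negP => /eqP rMM'.
have : (M' <= M)%MS by rewrite -(geq_leqif (mxrank_leqif_sup MM')) rMM'.
move=> /row_subP/(_ ord_max); rewrite rowK /l' unlift_none => /submxP[D vD].
by move/eqP: vi; apply; rewrite vD -mulmxA Ma mulmx0.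
Qed.

(** * Integrals over initial segments and dyadic tests for vanishing *)

Section segment_integrals.
Context (R : realType).
Notation leb := (@lebesgue_measure R).

Lemma itv0E (b : R) : itv0 b = `[0, b]%classic.
Proof. by apply/seteqP; split => x /=; rewrite in_itv. Qed.

Lemma measurable_itv0 (b : R) : measurable (itv0 b).
Proof. by rewrite itv0E; exact: measurable_itv. Qed.

Lemma integrable_itv0 (b : R) (g : R -> R) : continuous g ->
  leb.-integrable (itv0 b) (EFin \o g).
Proof.
move=> cg; rewrite itv0E; apply: continuous_compact_integrable; first exact: segment_compact.
exact: continuous_subspaceT.
Qed.

Lemma Rintegral_itv0_cst (b r : R) : 0 <= b -> Rintegral leb (itv0 b) (fun=> r) = r * b.
Proof.
move=> b0; rewrite Rintegral_cst; last exact: measurable_itv0.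
rewrite itv0E; have := @lebesgue_measure_itv R `[0, b]; rewrite /= lte_fin => ->.
case: ltP => [_|bl].
  by rewrite oppr0 adde0.
by rewrite (_ : b = 0) ?mulr0//; apply/eqP; rewrite eq_le bl b0.
Qed.

Lemma Rintegral_sum (A : set R) (I : Type) (s : seq I) (f : I -> R -> R) : measurable A ->
  (forall i, leb.-integrable A (EFin \o f i)) ->
  leb.-integrable A (EFin \o (fun x => \sum_(i <- s) f i x)) /\
  Rintegral leb A (fun x => \sum_(i <- s) f i x) = \sum_(i <- s) Rintegral leb A (f i).
Proof.
move=> mA fI; elim: s => [|i s [IH1 IH2]].
  rewrite big_nil; split.
    rewrite (_ : EFin \o _ = (fun=> 0%E)); first exact: integrable0.
    by apply/funext => x /=; rewrite big_nil.
  by under eq_Rintegral do rewrite big_nil; rewrite /Rintegral integral0.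
split.
  rewrite (_ : EFin \o _ = (EFin \o f i) \+ (EFin \o (fun x => \sum_(j <- s) f j x))).
    exact: integrableD.
  by apply/funext => x /=; rewrite big_cons EFinD.
by under eq_Rintegral do rewrite big_cons; rewrite RintegralD// IH2 big_cons.
Qed.

Lemma Rintegral_mul_step (K : nat) (b al : 'I_K -> R) (g : R -> R) (c : R) :
  continuous g ->
  Rintegral leb (itv0 c) (fun x => g x * \sum_(l < K) al l * \1_(itv0 (b l)) x) =
  \sum_(l < K) al l * Rintegral leb (itv0 (Num.min c (b l))) g.
Proof.
move=> cg.
have mc := measurable_itv0 c.
have E l : itv0 c `&` itv0 (b l) = itv0 (Num.min c (b l)).
  apply/seteqP; split => x; rewrite /itv0/= le_min; first by move=> [/andP[-> ->] /andP[_ ->]].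
  by move=> /andP[-> /andP[-> ->]].
have rI l : leb.-integrable (itv0 c) (EFin \o (g \_ (itv0 (b l)))).
  rewrite -restrict_EFin; apply/integrable_restrict => //; first exact: measurable_itv0.
  by rewrite E; exact: integrable_itv0.
have fI l : leb.-integrable (itv0 c) (EFin \o (fun x => al l * (g \_ (itv0 (b l))) x)).
  rewrite (_ : EFin \o _ = (fun x => (al l)%:E * (EFin \o (g \_ (itv0 (b l)))) x)%E).
    exact: integrableZl.
  by apply/funext => x /=; rewrite EFinM.
rewrite (_ : (fun x => _) = (fun x => \sum_(l < K) al l * (g \_ (itv0 (b l))) x)).
  rewrite (Rintegral_sum _ mc fI).2; apply: eq_bigr => l _.
  by rewrite RintegralZl// -Rintegral_mkcondr E.
apply/funext => x; rewrite mulr_sumr; apply: eq_bigr => l _.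
rewrite patchE indicE; case: ifP => _; last by rewrite !mulr0.
by rewrite mulr1 mulrC.
Qed.

Lemma Rintegral_itv0_le (b e : R) (f : R -> R) : 0 <= b -> continuous f ->
  (forall x, 0 <= x <= b -> `|f x| <= e) -> `|Rintegral leb (itv0 b) f| <= e * b.
Proof.
move=> b0 cf fe; have mb := measurable_itv0 b.
apply: le_trans (le_normr_Rintegral _ _) _ => //; first exact: integrable_itv0.
rewrite -Rintegral_itv0_cst//; apply: le_Rintegral => //.
- apply: (@integrable_itv0 b (fun x => `|f x|)) => x.
  by apply: (cvg_comp f (fun y : R => `|y|)); [exact: cf|exact: norm_continuous].
- by apply: (@integrable_itv0 b (fun=> e)) => x; exact: cvg_cst.
Qed.

(** If [g s > 0], then [g] exceeds [g s / 2] on a whole grid step around [s], although its integral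
    there is a difference of two vanishing integrals. *)
Lemma dyadic_integrals_le0 (Tm : R) (g : R -> R) : 0 < Tm -> continuous g ->
  (forall N i, (i <= 2 ^ N)%N -> Rintegral leb (itv0 (grid Tm N i)) g = 0) ->
  forall s, 0 <= s <= Tm -> g s <= 0.
Proof.
move=> T0 cg gI s sT; rewrite leNgt; apply/negP => gs.
have g2 : 0 < g s / 2 by rewrite divr_gt0.
have [dl dl0 gdl] := unif_cont_segment 0 Tm cg g2.
have [N hN] := exp2N_small (divr_gt0 dl0 T0).
have [l lN /andP[l1 l2]] := grid_lookup N sT.
have step : grid Tm N l.+1 - grid Tm N l <= dl.
  by rewrite grid_step mulrC -ler_pdivlMr//; exact: hN.
have stepP : 0 < grid Tm N l.+1 - grid Tm N l by rewrite grid_step divr_gt0// exprn_gt0.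
have l0 : 0 <= grid Tm N l := grid_ge0 T0 N l.
have lT : grid Tm N l.+1 <= Tm by rewrite -[leRHS](grid_end Tm N) ler_grid.
have I0 := @integrable_itv0 (grid Tm N l.+1) g cg; rewrite itv0E in I0.
have := @Rintegral_itvB R g (BLeft 0) (BRight (grid Tm N l.+1)) (grid Tm N l) I0.
rewrite -!itv0E !gI//; last exact: ltnW.
rewrite subrr => /(_ _ _) E.
have {E} : 0 = Rintegral leb `]grid Tm N l, grid Tm N l.+1]%classic g.
  by apply: E; rewrite ?bnd_simp// ltW// -subr_gt0.
apply/eqP; rewrite lt_eqF//.
apply: (@lt_le_trans _ _ (g s / 2 * (grid Tm N l.+1 - grid Tm N l))).
  by rewrite mulr_gt0.
have sub : `]grid Tm N l, grid Tm N l.+1]%classic `<=` `[0, grid Tm N l.+1]%classic.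
  by move=> x /=; rewrite !in_itv/= => /andP[x1 ->]; rewrite andbT (le_trans l0)// ltW.
have -> : g s / 2 * (grid Tm N l.+1 - grid Tm N l) =
    Rintegral leb `]grid Tm N l, grid Tm N l.+1]%classic (fun=> g s / 2).
  rewrite Rintegral_cst//.
  have := @lebesgue_measure_itv R `]grid Tm N l, grid Tm N l.+1].
  by rewrite /= lte_fin -subr_gt0 stepP => ->.
have c2 : continuous (fun _ : R => g s / 2) by move=> x; exact: cvg_cst.
have iS (h : R -> R) : continuous h ->
    leb.-integrable `]grid Tm N l, grid Tm N l.+1]%classic (EFin \o h).
  move=> ch; have := @integrable_itv0 (grid Tm N l.+1) h ch; rewrite itv0E.
  by apply: integrableS => //; exact: measurable_itv.
apply: le_Rintegral; [exact: measurable_itv|exact: iS|exact: iS|].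
move=> x /=; rewrite in_itv/= => /andP[x1 x2].
have xT : 0 <= x <= Tm by rewrite (le_trans l0 (ltW x1)) (le_trans x2 lT).
have sx : `|s - x| <= dl by rewrite ler_distl; apply/andP; split; lra.
have := gdl _ _ sT xT sx; rewrite ltr_norml => /andP[_]; lra.
Qed.

Lemma dyadic_integrals_eq0 (Tm : R) (g : R -> R) : 0 < Tm -> continuous g ->
  (forall N i, (i <= 2 ^ N)%N -> Rintegral leb (itv0 (grid Tm N i)) g = 0) ->
  forall s, 0 <= s <= Tm -> g s = 0.
Proof.
move=> T0 cg gI s sT; apply/eqP; rewrite eq_le (dyadic_integrals_le0 T0 cg gI sT)/=.
have cNg : continuous (fun x => - g x) by move=> x; apply: cvgN; exact: cg.
rewrite -oppr_le0; apply: (dyadic_integrals_le0 T0 cNg) sT => N i iN.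
have -> : (fun x => - g x) = (fun x => (-1) * g x) by apply/funext => x; rewrite mulN1r.
rewrite RintegralZl ?gI ?mulr0//; [exact: measurable_itv0|exact: integrable_itv0].
Qed.

End segment_integrals.

(** * Derivatives of the flow *)

Section flow.
Context (R : realType) (X : completeNormedModType R) (ip : X -> X -> R).
Context (n : nat) (sigma : 'I_n -> X) (phi : R -> X -> bpath R n -> X).
Hypotheses (ipP : is_inner_product ip) (cocyc : is_cont_adapted_cocycle phi).
Hypothesis asA : assumptionA ip sigma phi.
Implicit Types (V Z : bpath R n) (u : X).

Lemma in_Omega_shift s V : in_Omega V -> in_Omega (Defs.shift s V).
Proof.
move=> [cV V0]; split; last by rewrite /Defs.shift/= add0r subrr.
move=> r; apply: cvgB; last exact: cvg_cst.
apply: (cvg_comp (fun r => r + s) V); last exact: cV.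
by apply: cvgD; [exact: cvg_id|exact: cvg_cst].
Qed.

Lemma loc_unif_cvg_cst V : loc_unif_cvg (fun=> V) V.
Proof. by move=> B e e0; apply: nearW => k r _; rewrite subrr normr0. Qed.

Lemma loc_unif_cvg_shift (sk : nat -> R) s (Vk : nat -> bpath R n) V :
  sk @ \oo --> s -> in_Omega V -> loc_unif_cvg Vk V ->
  loc_unif_cvg (fun k => Defs.shift (sk k) (Vk k)) (Defs.shift s V).
Proof.
move=> sks [cV _] VkV B e e0; have e4 : 0 < e / 4 by lra.
(* Once [sk k] is within 1 of [s], all the times involved lie in [[- M, M]]. *)
pose M := `|B| + `|s| + 1.
have [dl dl0 Vdl] := unif_cont_segment (- M) M cV e4.
have md : 0 < Num.min dl 1 by rewrite lt_min dl0/=.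
have /cvgrPdist_le/(_ _ md) [N1 _ h1] := sks.
have [N2 _ h2] := VkV M _ e4.
exists (maxn N1 N2) => // k /=; rewrite geq_max => /andP[k1 k2] r rB.
have := h1 k k1; rewrite /= le_min => /andP[d1 d2].
have rB' : `|r| <= `|B| by rewrite (le_trans rB)// ler_norm.
have sM : `|s| <= M by rewrite /M; have := normr_ge0 B; lra.
have skM : `|sk k| <= M.
  rewrite -(subrK s (sk k)); apply: le_trans (ler_normD _ _) _.
  by rewrite distrC /M; have := normr_ge0 B; lra.
have rsM : `|r + s| <= M by apply: le_trans (ler_normD _ _) _; rewrite /M; lra.
have rskM : `|r + sk k| <= M.
  rewrite (_ : r + sk k = (r + s) - (s - sk k)); last by ring.
  apply: le_trans (ler_normB _ _) _; have := ler_normD r s; rewrite /M; lra.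
have a1 := h2 k k2 _ rskM; have a2 := h2 k k2 _ skM.
have a3 : `|V (r + sk k) - V (r + s)| < e / 4.
  apply: Vdl; rewrite -?ler_norml// distrC.
  by rewrite (_ : _ - _ = s - sk k)//; ring.
have a4 : `|V (sk k) - V s| < e / 4 by apply: Vdl; rewrite -?ler_norml// distrC.
rewrite /Defs.shift.
have -> : Vk k (r + sk k) - Vk k (sk k) - (V (r + s) - V s) =
    (Vk k (r + sk k) - V (r + sk k)) + (V (r + sk k) - V (r + s)) -
    ((Vk k (sk k) - V (sk k)) + (V (sk k) - V s)).
  by apply/rowP => i; rewrite !mxE; ring.
apply: le_lt_trans (ler_normB _ _) _.
apply: le_lt_trans (lerD (ler_normD _ _) (ler_normD _ _)) _.
lra.
Qed.

Lemma phi_adapted t u V V' : 0 <= t -> in_Omega V -> in_Omega V' ->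
  (forall r, 0 <= r <= t -> V r = V' r) -> phi t u V = phi t u V'.
Proof. by case: cocyc => _ _ + _; apply. Qed.

Lemma phi_seq_cvg t u (Vk : nat -> bpath R n) V : 0 <= t ->
  (forall k, in_Omega (Vk k)) -> in_Omega V -> loc_unif_cvg Vk V ->
  (fun k => phi t u (Vk k)) @ \oo --> phi t u V.
Proof.
move=> t0 OVk OV VkV; case: cocyc => _ _ _ h.
by apply: (h (fun=> t) (fun=> u)) => //; exact: cvg_cst.
Qed.

Lemma J_seq_cvg Tm u (sk : nat -> R) s (Vk : nat -> bpath R n) V xi :
  (forall k, 0 <= sk k <= Tm) -> 0 <= s <= Tm -> sk @ \oo --> s ->
  (forall k, in_Omega (Vk k)) -> in_Omega V -> loc_unif_cvg Vk V ->
  (fun k => Jst phi (sk k) Tm u (Vk k) xi) @ \oo --> Jst phi s Tm u V xi.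
Proof.
move=> skT sT sks OVk OV VkV.
case: asA => _ _ DuC _ _.
apply: (DuC (fun k => Tm - sk k) (fun k => phi (sk k) u (Vk k))
  (fun k => Defs.shift (sk k) (Vk k)) (fun=> xi)).
- by move=> k; rewrite subr_ge0; case/andP: (skT k).
- by move=> k; exact: in_Omega_shift.
- by rewrite subr_ge0; case/andP: sT.
- exact: in_Omega_shift.
- by apply: cvgB => //; exact: cvg_cst.
- case: cocyc => _ _ _ h; apply: (h sk (fun=> u)) => //.
  + by move=> k; case/andP: (skT k).
  + by case/andP: sT.
  + exact: cvg_cst.
- exact: loc_unif_cvg_shift.
- exact: cvg_cst.
Qed.

Lemma J_adapted Tm u V V' s : in_Omega V -> in_Omega V' ->
  (forall r, 0 <= r <= Tm -> V r = V' r) -> 0 <= s <= Tm ->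
  Jst phi s Tm u V = Jst phi s Tm u V'.
Proof.
move=> OV OV' VV' /andP[s0 sT]; rewrite /Jst /Du.
have -> : phi s u V = phi s u V'.
  apply: phi_adapted => // r /andP[r0 rs]; apply: VV'.
  by rewrite r0 (le_trans rs).
congr ('d _ _); apply/funext => w; apply: phi_adapted.
- by rewrite subr_ge0.
- exact: in_Omega_shift.
- exact: in_Omega_shift.
move=> r /andP[r0 rs]; rewrite /Defs.shift !VV'// ?s0// addr_ge0//=.
by rewrite -lerBrDr.
Qed.

(** The chain rule for the cocycle identity that composes the flow from [r] to [t] with the flow
    from [t] to [t + s]. *)
Lemma J_chain r t s u V xi : 0 <= r <= t -> 0 <= s -> in_Omega V ->
  Jst phi r (t + s) u V xi = Jst phi t (t + s) u V (Jst phi r t u V xi).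
Proof.
move=> /andP[r0 rt] s0 OV; rewrite /Jst /Du.
have [_ coc _ _] := cocyc; have [_ dif _ _ _] := asA.
have tr : 0 <= t - r by rewrite subr_ge0.
have OZ : in_Omega (Defs.shift r V) by exact: in_Omega_shift.
have shE : Defs.shift (t - r) (Defs.shift r V) = Defs.shift t V.
  apply/funext => x; rewrite /Defs.shift.
  have -> : x + (t - r) + r = x + t by ring.
  have -> : t - r + r = t by ring.
  by apply/rowP => i; rewrite !mxE; ring.
have tE : t + s - r = s + (t - r) by ring.
have -> : (fun w => phi (t + s - r) w (Defs.shift r V)) =
    (fun w => phi s w (Defs.shift t V)) \o (fun w => phi (t - r) w (Defs.shift r V)).
  by apply/funext => w; rewrite /= tE coc// shE.
have pE : phi (t - r) (phi r u V) (Defs.shift r V) = phi t u V.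
  by rewrite -coc// subrK.
have d1 : differentiable (fun w => phi (t - r) w (Defs.shift r V)) (phi r u V).
  exact: dif.
have d2 : differentiable (fun w => phi s w (Defs.shift t V)) (phi (t - r) (phi r u V) (Defs.shift r V)).
  by apply: dif => //; exact: in_Omega_shift.
rewrite diff_comp//= pE (_ : t + s - t = s)//; ring.
Qed.

End flow.

Lemma seq_continuous (R : realType) (f : R -> R) :
  (forall (v : nat -> R) s, v @ \oo --> s -> (fun k => f (v k)) @ \oo --> f s) ->
  continuous f.
Proof.
move=> fs s; apply/cvgrPdist_lt => e e0; apply: contrapT => H.
have /choice[v Hv] : forall k : nat, exists x, `|s - x| <= k.+1%:R^-1 /\ ~ `|f s - f x| < e.
  move=> k; apply: contrapT => nk; apply: H.
  have k0 : 0 < k.+1%:R^-1 :> R by rewrite invr_gt0.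
  apply/nbhs_ballP; exists k.+1%:R^-1 => //= x /=; rewrite /ball/= => /ltW sx.
  by apply: contrapT => h; apply: nk; exists x.
have vs : v @ \oo --> s.
  by apply: (@invS_cvg_dist _ (fun=> s)); [move=> k; exact: (Hv k).1|exact: cvg_cst].
have [N _ /(_ N (leqnn N))] := (cvgrPdist_lt _ _).1 (fs _ _ vs) _ e0.
exact: (Hv N).2.
Qed.

Section flow_derivative.
Context (R : realType) (X : completeNormedModType R) (ip : X -> X -> R).
Context (n : nat) (sigma : 'I_n -> X) (phi : R -> X -> bpath R n -> X).
Hypotheses (ipP : is_inner_product ip) (cocyc : is_cont_adapted_cocycle phi).
Hypothesis asA : assumptionA ip sigma phi.
Variables (u : X) (Tm : R).
Hypothesis T0 : 0 < Tm.
Implicit Types (V Z : bpath R n).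
Notation leb := (@lebesgue_measure R).

Let T0' : 0 <= Tm := ltW T0.

(** Integrand of the derivative along Cameron-Martin paths, paired with [xi]; clamping the time
    extends it to a continuous function on the line. *)
Definition response k xi Z (s : R) : R := ip (Jst phi (ramp Tm s) Tm u Z (sigma k)) xi.

Lemma response_continuous k xi Z : in_Omega Z -> continuous (response k xi Z).
Proof.
move=> OZ; apply: seq_continuous => v s vs.
have rT r : 0 <= ramp Tm r <= Tm := ramp_bounds r T0'.
have c : (fun k0 => Jst phi (ramp Tm (v k0)) Tm u Z (sigma k)) @ \oo -->
    Jst phi (ramp Tm s) Tm u Z (sigma k).
  apply: (@J_seq_cvg _ _ _ _ _ _ cocyc asA Tm u (fun k0 => ramp Tm (v k0)) (ramp Tm s)
    (fun=> Z) Z (sigma k)) => //.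
    by apply: (cvg_comp v (ramp Tm) vs); exact: ramp_continuous.
  exact: loc_unif_cvg_cst.
by apply: (cvg_comp _ (ip ^~ xi) c); exact: ip_continuousl.
Qed.

Lemma loc_unif_cvg_stop (Zk : nat -> bpath R n) Z :
  (forall k r, 0 <= r <= Tm -> `|Zk k r - Z r| <= k.+1%:R^-1) ->
  loc_unif_cvg (fun k => stop Tm (Zk k)) (stop Tm Z).
Proof.
move=> ZkZ B e e0; have [N _ hN] := (cvgr0Pnorm_lt _).1 (@cvg_harmonic R) _ e0.
exists N => // k /= Nk r _; apply: le_lt_trans (ZkZ k _ (ramp_bounds r T0')) _.
by have := hN k Nk; rewrite /= ger0_norm// invr_ge0.
Qed.

(** Continuity is only given along sequences; a neighbourhood is obtained by contradiction, from
    paths at distance [1 / (k + 1)]. *)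
Lemma flow_close Z e : in_Omega Z -> 0 < e -> exists2 dl, 0 < dl &
  forall Z', in_Omega Z' -> (forall r, 0 <= r <= Tm -> `|Z' r - Z r| <= dl) ->
    `|phi Tm u Z' - phi Tm u Z| <= e.
Proof.
move=> OZ e0; apply: contrapT => H.
have /choice[Zk HZ] : forall k : nat, exists Z', [/\ in_Omega Z',
    (forall r, 0 <= r <= Tm -> `|Z' r - Z r| <= k.+1%:R^-1) &
    ~ `|phi Tm u Z' - phi Tm u Z| <= e].
  move=> k; apply: contrapT => nk; apply: H; exists k.+1%:R^-1 => // Z' OZ' ZZ'.
  by apply: contrapT => h; apply: nk; exists Z'.
have OZk k : in_Omega (Zk k) by case: (HZ k).
have stE Z' : in_Omega Z' -> phi Tm u (stop Tm Z') = phi Tm u Z'.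
  move=> OZ'; apply: (phi_adapted cocyc u T0') => //; first exact: in_Omega_stop.
  by move=> r rT; exact: stop_id.
have c : (fun k => phi Tm u (stop Tm (Zk k))) @ \oo --> phi Tm u (stop Tm Z).
  apply: (@phi_seq_cvg _ _ _ _ cocyc Tm u (fun k => stop Tm (Zk k)) _ T0').
  - by move=> k; exact: in_Omega_stop.
  - exact: in_Omega_stop.
  - by apply: loc_unif_cvg_stop => k; case: (HZ k).
have /cvgrPdist_le/(_ _ e0) [N _ /(_ N (leqnn N))] := c.
by rewrite /= !stE// distrC; case: (HZ N).
Qed.

(** Uniformity in time comes from compactness: along a subsequence the offending clamped times
    converge, and both responses tend to the same limit. *)
Lemma response_close k xi Z e : in_Omega Z -> 0 < e -> exists2 dl, 0 < dl &
  forall Z', in_Omega Z' -> (forall r, 0 <= r <= Tm -> `|Z' r - Z r| <= dl) ->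
    forall s, `|response k xi Z' s - response k xi Z s| <= e.
Proof.
move=> OZ e0; apply: contrapT => H.
have /choice[p Hp] : forall i : nat, exists p : bpath R n * R, [/\ in_Omega p.1,
    (forall r, 0 <= r <= Tm -> `|p.1 r - Z r| <= i.+1%:R^-1) &
    ~ `|response k xi p.1 p.2 - response k xi Z p.2| <= e].
  move=> i; apply: contrapT => nk; apply: H; exists i.+1%:R^-1 => // Z' OZ' ZZ' s.
  by apply: contrapT => h; apply: nk; exists (Z', s).
have rT r : 0 <= ramp Tm r <= Tm := ramp_bounds r T0'.
have [f [l [fk sl lT]]] := bolzano_weierstrass_segment (fun i => rT (p i).2).
have Op i : in_Omega (p i).1 by case: (Hp i).
have stE Z' s : in_Omega Z' ->
    Jst phi (ramp Tm s) Tm u (stop Tm Z') = Jst phi (ramp Tm s) Tm u Z'.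
  move=> OZ'; apply: (J_adapted cocyc u) => //; first exact: in_Omega_stop.
  by move=> r rT'; exact: stop_id.
have c1 : (fun i => Jst phi (ramp Tm (p (f i)).2) Tm u (stop Tm (p (f i)).1) (sigma k))
    @ \oo --> Jst phi l Tm u (stop Tm Z) (sigma k).
  apply: (@J_seq_cvg _ _ _ _ _ _ cocyc asA Tm u (fun i => ramp Tm (p (f i)).2) l) => //.
  - by move=> i; exact: in_Omega_stop.
  - exact: in_Omega_stop.
  - apply: loc_unif_cvg_stop => i r rT'; have [_ h _] := Hp (f i).
    by apply: le_trans (h r rT') _; rewrite lef_pV2 ?posrE// ler_nat ltnS.
have c2 : (fun i => Jst phi (ramp Tm (p (f i)).2) Tm u (stop Tm Z) (sigma k))
    @ \oo --> Jst phi l Tm u (stop Tm Z) (sigma k).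
  apply: (@J_seq_cvg _ _ _ _ _ _ cocyc asA Tm u (fun i => ramp Tm (p (f i)).2) l) => //.
  - by move=> i; exact: in_Omega_stop.
  - exact: in_Omega_stop.
  - exact: loc_unif_cvg_cst.
have d1 : (fun i => ip (Jst phi (ramp Tm (p (f i)).2) Tm u (stop Tm (p (f i)).1)
    (sigma k)) xi) @ \oo --> ip (Jst phi l Tm u (stop Tm Z) (sigma k)) xi.
  by apply: (cvg_comp _ (ip ^~ xi) c1); exact: ip_continuousl.
have d2 : (fun i => ip (Jst phi (ramp Tm (p (f i)).2) Tm u (stop Tm Z) (sigma k)) xi)
    @ \oo --> ip (Jst phi l Tm u (stop Tm Z) (sigma k)) xi.
  by apply: (cvg_comp _ (ip ^~ xi) c2); exact: ip_continuousl.
have d12 : (fun i => ip (Jst phi (ramp Tm (p (f i)).2) Tm u (stop Tm (p (f i)).1)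
    (sigma k)) xi - ip (Jst phi (ramp Tm (p (f i)).2) Tm u (stop Tm Z) (sigma k)) xi)
    @ \oo --> (0 : R).
  rewrite -(subrr (ip (Jst phi l Tm u (stop Tm Z) (sigma k)) xi)); exact: cvgB.
have [N _ /(_ N (leqnn N))] := (cvgr0Pnorm_le _).1 d12 _ e0.
by have [_ _ h] := Hp (f N); rewrite /= !stE.
Qed.

Definition response_int b k xi Z : R := Rintegral leb (itv0 b) (response k xi Z).

Lemma response_int_close k xi Z e : in_Omega Z -> 0 < e -> exists2 dl, 0 < dl &
  forall Z', in_Omega Z' -> (forall r, 0 <= r <= Tm -> `|Z' r - Z r| <= dl) ->
    forall b, 0 <= b <= Tm -> `|response_int b k xi Z' - response_int b k xi Z| <= e.
Proof.
move=> OZ e0; have [dl dl0 h] := response_close k xi OZ (divr_gt0 e0 T0).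
exists dl => // Z' OZ' ZZ' b /andP[b0 bT].
have cZ : continuous (response k xi Z) by exact: response_continuous.
have cZ' : continuous (response k xi Z') by exact: response_continuous.
rewrite /response_int -RintegralB//; last 3 first.
- exact: measurable_itv0.
- exact: integrable_itv0.
- exact: integrable_itv0.
apply: (@le_trans _ _ (e / Tm * b)).
  apply: Rintegral_itv0_le => //.
    by move=> x; apply: cvgB; [exact: cZ'|exact: cZ].
  by move=> x _; exact: h.
by rewrite -mulrA ler_piMr ?(ltW e0)// mulrC ler_pdivrMr// mul1r.
Qed.

Section directions.
Variables (K : nat) (b : 'I_K -> R) (kk : 'I_K -> 'I_n).
Hypothesis bT : forall l, 0 <= b l <= Tm.

Let b0 l : 0 <= b l. Proof. by case/andP: (bT l). Qed.

Definition step_fun (a : 'rV[R]_K) (k : 'I_n) (x : R) : R :=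
  \sum_(l < K) (a ord0 l * (k == kk l)%:R) * \1_(itv0 (b l)) x.

Lemma CM_path_step_fun a : CM_path Tm (step_fun a) = ramps b kk a.
Proof.
apply/funext => r; apply/rowP => k; rewrite mxE /ramps summxE.
case: ltP => r0.
  rewrite big1// => l _; rewrite /ramp_path !mxE.
  by rewrite /ramp max_r ?(ltW r0)// min_l// mulr0 mul0r.
have -> : step_fun a k = (fun x => 1 * step_fun a k x).
  by apply/funext => x; rewrite mul1r.
rewrite (@Rintegral_mul_step R K b (fun l => a ord0 l * (k == kk l)%:R) (fun=> 1)); last first.
  by move=> x; exact: cvg_cst.
apply: eq_bigr => l _; rewrite Rintegral_itv0_cst; last by rewrite !le_min r0 T0' b0.
have -> : Num.min (Num.min r Tm) (b l) = ramp (b l) r.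
  rewrite /ramp (max_l r0) -minA; congr (Num.min _ _).
  by apply: min_r; case/andP: (bT l).
by rewrite mul1r /ramp_path !mxE eqxx/= mulrAC.
Qed.

Lemma rampsD a a' r : ramps b kk (a + a') r = ramps b kk a r + ramps b kk a' r.
Proof.
rewrite /ramps -big_split; apply: eq_bigr => l _.
by rewrite /ramp_path mxE mulrDl scalerDl.
Qed.

Lemma ramps_bound a r : `|ramps b kk a r| <= K%:R * (`|a| * Tm).
Proof.
apply: le_trans (ler_norm_sum _ _ _) _.
rewrite (_ : K%:R * _ = \sum_(l < K) `|a| * Tm); last first.
  by rewrite sumr_const card_ord mulr_natl.
apply: ler_sum => l _; apply/rV_norm_leP; first by rewrite mulr_ge0.
move=> j; rewrite /ramp_path !mxE !normrM -mulrA; apply: ler_pM => //.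
  exact: rV_coord_le.
have /andP[h1 h2] := ramp_bounds r (b0 l).
rewrite (ger0_norm h1) -[leRHS]mulr1; apply: ler_pM => //.
  by apply: le_trans h2 _; case/andP: (bT l).
by case: (_ && _); rewrite ?normr1 ?normr0.
Qed.

Lemma step_fun_bound a k x : `|step_fun a k x| <= K%:R * `|a|.
Proof.
apply: le_trans (ler_norm_sum _ _ _) _.
rewrite (_ : K%:R * _ = \sum_(l < K) `|a|); last by rewrite sumr_const card_ord mulr_natl.
apply: ler_sum => l _; rewrite !normrM -[leRHS]mulr1 -[leRHS]mulr1.
apply: ler_pM => //.
  apply: ler_pM => //; first exact: rV_coord_le.
  by case: (_ == _); rewrite ?normr1 ?normr0.
by rewrite indicE; case: (_ \in _); rewrite ?normr1 ?normr0.
Qed.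

Lemma measurable_step_fun a k : measurable_fun setT (step_fun a k).
Proof.
apply: measurable_sum => l; apply: measurable_funM; first exact: measurable_cst.
by apply: measurable_indic; exact: measurable_itv0.
Qed.

Lemma integral_step_fun_sqr a k :
  (\int[leb]_(x in itv0 Tm) ((step_fun a k x) ^+ 2)%:E <= ((K%:R * `|a|) ^+ 2 * Tm)%:E)%E.
Proof.
have mT := measurable_itv0 Tm.
have mu : leb (itv0 Tm) = Tm%:E.
  rewrite itv0E; have := @lebesgue_measure_itv R `[0, Tm].
  by rewrite /= lte_fin T0 oppr0 adde0.
rewrite EFinM -[X in (_ * X)%E]mu -integral_cst//.
apply: ge0_le_integral => //.
- by move=> x _; rewrite lee_fin sqr_ge0.
- apply/measurable_EFinP; apply: measurable_funTS.
  by apply: measurable_funX; exact: measurable_step_fun.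
- move=> x _; rewrite lee_fin -[leLHS]real_normK ?num_real//.
  by rewrite ler_sqr ?nnegrE ?mulr_ge0//; exact: step_fun_bound.
Qed.

Lemma is_L2_step_fun a k : is_L2 Tm (step_fun a k).
Proof.
split; first by apply: measurable_funTS; exact: measurable_step_fun.
by apply: le_lt_trans (integral_step_fun_sqr a k) _; rewrite ltry.
Qed.

(** Turns a remainder that is small against the Cameron-Martin norm into one that is small against
    [|a|]. *)
Lemma normCM_step_fun a :
  normCM Tm (step_fun a) <= Num.sqrt (n%:R * (K%:R ^+ 2 * Tm)) * `|a|.
Proof.
rewrite -[X in _ * X](ger0_norm (normr_ge0 a)) -sqrtr_sqr -sqrtrM; last first.
  by rewrite !mulr_ge0.
apply: ler_wsqrtr.
rewrite (_ : _ * _ = \sum_(k < n) ((K%:R * `|a|) ^+ 2 * Tm)); last first.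
  by rewrite sumr_const card_ord -[RHS]mulr_natl; ring.
apply: ler_sum => k _; rewrite -lee_fin fineK; first exact: integral_step_fun_sqr.
rewrite ge0_fin_numE; first exact: (is_L2_step_fun a k).2.
by apply: integral_ge0 => x _; rewrite lee_fin sqr_ge0.
Qed.

(** The derivative of the flow at [Z] along [ramps b kk a], paired with [xi]. *)
Definition direction_derivative (a : 'rV[R]_K) xi Z : R :=
  \sum_(l < K) a ord0 l * response_int (b l) (kk l) xi Z.

Lemma frechet_ramps Z xi e : in_Omega Z -> 0 < e -> exists2 dl, 0 < dl &
  forall a, `|a| < dl ->
    `|ip (phi Tm u (fun r => Z r + ramps b kk a r)) xi - ip (phi Tm u Z) xi
      - direction_derivative a xi Z| <= e * `|a|.
Proof.
move=> OZ e0; have [frech _ _ _ _] := asA.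
have [Dw [DwE Dwd]] := frech Tm u Z T0 OZ.
pose C := Num.sqrt (n%:R * (K%:R ^+ 2 * Tm)).
have C1 : 0 < C + 1 by rewrite ltr_wpDl// sqrtr_ge0.
have x1 : 0 < `|xi| + 1 by rewrite ltr_wpDl.
(* The two factors absorb the Cauchy-Schwarz bound and the norm estimate; the added 1s keep them
   positive. *)
have [dl [dl0 hdl]] := Dwd _ (divr_gt0 e0 (mulr_gt0 x1 C1)).
exists (dl / (C + 1)) => [|a adl]; first exact: divr_gt0.
have nC : normCM Tm (step_fun a) <= (C + 1) * `|a|.
  by apply: le_trans (normCM_step_fun a) _; rewrite ler_wpM2r// lerDl.
have nd : normCM Tm (step_fun a) < dl.
  by apply: le_lt_trans nC _; rewrite mulrC -ltr_pdivlMr.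
have L2 k : is_L2 Tm (step_fun a k) := is_L2_step_fun a k.
have := hdl _ L2 nd; rewrite CM_path_step_fun => h.
have -> : direction_derivative a xi Z = ip (Dw (step_fun a)) xi.
  rewrite DwE//.
  transitivity (\sum_(k < n) \sum_(l < K) (a ord0 l * (k == kk l)%:R) *
      response_int (b l) k xi Z).
    rewrite exchange_big; apply: eq_bigr => l _.
    rewrite (bigD1 (kk l))//= eqxx mulr1 big1 ?addr0// => k /negbTE ->.
    by rewrite mulr0 mul0r.
  apply: eq_bigr => k _.
  transitivity (Rintegral leb (itv0 Tm) (fun s => response k xi Z s * step_fun a k s)).
    rewrite (Rintegral_mul_step _ (fun l => a ord0 l * (k == kk l)%:R)); last first.
      exact: response_continuous.
    by apply: eq_bigr => l _; rewrite min_r//; case/andP: (bT l).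
  apply: eq_Rintegral => s; rewrite inE => sT; congr (_ * _).
  by rewrite /response ramp_id.
rewrite -!(ipBl ipP); apply: le_trans (ip_cauchy_schwarz ipP _ _) _.
apply: (@le_trans _ _ (e / ((`|xi| + 1) * (C + 1)) * ((C + 1) * `|a|) * (`|xi| + 1))).
  apply: ler_pM => //; last by rewrite lerDl.
  apply: le_trans h _; apply: ler_wpM2l => //.
  by rewrite divr_ge0 ?(ltW e0)// ltW// mulr_gt0.
rewrite le_eqVlt; apply/orP; left; apply/eqP; field.
by rewrite !gt_eqF.
Qed.

(** Differentiability is used at the moving base path, which gives a derivative at every [r], as the
    mean value theorem requires. *)
Lemma ramps_is_derive Z a xi (r : R) : in_Omega Z ->
  is_derive r 1 (fun r : R => ip (phi Tm u (fun x => Z x + ramps b kk (r *: a) x)) xi)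
    (direction_derivative a xi (fun x => Z x + ramps b kk (r *: a) x)).
Proof.
move=> OZ; set f := fun r : R => _; set Z0 := fun x => Z x + ramps b kk (r *: a) x.
set D := direction_derivative a xi Z0.
have OZ0 : @in_Omega R n Z0 by apply: in_OmegaD => //; exact: in_Omega_ramps.
have lim : h^-1 *: (f (h *: 1 + r) - f r) @[h --> 0^'] --> D.
  apply/cvgrPdist_le => e e0.
  have a1 : 0 < `|a| + 1 by rewrite ltr_wpDl.
  have [dl dl0 hdl] := frechet_ramps xi OZ0 (divr_gt0 e0 a1).
  near=> h.
  have h0 : h != 0 by near: h; exact: nbhs_dnbhs_neq.
  have hd : `|h| < dl / (`|a| + 1) by near: h; apply: dnbhs0_lt; exact: divr_gt0.
  have had : `|h *: a| < dl.
    rewrite normrZ; apply: (@le_lt_trans _ _ (`|h| * (`|a| + 1))).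
      by rewrite ler_wpM2l// lerDl.
    by rewrite -ltr_pdivlMr.
  have := hdl _ had.
  have -> : (fun x => Z0 x + ramps b kk (h *: a) x) =
      (fun x => Z x + ramps b kk ((h *: 1 + r) *: a) x).
    apply/funext => x; rewrite /Z0 -addrA -rampsD -scalerDl.
    by rewrite [h *: 1]mulr1 [r + h]addrC.
  have -> : direction_derivative (h *: a) xi Z0 = h * D.
    by rewrite /D mulr_sumr; apply: eq_bigr => l _; rewrite mxE mulrA.
  rewrite -/(f _) -/(f r) normrZ => hh.
  have -> : D - h^-1 *: (f (h *: 1 + r) - f r) =
      h^-1 * (h * D - (f (h *: 1 + r) - f r)).
    by rewrite mulrBr mulKf.
  rewrite normrM distrC normfV -ler_pdivlMl ?invr_gt0 ?normr_gt0// invrK.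
  apply: le_trans hh _.
  have -> : e / (`|a| + 1) * (`|h| * `|a|) = `|h| * (e * (`|a| / (`|a| + 1))) by ring.
  by rewrite ler_wpM2l// ler_piMr ?(ltW e0)// ler_pdivrMr// mul1r lerDl.
split; first by apply/cvg_ex; exists D.
exact: cvg_lim lim.
Unshelve. all: by end_near. Qed.

End directions.

Lemma finite_common_radius (I : Type) (s : seq I) (Q : I -> R -> Prop) :
  (forall i, exists2 dl, 0 < dl & Q i dl) ->
  (forall i dl dl', dl' <= dl -> Q i dl -> Q i dl') ->
  exists2 dl, 0 < dl & forall i, List.In i s -> Q i dl.
Proof.
move=> hQ mono; elim: s => [|i s [dl dl0 IH]]; first by exists 1.
have [dl' dl'0 h] := hQ i; exists (Num.min dl dl'); first by rewrite lt_min dl0.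
move=> j /= [<-|js]; first by apply: mono h; rewrite ge_min lexx orbT.
by apply: mono (IH _ js); rewrite ge_min lexx.
Qed.

Lemma in_List (I : eqType) (i : I) (s : seq I) : i \in s -> List.In i s.
Proof.
by elim: s => // j s IH; rewrite inE => /orP[/eqP ->|/IH]; [left|right].
Qed.

(** By the choice of [B], the derivative in [c] at [Zb] is the identity. Each coordinate is a real
    function along the segment from [c'] to [c], and the mean value theorem bounds its deviation by
    that of the derivative at a path close to [Zb]. *)
Lemma controlled_half_lipschitz (m K : nat) (b : 'I_K -> R) (kk : 'I_K -> 'I_n)
    (xis : 'I_m -> X) (B : 'M[R]_(m, K)) Zb :
  (forall l, 0 <= b l <= Tm) -> in_Omega Zb ->
  B *m (\matrix_(l, j) response_int (b l) (kk l) (xis j) Zb) = 1%:M ->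
  exists e delta, [/\ 0 < e, 0 < delta & forall Z, in_Omega Z ->
    (forall r, 0 <= r <= Tm -> `|Z r - Zb r| <= e) ->
    half_lipschitz_dev (fun c => \row_j ip (phi Tm u
      (fun r => Z r + ramps b kk (c *m B) r)) (xis j)) delta].
Proof.
move=> bT OZb B1; have b0 l : 0 <= b l by case/andP: (bT l).
pose be := \sum_(i < m) \sum_(l < K) `|B i l|.
have be0 : 0 <= be by apply: sumr_ge0 => i _; apply: sumr_ge0.
have Bc (c : 'rV[R]_m) : `|c *m B| <= be * `|c|.
  apply/rV_norm_leP; first by rewrite mulr_ge0.
  move=> l; rewrite mxE; apply: le_trans (ler_norm_sum _ _ _) _.
  rewrite /be mulr_suml; apply: ler_sum => i _; rewrite normrM mulrC.
  apply: ler_pM => //; last exact: rV_coord_le.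
  by rewrite (bigD1 l)//= lerDl sumr_ge0.
have q0 : 0 < 2 * (K%:R * be + 1) by rewrite mulr_gt0// ltr_wpDl// mulr_ge0.
(* With this [eta], the [K] terms, each at most [be * |c - c'| * eta], add up to at most
   [|c - c'| / 2]. *)
have eta0 : 0 < (2 * (K%:R * be + 1))^-1 by rewrite invr_gt0.
set eta := _^-1 in eta0.
pose Q (lj : 'I_K * 'I_m) dl := forall Z', in_Omega Z' ->
  (forall r, 0 <= r <= Tm -> `|Z' r - Zb r| <= dl) ->
  `|response_int (b lj.1) (kk lj.1) (xis lj.2) Z' -
    response_int (b lj.1) (kk lj.1) (xis lj.2) Zb| <= eta.
have [||dl dl0 hdl] := @finite_common_radius _ (enum {: 'I_K * 'I_m}) Q.
- move=> lj; have [dl dl0 h] := response_int_close (kk lj.1) (xis lj.2) OZb eta0.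
  by exists dl => // Z' OZ' ZZ'; exact: h.
- move=> lj d1 d2 d21 h Z' OZ' ZZ'; apply: h => // r rT.
  exact: le_trans (ZZ' r rT) d21.
have {}hdl lj : Q lj dl by apply: hdl; apply: in_List; rewrite mem_enum.
(* [w] bounds the size of the ramps per unit of parameter; half of [dl] is spent on [Z - Zb], the
   other half on the ramps. *)
pose w := K%:R * (be * Tm) + 1.
have w0 : 0 < w by rewrite ltr_wpDl// mulr_ge0// mulr_ge0.
exists (dl / 2), (dl / 2 / w); split; rewrite ?divr_gt0//.
move=> Z OZ ZZb c c' cd c'd.
have dw : 0 < dl / 2 / w by rewrite !divr_gt0.
apply/rV_norm_leP; first by rewrite divr_ge0.
move=> j; rewrite !mxE.
pose Z1 : bpath R n := fun r => Z r + ramps b kk (c' *m B) r.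
have OZ1 : in_Omega Z1 by apply: in_OmegaD => //; exact: in_Omega_ramps.
pose a := (c - c') *m B.
pose f (t : R) := ip (phi Tm u (fun x => Z1 x + ramps b kk (t *: a) x)) (xis j).
pose df (t : R) := direction_derivative b kk a (xis j) (fun x => Z1 x + ramps b kk (t *: a) x).
have fd (t : R) : is_derive t 1 f (df t) by exact: (@ramps_is_derive K b kk bT Z1 a (xis j) t OZ1).
have fc : {within `[0, 1], continuous f}.
  apply: continuous_subspaceT => t; apply: differentiable_continuous.
  by apply/derivable1_diffP; exact: (@ex_derive _ _ _ _ _ _ _ (fd t)).
have [t /[!in_itv]/= /andP[t0 t1] fE] := MVT ltr01 (fun t _ => fd t) fc.
rewrite subr0 mulr1 in fE.
have -> : ip (phi Tm u (fun r => Z r + ramps b kk (c *m B) r)) (xis j) = f 1.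
  rewrite /f; congr (ip (phi Tm u _) _); apply/funext => x.
  rewrite /Z1 scale1r -addrA -rampsD /a -mulmxDl; congr (_ + ramps b kk (_ *m B) x).
  by rewrite addrC subrK.
have -> : ip (phi Tm u (fun r => Z r + ramps b kk (c' *m B) r)) (xis j) = f 0.
  rewrite /f; congr (ip (phi Tm u _) _); apply/funext => x.
  rewrite /Z1 scale0r /ramps [X in _ = _ + X]big1 ?addr0// => l _.
  by rewrite /ramp_path mxE mul0r scale0r.
rewrite fE.
(* The identity derivative at [Zb], written as the same sum as [df] so that the two can be
   subtracted termwise. *)
have cE : c ord0 j - c' ord0 j = \sum_(l < K) a ord0 l * response_int (b l) (kk l) (xis j) Zb.
  transitivity ((a *m (\matrix_(l, j) response_int (b l) (kk l) (xis j) Zb)) ord0 j).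
    by rewrite /a -mulmxA B1 mulmx1 !mxE.
  by rewrite [LHS]mxE; apply: eq_bigr => l _; congr (_ * _); rewrite mxE.
rewrite cE /df /direction_derivative -sumrB.
apply: le_trans (ler_norm_sum _ _ _) _.
set Zt := fun x => Z1 x + ramps b kk (t *: a) x.
have OZt : @in_Omega R n Zt by apply: in_OmegaD => //; exact: in_Omega_ramps.
have Ztb r : 0 <= r <= Tm -> `|Zt r - Zb r| <= dl.
  move=> rT.
  have -> : Zt r - Zb r = (Z r - Zb r) + ramps b kk ((c' + t *: (c - c')) *m B) r.
    have -> : (c' + t *: (c - c')) *m B = c' *m B + t *: a.
      by rewrite mulmxDl /a scalemxAl.
    rewrite rampsD /Zt /Z1 -!addrA; congr (_ + _).
    by rewrite [RHS]addrC -addrA.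
  apply: le_trans (ler_normD _ _) _; rewrite [leRHS](splitr dl).
  apply: lerD; first exact: ZZb.
  apply: le_trans (ramps_bound kk bT _ _) _.
  (* A convex combination of [c] and [c'], hence still in the ball. *)
  have cc : `|c' + t *: (c - c')| <= dl / 2 / w.
    rewrite (_ : _ + _ = t *: c + (1 - t) *: c'); last first.
      by apply/rowP => i; rewrite !mxE; ring.
    apply: le_trans (ler_normD _ _) _; rewrite !normrZ.
    rewrite (gtr0_norm t0) gtr0_norm ?subr_gt0//.
    have h1 : t * `|c| <= t * (dl / 2 / w) by rewrite ler_wpM2l// ltW.
    have h2 : (1 - t) * `|c'| <= (1 - t) * (dl / 2 / w).
      by rewrite ler_wpM2l// subr_ge0 ltW.
    lra.
  apply: (@le_trans _ _ (K%:R * (be * (dl / 2 / w) * Tm))).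
    rewrite ler_wpM2l// ler_wpM2r// (le_trans (Bc _))// ler_wpM2l//.
  have -> : K%:R * (be * (dl / 2 / w) * Tm) = K%:R * (be * Tm) * (dl / 2 / w) by ring.
  apply: (@le_trans _ _ (w * (dl / 2 / w))).
    by rewrite ler_wpM2r ?(ltW dw)// /w lerDl.
  by rewrite mulrC divfK// gt_eqF.
apply: (@le_trans _ _ (\sum_(l < K) be * `|c - c'| * eta)).
  apply: ler_sum => l _; rewrite -mulrBr normrM; apply: ler_pM => //.
    exact: le_trans (rV_coord_le _ _) (Bc _).
  exact: (hdl (l, j)).
rewrite sumr_const card_ord -[leLHS]mulr_natl /eta.
have -> : K%:R * (be * `|c - c'| / (2 * (K%:R * be + 1))) =
   `|c - c'| / 2 * (K%:R * be / (K%:R * be + 1)).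
  by field; rewrite gt_eqF// ltr_wpDl// mulr_ge0.
rewrite ler_piMr ?divr_ge0// ler_pdivrMr ?mul1r ?lerDl// ltr_wpDl// mulr_ge0//.
Qed.

End flow_derivative.

(** * Full rank from the Gramian *)

Section full_rank.
Context (R : realType) (X : completeNormedModType R) (ip : X -> X -> R).
Context (n : nat) (sigma : 'I_n -> X) (phi : R -> X -> bpath R n -> X).
Hypotheses (ipP : is_inner_product ip) (cocyc : is_cont_adapted_cocycle phi).
Hypothesis asA : assumptionA ip sigma phi.

Lemma ip_sumr (I : finType) (a : I -> R) (y : I -> X) x :
  ip x (\sum_j a j *: y j) = \sum_j a j * ip x (y j).
Proof.
elim/big_rec2: _ => [|j b c _ IH]; first by rewrite (ipC ipP) (ip0l ipP).
by rewrite (ipDr ipP) (ipZr ipP) IH.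
Qed.

(* If [eta], a combination of the [xis], is orthogonal to the response to every
   ramp, then the Gramian at time [t] vanishes at [J_{t,t+s}^* eta]. *)
Lemma full_rank_directions (m : nat) (xis : 'I_m -> X) (u : X) (t s : R)
    (V Zb : bpath R n) :
  (forall a : 'I_m -> R, (exists j, a j != 0) -> \sum_j a j *: xis j != 0) ->
  0 < t -> 0 < s -> in_Omega V -> in_Omega Zb ->
  (forall r, 0 <= r <= t -> V r = Zb r) ->
  gramian_nondegenerate ip sigma phi t u V ->
  exists (K : nat) (q : 'I_K -> nat * nat) (kk : 'I_K -> 'I_n) (B : 'M[R]_(m, K)),
    (forall l, ((q l).2 <= 2 ^ (q l).1)%N) /\
    B *m (\matrix_(l, j) response_int ip sigma phi u (t + s)
      (grid (t + s) (q l).1 (q l).2) (kk l) (xis j) Zb) = 1%:M.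
Proof.
move=> free t0 s0 OV OZ VZ nondeg.
pose Tm := t + s; have T0 : 0 < Tm by rewrite addr_gt0.
pose I := ({p : nat * nat | (p.2 <= 2 ^ p.1)%N} * 'I_n)%type.
pose v (i : I) : 'rV[R]_m := \row_j response_int ip sigma phi u Tm
  (grid Tm (val i.1).1 (val i.1).2) i.2 (xis j) Zb.
have [|K [l [B BE]]] := @spanning_family R m I v; last first.
  exists K, (fun j => val (l j).1), (fun j => (l j).2), B; split.
    by move=> j; exact: (valP (l j).1).
  by rewrite -BE; congr (_ *m _); apply/matrixP => i j; rewrite !mxE.
move=> a a0; apply: contrapT => nv.
have {}nv i : v i *m a = 0.
  by apply/eqP/negPn/negP => h; apply: nv; exists i.
pose xa := \sum_j a j ord0 *: xis j.
have xa0 : xa != 0.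
  apply: free; apply: contrapT => h; move/negP: a0; apply; apply/eqP/matrixP => j j'.
  rewrite (ord1 j') mxE; apply/eqP/negPn/negP => aj; apply: h; by exists j.
have cr k xi : continuous (response ip sigma phi u Tm k xi Zb).
  exact: (response_continuous ipP cocyc asA).
(* All integrals of the response over [[0, b]] with [b] dyadic vanish, so the continuous response
   vanishes. *)
have resp0 k r : 0 <= r <= Tm -> response ip sigma phi u Tm k xa Zb r = 0.
  apply: (dyadic_integrals_eq0 T0 (cr k xa)) => N i iN.
  have rE : response ip sigma phi u Tm k xa Zb =
      (fun x => \sum_(j < m) a j ord0 * response ip sigma phi u Tm k (xis j) Zb x).
    by apply/funext => x; rewrite /response /xa ip_sumr.
  have iI j : (@lebesgue_measure R).-integrable (itv0 (grid Tm N i))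
      (EFin \o (fun x => a j ord0 * response ip sigma phi u Tm k (xis j) Zb x)).
    apply: integrable_itv0 => x; apply: cvgM; [exact: cvg_cst|exact: cr].
  rewrite rE (Rintegral_sum _ (measurable_itv0 _) iI).2.
  have /matrixP/(_ ord0 ord0) nvE := nv (exist _ (N, i) iN, k).
  rewrite !mxE in nvE; rewrite -[RHS]nvE.
  apply: eq_bigr => j _; rewrite RintegralZl ?mxE; first by rewrite mulrC.
    exact: measurable_itv0.
  exact: integrable_itv0.
have [_ _ _ _ adj] := asA.
have tT : 0 <= t <= t + s by rewrite (ltW t0)/= lerDl ltW.
have [Js [JsA Jsi]] := adj t (t + s) u Zb tT OZ.
(* [Js] is not given as a linear map; the adjoint identity at [Js 0] shows that this vector has norm
   0. *)
have Js0 : Js 0 = 0.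
  apply/eqP; rewrite -normr_eq0 -sqrf_eq0 -(ipxx ipP) -JsA.
  by rewrite (ipC ipP) (ip0l ipP).
have eta0 : Js xa != 0.
  by apply/eqP => h; move/eqP: xa0; apply; apply: Jsi; rewrite h Js0.
have := nondeg _ eta0; rewrite /gramian big1 ?ltxx// => k _.
transitivity (Rintegral (@lebesgue_measure R) (itv0 t) (fun=> 0)); last first.
  by rewrite Rintegral_itv0_cst ?mul0r// ltW.
apply: eq_Rintegral => r; rewrite inE => /= rt.
have rT : 0 <= r <= t + s.
  by case/andP: rt => r0 rt; rewrite r0 (le_trans rt)// lerDl ltW.
(* Moving [Js] to the other side and composing the two Jacobians turns this pairing into the
   response at time [r]. *)
suff -> : ip (Jst phi r t u V (sigma k)) (Js xa) = 0 by rewrite mul0r.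
rewrite (J_adapted cocyc u OV OZ VZ rt) -JsA -(J_chain cocyc asA) ?(ltW s0)//.
by have := resp0 k r rT; rewrite /response ramp_id.
Qed.

End full_rank.

(** * Positivity of the density *)

Theorem theorem4p13 (R : realType) (X : completeNormedModType R) (ip : X -> X -> R)
    (n m : nat) (sigma : 'I_n -> X) (phi : R -> X -> bpath R n -> X)
    (pi : {linear X -> 'rV[R]_m})
    (u : X) (t : R) (V : bpath R n) (s : R)
    (d : measure_display) (T : measurableType d) (P : probability T R)
    (W : T -> bpath R n)
    (lam : {measure set (m.-tuple R) -> \bar R}) (p : m.-tuple R -> R) :
  is_inner_product ip ->
  is_cont_adapted_cocycle phi ->
  assumptionA ip sigma phi ->
  continuous pi -> (forall y, exists x, pi x = y) ->
  0 < t -> in_Omega V ->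
  gramian_nondegenerate ip sigma phi t u V ->
  exactly_controllable phi pi ->
  is_two_sided_BM P W ->
  is_lebesgue_Rm lam ->
  0 < s ->
  has_density P lam (fun w => rv2t (pi (phi (t + s) u (W w)))) p ->
  {ae lam, forall x, 0 < p x}.
Proof.
move=> ipP cocyc asA cpi spi t0 OV nondeg ctrl BM lamP s0 [mp p0 pP].
have T0 : 0 < t + s by rewrite addr_gt0.
have /choice[xis xisP] : forall j : 'I_m, exists xi, forall x, (pi x) ord0 j = ip x xi.
  move=> j; apply: (riesz_representation ipP (l := fun x => pi x ord0 j)).
    by move=> a x y; rewrite linearP !mxE.
  move=> x; apply: (cvg_comp pi (fun v : 'rV[R]_m => v ord0 j) (cpi x)).
  exact: coord_continuous.
have piE x : pi x = \row_j ip x (xis j) by apply/rowP => j; rewrite mxE xisP.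
(* Pairing the combination with a preimage of [a] under [pi] gives the sum of the squares of the
   [a j]. *)
have free (a : 'I_m -> R) : (exists j, a j != 0) -> \sum_j a j *: xis j != 0.
  move=> [j aj]; apply/eqP => h; have [x xa] := spi (\row_j a j).
  have : ip x (\sum_j a j *: xis j) = 0 by rewrite h (ipC ipP) (ip0l ipP).
  rewrite (ip_sumr ipP) => /eqP; apply/negP; rewrite gt_eqF//.
  under eq_bigr do rewrite -xisP xa mxE.
  rewrite (bigD1 j)//= ltr_pwDl//; last by apply: sumr_ge0 => i _; rewrite -expr2 sqr_ge0.
  by rewrite -expr2 exprn_even_gt0.
pose F Z := pi (phi (t + s) u Z).
have Fcont (Vk : nat -> bpath R n) Z : (forall k, in_Omega (Vk k)) -> in_Omega Z ->
    loc_unif_cvg Vk Z -> (fun k => F (Vk k)) @ \oo --> F Z.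
  move=> OVk OZ VkZ; apply: (cvg_comp (fun k => phi (t + s) u (Vk k)) pi); last exact: cpi.
  exact: (@phi_seq_cvg _ _ _ _ cocyc (t + s) u Vk Z (ltW T0) OVk OZ VkZ).
have Fadapt Z Z' : in_Omega Z -> in_Omega Z' ->
    (forall r, 0 <= r <= t + s -> Z r = Z' r) -> F Z = F Z'.
  by move=> OZ OZ' ZZ'; rewrite /F (phi_adapted cocyc u (ltW T0) OZ OZ' ZZ').
(* The density vanishes on [A], so the law of [F W] does not charge [A], whatever its Lebesgue
   measure. *)
pose A := [set x | p x = 0].
have mA : measurable A.
  by have := mp measurableT _ (measurable_set1 (0 : R)); rewrite setTI.
have PA : P [set w | A (rv2t (F (W w)))] = 0%E.
  rewrite (pP A mA) (eq_integral (cst 0%E)) ?integral0// => x; rewrite inE => px.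
  by rewrite (px : p x = 0).
exists A; split => //; last first.
  by move=> x /= /negP; rewrite lt_def p0 andbT negbK => /eqP.
apply: (lam_null_local mA) => y.
have [z zy] := spi y; have [V' [OV' _ V'z]] := ctrl (phi t u V) z s s0.
(* Concatenation: the first term freezes [V] after time [t], and the second stays at [V' 0 = 0]
   until then. *)
pose Zb : bpath R n := fun r => V (ramp t r) + V' (ramp s (r - t)).
have r0 (c x : R) : 0 < c -> x <= 0 -> ramp c x = 0.
  by move=> c0 x0; rewrite /ramp max_r// min_l// ltW.
have OZb : in_Omega Zb.
  split; last by rewrite /Zb sub0r !r0 ?oppr_le0 ?(ltW t0)// OV.2 OV'.2 addr0.
  move=> r; apply: cvgD.
    by apply: (cvg_comp (ramp t) V); [exact: ramp_continuous|exact: OV.1].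
  apply: (cvg_comp (fun r : R => ramp s (r - t)) V'); last exact: OV'.1.
  apply: (cvg_comp (fun r : R => r - t) (ramp s)); last exact: ramp_continuous.
  by apply: cvgB; [exact: cvg_id|exact: cvg_cst].
have VZb r : 0 <= r <= t -> V r = Zb r.
  move=> rt; rewrite /Zb ramp_id// r0 ?OV'.2 ?addr0// subr_le0.
  by case/andP: rt.
have V'Zb r : 0 <= r <= s -> Defs.shift t Zb r = V' r.
  move=> rs; have /andP[r_ge0 _] := rs.
  have E : ramp t (r + t) = t by rewrite /ramp max_l ?min_r ?addr_ge0 ?(ltW t0)// lerDr.
  rewrite /Defs.shift /Zb addrK subrr E (r0 s 0)// !ramp_id ?lexx ?(ltW t0)//.
  by rewrite OV'.2 addr0 addrC addKr.
have FZb : F Zb = y.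
  have [_ coc _ _] := cocyc.
  rewrite /F addrC coc ?(ltW s0) ?(ltW t0)//.
  rewrite -(phi_adapted cocyc u (ltW t0) OV OZb VZb).
  by rewrite (phi_adapted cocyc _ (ltW s0) (in_Omega_shift t OZb) OV' V'Zb) V'z.
have [K [q [kk [B [qP BE]]]]] :=
  full_rank_directions ipP cocyc asA free t0 s0 OV OZb VZb nondeg.
pose b l := grid (t + s) (q l).1 (q l).2.
have bT l : 0 <= b l <= t + s.
  by rewrite grid_ge0//= -[leRHS](grid_end (t + s) (q l).1) ler_grid.
have [e [delta [e0 d0 contr]]] := controlled_half_lipschitz ipP cocyc asA T0 bT OZb BE.
(* [S] dominates each [|xis j|], so flow values within [delta / 16 / S] have images under [pi]
   within [delta / 16]. *)
pose S := \sum_j `|xis j| + 1.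
have S0 : 0 < S by rewrite ltr_wpDl// sumr_ge0.
have d16 : 0 < delta / 16 by rewrite divr_gt0.
have [e' e'0 close] := flow_close cocyc u T0 OZb (divr_gt0 d16 S0).
(* [Z] must be close enough both for the Lipschitz bound and for [F Z] to lie within [delta / 16] of
   [y]. *)
have m0 : 0 < Num.min e e' by rewrite lt_min e0.
have [Z [OZ ZZb mG GA]] :=
  exists_good_path BM T0 Fcont Fadapt lamP kk B mA PA OZb m0 d0 qP.
have ZZb1 r : 0 <= r <= t + s -> `|Z r - Zb r| <= e.
  by move=> rT; have := ZZb r rT; rewrite le_min => /andP[].
have ZZb2 r : 0 <= r <= t + s -> `|Z r - Zb r| <= e'.
  by move=> rT; have := ZZb r rT; rewrite le_min => /andP[].
exists (delta / 16) => //.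
pose g c := F (fun r => Z r + ramps b kk (c *m B) r).
apply: (half_lipschitz_dev_null lamP d0 (g := g)) => //.
- have -> : g = (fun c => \row_j ip (phi (t + s) u
      (fun r => Z r + ramps b kk (c *m B) r)) (xis j)).
    by apply/funext => c; rewrite /g /F piE.
  exact: contr.
have -> : g 0 = F Z.
  rewrite /g; congr F; apply/funext => r; rewrite mul0mx /ramps big1 ?addr0// => l _.
  by rewrite /ramp_path mxE mul0r scale0r.
rewrite -FZb /F; apply/rV_norm_leP; first exact: ltW.
move=> j; rewrite !mxE !xisP -(ipBl ipP).
apply: le_trans (ip_cauchy_schwarz ipP _ _) _.
apply: (@le_trans _ _ (delta / 16 / S * S)); last by rewrite divfK// gt_eqF.
apply: ler_pM => //; first exact: close.
by rewrite /S (bigD1 j)//= -addrA lerDl addr_ge0// sumr_ge0.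
Qed.
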